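(* Let $D\subset S^{\mathbb{Z}}$, $S=\{\alpha_1,\alpha_2,\alpha_1^{-1},\alpha_2^{-1}\}$, be the Dyck shift, and let $f:D\to\mathbb{R}$ be a site-potential. Then every equilibrium measure for $f$ is a Gibbs measure for $f$.
   Context: Dyck shift: on $S^*\cup\{0\}$ (finite words over $S$, together with an absorbing symbol $0$) consider the associative operation given by concatenation subject to the reduction rules $\alpha_j\ast\alpha_j^{-1}=\Lambda$ (the empty word) for $j=1,2$, and $\alpha_i\ast\alpha_j^{-1}=0$ for $i\ne j$. $D$ is the subshift of all $x\in S^{\mathbb{Z}}$ containing no finite subword that reduces to $0$ under these rules. $T$ denotes the shift map, $(Tx)_n=x_{n+1}$. A site-potential is a function $f:D\to\mathbb{R}$ of the form $f(x)=f_1,f_2,f_3,f_4$ according as $x_0=\alpha_1,\alpha_2,\alpha_1^{-1},\alpha_2^{-1}$ respectively, with $f_1,\ldots,f_4\in\mathbb{R}$. Gibbs relation: $\mathfrak{T}_D$ is the set of pairs $(x,y)\in D\times D$ with $x_n=y_n$ for all but finitely many $n\in\mathbb{Z}$. For $(x,y)\in\mathfrak{T}_D$ let $\phi_f(x,y)=\sum_{n\in\mathbb{Z}}\big(f(T^n y)-f(T^n x)\big)$ (a finite sum for a site-potential). Gibbs measures: a $\mathfrak{T}_D$-holonomy is a Borel isomorphism $\gamma:A\to B$ between Borel sets $A,B\subset D$ with $(x,\gamma(x))\in\mathfrak{T}_D$ for all $x\in A$. A Borel probability measure $\mu$ on $D$ is a Gibbs measure for $f$ if it is $\mathfrak{T}_D$-nonsingular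 (the $\mathfrak{T}_D$-saturation of every $\mu$-null Borel set is $\mu$-null) and for every $\mathfrak{T}_D$-holonomy $\gamma:A\to B$, $\frac{d\mu\circ\gamma}{d\mu}(x)=\exp(\phi_f(x,\gamma(x)))$ for $\mu$-a.e. $x\in A$, where $(\mu\circ\gamma)(E)=\mu(\gamma(E))$. Equilibrium: $P(f)=\lim_{n\to\infty}\frac1n\log\sum_{a\in L_n(D)}\exp\big[\sup_{x\in[a]}\sum_{m=1}^{n}f(T^m x)\big]$, where $L_n(D)$ is the set of words $x_{1}\cdots x_n$, $x\in D$, and $[a]=\{x\in D:x_1\cdots x_n=a\}$. For a shift-invariant Borel probability measure $\mu$ on $D$, $P_\mu(f)=h_\mu(D,T)+\int f\,d\mu$ with $h_\mu$ the Kolmogorov entropy. $\mu$ is an equilibrium measure for $f$ if it is shift-invariant and $P_\mu(f)=P(f)$ (equivalently, by the variational principle, $\mu$ maximizes $P_\mu(f)$). *)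

(* Defs.v *)
From HB Require Import structures.
From mathcomp Require Import all_boot all_order all_algebra.
From mathcomp Require Import all_classical all_reals all_analysis.
From mathcomp Require Import measurable_realfun.

Set Implicit Arguments.
Unset Strict Implicit.
Unset Printing Implicit Defensive.

Import Order.TTheory GRing.Theory Num.Theory.
Import numFieldNormedType.Exports.

Local Open Scope classical_set_scope.
Local Open Scope ring_scope.

(* The index j = 1, 2 is encoded as false, true: [Alpha false], [Alpha true],
   [AlphaInv false], [AlphaInv true] are alpha_1, alpha_2, alpha_1^-1,
   alpha_2^-1. *)
Inductive letter := Alpha of bool | AlphaInv of bool.

Definition letter_to_sum (s : letter) : bool + bool :=
  match s with Alpha j => inl j | AlphaInv j => inr j end.

Definition letter_of_sum (s : bool + bool) : letter :=
  match s with inl j => Alpha j | inr j => AlphaInv j end.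

Lemma letter_to_sumK : cancel letter_to_sum letter_of_sum.
Proof. by case. Qed.

HB.instance Definition _ := Finite.copy letter (can_type letter_to_sumK).
HB.instance Definition _ := isPointed.Build letter (Alpha false).
HB.instance Definition _ := hasNbhs.Build letter principal_filter.
HB.instance Definition _ := Discrete_ofNbhs.Build letter erefl.

(* The full shift S^Z with the Borel sigma-algebra of the product topology. *)
Definition fullshift : Type :=
  g_sigma_algebraType (@open {ptws int -> letter}).

HB.instance Definition _ := Measurable.on fullshift.

(* [shiftz n] is the n-th power of the shift map (see [iter_shift], [shiftzD]). *)
Definition shiftz (n : int) (x : fullshift) : fullshift := fun k => x (k + n).

Definition shift_map : fullshift -> fullshift := shiftz 1.

Lemma iter_shift (n : nat) (x : fullshift) : iter n shift_map x = shiftz n%:Z x.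
Proof.
elim: n => [|n IHn] /=; rewrite /shift_map /shiftz; apply/funext => k.
  by rewrite addr0.
by rewrite IHn /shiftz -addrA -[n.+1]add1n PoszD.
Qed.

Lemma shiftzD (m n : int) (x : fullshift) :
  shiftz m (shiftz n x) = shiftz (m + n) x.
Proof. by rewrite /shiftz; apply/funext => k; rewrite addrA. Qed.

(* [reduces_to_zero w]: the word w reduces to 0 by the rules
   alpha_j * alpha_j^-1 = Lambda and alpha_i * alpha_j^-1 = 0 (i <> j),
   0 being absorbing. *)
Inductive reduces_to_zero : seq letter -> Prop :=
| reduces_mismatch (u v : seq letter) (i j : bool) :
    i <> j -> reduces_to_zero (u ++ [:: Alpha i; AlphaInv j] ++ v)
| reduces_cancel (u v : seq letter) (j : bool) :
    reduces_to_zero (u ++ v) ->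
    reduces_to_zero (u ++ [:: Alpha j; AlphaInv j] ++ v).

Definition dyck : set fullshift :=
  [set x | forall (m : int) (n : nat),
             ~ reduces_to_zero (mkseq (fun i => x (m + i%:Z)) n)].

(* A function on the Dyck shift is represented by a function on the full shift
   whose values outside [dyck] are irrelevant. *)
Definition site_potential (R : realType) (f : fullshift -> R) : Prop :=
  exists f1 f2 f3 f4 : R, forall x, dyck x ->
    f x = match x 0 with
          | Alpha false => f1
          | Alpha true => f2
          | AlphaInv false => f3
          | AlphaInv true => f4
          end.

Definition gibbs_relation (x y : fullshift) : Prop :=
  [/\ dyck x, dyck y & finite_set [set n : int | x n <> y n]].

Definition gibbs_cocycle (R : realType) (f : fullshift -> R)
    (x y : fullshift) : R :=
  \sum_(n \in [set: int]) (f (shiftz n y) - f (shiftz n x)).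

Definition saturation (A : set fullshift) : set fullshift :=
  [set y | exists2 x, A x & gibbs_relation x y].

(* The last clause is the measurability of the inverse map B -> A. *)
Definition holonomy (A B : set fullshift) (g : fullshift -> fullshift) : Prop :=
  [/\ measurable A /\ measurable B,
      set_bij A B g,
      forall x, A x -> gibbs_relation x (g x),
      measurable_fun A g
    & forall E, measurable E -> E `<=` A -> measurable (g @` E)].

(* [rho] is a version of the Radon-Nikodym derivative d nu / d mu on A; only
   the values of the set function nu on measurable subsets of A matter. *)
Definition radon_nikodym_on (R : realType) (mu : probability fullshift R)
    (A : set fullshift) (nu : set fullshift -> \bar R)
    (rho : fullshift -> \bar R) : Prop :=
  [/\ measurable_fun A rho,
      forall x, A x -> (0 <= rho x)%E
    & forall E, measurable E -> E `<=` A ->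
        nu E = (\int[mu]_(x in E) rho x)%E].

(* Borel probability measures on the Dyck shift are the Borel probability
   measures mu on the full shift with mu dyck = 1. *)
Definition gibbs_measure (R : realType) (f : fullshift -> R)
    (mu : probability fullshift R) : Prop :=
  [/\ mu dyck = 1%E,
      forall E, measurable E -> E `<=` dyck -> mu E = 0%E ->
        mu.-negligible (saturation E)
    & forall (A B : set fullshift) (g : fullshift -> fullshift),
        holonomy A B g ->
        exists2 rho : fullshift -> \bar R,
          radon_nikodym_on mu A (fun E => mu (g @` E)) rho
        & {ae mu, forall x, A x ->
             rho x = (expR (gibbs_cocycle f x (g x)))%:E}].

Section entropy.
Context d (T : measurableType d) (R : realType).
Variables (mu : probability T R) (S : T -> T).

(* A finite partition into k pieces is the family of fibres of xi : T -> 'I_k;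
   [refinement_cell xi n w] are the pieces of its join with its preimages
   under S, ..., S^(n-1). *)
Definition refinement_cell (k : nat) (xi : T -> 'I_k) (n : nat)
    (w : {ffun 'I_n -> 'I_k}) : set T :=
  [set x | forall i : 'I_n, xi (iter i S x) = w i].

(* As ln 0 = 0, null pieces contribute 0. *)
Definition block_entropy (k : nat) (xi : T -> 'I_k) (n : nat) : R :=
  - \sum_(w : {ffun 'I_n -> 'I_k})
      fine (mu (refinement_cell xi w)) * ln (fine (mu (refinement_cell xi w))).

Definition partition_entropy (k : nat) (xi : T -> 'I_k) : R :=
  limn (fun n : nat => n%:R^-1 * block_entropy xi n).

Definition kolmogorov_entropy : \bar R :=
  ereal_sup [set h | exists (k : nat) (xi : T -> 'I_k),
    (forall i, measurable (xi @^-1` [set i])) /\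
    h = (partition_entropy xi)%:E].

End entropy.

Definition word (n : nat) (x : fullshift) : n.-tuple letter :=
  [tuple x (i.+1)%:Z | i < n].

Definition language (n : nat) : set (n.-tuple letter) :=
  [set word n x | x in dyck].

Definition cylinder (n : nat) (a : n.-tuple letter) : set fullshift :=
  [set x | dyck x /\ word n x = a].

Definition partition_function (R : realType) (f : fullshift -> R)
    (n : nat) : R :=
  \sum_(a : n.-tuple letter | a \in @language n)
    expR (sup [set \sum_(1 <= m < n.+1) f (iter m shift_map x) | x in cylinder a]).

Definition pressure (R : realType) (f : fullshift -> R) : R :=
  limn (fun n : nat => n%:R^-1 * ln (partition_function f n)).

Definition shift_invariant (R : realType) (mu : probability fullshift R) :
    Prop :=
  forall E, measurable E -> mu (shift_map @^-1` E) = mu E.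

Definition measure_pressure (R : realType) (f : fullshift -> R)
    (mu : probability fullshift R) : \bar R :=
  (kolmogorov_entropy mu shift_map + \int[mu]_(x in dyck) (f x)%:E)%E.

Definition equilibrium_measure (R : realType) (f : fullshift -> R)
    (mu : probability fullshift R) : Prop :=
  [/\ mu dyck = 1%E, shift_invariant mu
    & measure_pressure f mu = (pressure f)%:E].

(* Main.v *)
From HB Require Import structures.
Require Import Defs.
From mathcomp Require Import all_boot all_order all_algebra.
From mathcomp Require Import all_classical all_reals all_analysis.
From mathcomp Require Import measurable_realfun.
From mathcomp Require Import zify ring lra.

(** In a point of the Dyck shift a letter is free if it has no partner. For an
    invariant measure, recurrence leaves three possibilities up to null sets:
    free openings occur arbitrarily far to the left, or free closings occur
    arbitrarily far to the right, or there are no free letters at all.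

    Read a word from right to left, keeping the stack of closings that still
    wait for a partner. For t > 0 the weights
      closing j : e^(f(alpha_j) + f(alpha_j^-1)) / (t lam),
      opening   : t / lam      (its type is forced unless the stack is empty)
    with lam = t + A / t and A = sum_j e^(f(alpha_j) + f(alpha_j^-1)) are the
    transition probabilities of a process, whose word probabilities q(w) equal
    lam^-|w| e^f(w) up to a factor depending only on the free letters of w.
    If t = o := e^f(alpha_1) + e^f(alpha_2), only the free closings matter.
    Comparing an invariant measure without free closings with q, the excess
    n log lam - (H_n + n int f) is the relative entropy K_n up to o(n); so its
    pressure is at most log(o + A / o). By symmetry the bound without free
    openings is log(c + A / c), c the weight of the closings, and without free
    letters t = sqrt A gives log(2 sqrt A), which is strictly smaller than
    max(o + A / o, c + A / c) because o c > A. As this maximum is e^P(f), an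
    equilibrium measure has no mass on the third part and K_n = o(n) on the
    other two. Then, along a subsequence, the conditional law of a block given
    what follows it is close to that of q. To the right of an opening that is
    free before and after a replacement u -> v, the weight q changes exactly by
    e^(f(v) - f(u)); this yields the Gibbs property for u -> v. *)

Set Implicit Arguments.
Unset Strict Implicit.
Unset Printing Implicit Defensive.

Import Order.TTheory GRing.Theory Num.Theory.
Import numFieldNormedType.Exports.

(** * Reduction of words *)

(** In place of an ergodic decomposition, the three parts are treated as unnormalised invariant
    measures: x ln x is superadditive, so the entropy of the whole is at most the sum over the
    parts, and at equilibrium the three upper bounds have to be attained together. The parameter t
    decides how the weight of a matched pair is shared: closing and opening together get
    e^(f(alpha_j) + f(alpha_j^-1)) / lam^2, whatever the share. Beyond [lam], only free letters feel
    t; the value t = o removes the factor of a free opening, and t = sqrt A minimises [lam], the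
    best choice when there are no free letters. The obstacle to the Gibbs property is that a
    replacement may change the partners of letters arbitrarily far away. On the first part the
    damage is confined: every free opening passed on the way to the left raises all later heights by
    one, while a replacement lowers heights by at most twice its length. Hence some opening is free
    before and after, and it shields everything to its left. Its distance to the replaced word is
    unbounded, so the exchange identity is proved for each distance and then assembled. *)

Definition inv_letter (l : letter) : letter :=
  match l with Alpha j => AlphaInv j | AlphaInv j => Alpha j end.

Lemma inv_letterK : involutive inv_letter.
Proof. by case. Qed.

(** The formal inverse of a word. It exchanges openings and closings, so the free openings of [w]
    correspond to the pending closings of [bar w], and only [pend] has to be studied. *)
Definition bar (w : seq letter) : seq letter := map inv_letter (rev w).

Lemma barK : involutive bar.
Proof. by move=> w; rewrite /bar -map_rev revK -map_comp map_id_in // => l _ /=;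
  rewrite inv_letterK. Qed.

Lemma size_bar w : size (bar w) = size w.
Proof. by rewrite size_map size_rev. Qed.

Lemma bar_cat u v : bar (u ++ v) = bar v ++ bar u.
Proof. by rewrite /bar rev_cat map_cat. Qed.

Lemma bar_rcons w l : bar (rcons w l) = inv_letter l :: bar w.
Proof. by rewrite /bar rev_rcons. Qed.

Lemma bar_cons w l : bar (l :: w) = rcons (bar w) (inv_letter l).
Proof. by rewrite /bar rev_cons map_rcons. Qed.

(** The head of the stack is the leftmost waiting closing. An opening that meets the empty stack is
    free and leaves no trace. *)
Definition push (l : letter) (s : option (seq bool)) : option (seq bool) :=
  match l, s with
  | _, None => None
  | AlphaInv j, Some s => Some (j :: s)
  | Alpha _, Some [::] => Some [::]
  | Alpha j, Some (i :: s) => if i == j then Some s else None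
  end.

Lemma push_None l : push l None = None.
Proof. by case: l. Qed.

(* The closings of [w] without a partner in [w], leftmost first; [None] when
   [w] reduces to 0. *)
Definition pend (w : seq letter) : option (seq bool) :=
  foldr push (Some [::]) w.

Lemma pend_cons l w : pend (l :: w) = push l (pend w).
Proof. by []. Qed.

Arguments pend : simpl never.

Lemma foldr_push_None u : foldr push None u = None.
Proof. by elim: u => //= l u ->; rewrite push_None. Qed.

Lemma pend_cat u v : pend (u ++ v) = foldr push (pend v) u.
Proof. by rewrite /pend foldr_cat. Qed.

Lemma reduces_pend w : reduces_to_zero w -> pend w = None.
Proof.
elim=> {w} [u v i j /eqP ij|u v j _]; rewrite !pend_cat /pend /=.
  case: (foldr _ _ v) => [s|] /=; last by rewrite foldr_push_None.
  by rewrite eq_sym (negbTE ij) foldr_push_None.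
by case: (foldr _ _ v) => [s|] //=; rewrite eqxx.
Qed.

Lemma peak_or_valley w :
  (exists u v i j, w = u ++ [:: Alpha i; AlphaInv j] ++ v) \/
  (exists p q, w = map AlphaInv p ++ map Alpha q).
Proof.
elim: w => [|l w [[u [v [i [j ->]]]]|[p [q ->]]]]; first by right; exists [::], [::].
  by left; exists (l :: u), v, i, j.
case: l => j; last by right; exists (j :: p), q.
case: p => [|i p]; first by right; exists [::], (j :: q).
by left; exists [::], (map AlphaInv p ++ map Alpha q), j, i.
Qed.

Lemma pend_openings q : pend (map Alpha q) = Some [::].
Proof. by rewrite /pend; elim: q => //= j q ->. Qed.

Lemma foldr_closings p s : foldr push (Some s) (map AlphaInv p) = Some (p ++ s).
Proof. by elim: p => //= j p ->. Qed.

Lemma pend_valley p q : pend (map AlphaInv p ++ map Alpha q) = Some p.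
Proof. by rewrite pend_cat pend_openings foldr_closings cats0. Qed.

Lemma pend_cancel u v j :
  pend (u ++ [:: Alpha j; AlphaInv j] ++ v) = pend (u ++ v).
Proof. by rewrite !pend_cat /= /pend; case: (foldr _ _ v) => //= s; rewrite eqxx. Qed.

(** Induction along the reduction: by [peak_or_valley] a word contains a mismatch, contains a
    cancelling pair, or is in normal form, closings before openings. *)
Lemma word_ind (P : seq letter -> Prop) :
  (forall u v i j, i != j -> P (u ++ [:: Alpha i; AlphaInv j] ++ v)) ->
  (forall u v j, P (u ++ v) -> P (u ++ [:: Alpha j; AlphaInv j] ++ v)) ->
  (forall p q, P (map AlphaInv p ++ map Alpha q)) -> forall w, P w.
Proof.
move=> H1 H2 H3 w; have [n] := ubnP (size w).
elim: n w => // n IH w wn; have [[u [v [i [j E]]]]|[p [q ->]]] := peak_or_valley w;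
  last exact: H3.
rewrite {}E in wn *; have [->|ij] := eqVneq i j; last exact: H1.
by apply: H2; apply: IH; move: wn; rewrite !size_cat /=; lia.
Qed.

Lemma pend_reduces w : pend w = None -> reduces_to_zero w.
Proof.
elim/word_ind: w => [u v i j ij _|u v j IH|p q].
- by apply: reduces_mismatch; apply/eqP.
- by rewrite pend_cancel => /IH; apply: reduces_cancel.
- by rewrite pend_valley.
Qed.

Lemma reduces_bar w : reduces_to_zero w -> reduces_to_zero (bar w).
Proof.
elim=> {w} [u v i j ij|u v j _]; rewrite !bar_cat /=.
  by rewrite -catA; apply: reduces_mismatch => /esym.
by move=> IH; rewrite -catA; apply: reduces_cancel.
Qed.

Lemma pend_bar_None w : (pend (bar w) == None) = (pend w == None).
Proof.
apply/eqP/eqP => /pend_reduces /reduces_bar /reduces_pend //.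
by rewrite barK.
Qed.

Definition sgn_letter (l : letter) : int := if l is Alpha _ then 1%R else (-1)%R.

Definition ht (w : seq letter) : int := (\sum_(l <- w) sgn_letter l)%R.

Lemma ht_cat u v : ht (u ++ v) = (ht u + ht v)%R.
Proof. by rewrite /ht big_cat. Qed.

Lemma ht_cons l w : ht (l :: w) = (sgn_letter l + ht w)%R.
Proof. by rewrite /ht big_cons. Qed.

Lemma ht_rcons l w : ht (rcons w l) = (ht w + sgn_letter l)%R.
Proof. by rewrite -cats1 ht_cat /ht big_seq1. Qed.

Lemma ht_nil : ht [::] = 0%R.
Proof. by rewrite /ht big_nil. Qed.

Definition npend (w : seq letter) : nat := if pend w is Some s then size s else 0.

(** Cancelling a pair changes neither side, and in the normal form free openings count 1 and free
    closings -1. *)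
Lemma npend_ht w : pend w != None -> ((npend (bar w))%:Z - (npend w)%:Z)%R = ht w.
Proof.
elim/word_ind: w => [u v i j ij|u v j|p q].
- rewrite (_ : pend _ = None) //; apply: reduces_pend.
  by apply: reduces_mismatch; apply/eqP.
- rewrite pend_cancel => IH /IH; rewrite /npend pend_cancel.
  by rewrite !bar_cat /= -catA pend_cancel !ht_cat !ht_cons ?ht_nil /= => ->; lia.
- move=> _; have E : bar (map AlphaInv p ++ map Alpha q) =
     map AlphaInv (rev q) ++ map Alpha (rev p).
    by rewrite bar_cat /bar -!map_rev -!map_comp.
  rewrite /npend E !pend_valley size_rev ht_cat.
  have -> : ht (map AlphaInv p) = (- (size p)%:Z)%R.
    by elim: p {E} => [|i p IH] /=; rewrite ?ht_nil // ht_cons IH /=; lia.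
  have -> : ht (map Alpha q) = ((size q)%:Z)%R.
    by elim: q {E} => [|i q IH] /=; rewrite ?ht_nil // ht_cons IH /=; lia.
  by lia.
Qed.

(** The free openings of [u] consume the top of the stack [s]; the closings pending in [u] itself
    end up above what remains. *)
Lemma foldr_push_pend u s s' : foldr push (Some s) u = Some s' ->
  exists s1 k, pend u = Some s1 /\ s' = s1 ++ drop k s.
Proof.
elim: u s' => [|l u IH] s' /=.
  by case=> <-; exists [::], 0; rewrite drop0.
case E: (foldr push (Some s) u) => [t|] /=; last by rewrite push_None.
have [s1 [k [E1 ->]]] := IH _ E; rewrite pend_cons E1.
case: l => j /=; last by case=> <-; exists (j :: s1), k.
case: s1 {E1} => [|i s1] /=.
  case D: (drop k s) => [|i r] /=.
    by case=> <-; exists [::], k; rewrite D.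
  case: eqP => // _ [<-]; exists [::], k.+1; split=> //=.
  by rewrite -add1n -drop_drop D drop1.
by case: eqP => // _ [<-]; exists s1, k.
Qed.

Lemma pend_suffix u v : pend (u ++ v) != None -> pend v != None.
Proof. by rewrite pend_cat; case: (pend v) => //; rewrite foldr_push_None. Qed.

Lemma pend_prefix u v : pend (u ++ v) != None -> pend u != None.
Proof.
rewrite pend_cat; case: (pend v) => [s|]; last by rewrite foldr_push_None.
by case E: (foldr _ _ u) => [s'|] // _; have [s1 [k [->]]] := foldr_push_pend E.
Qed.

Lemma pend_prefix0 u v : pend (u ++ v) = Some [::] -> pend u = Some [::].
Proof.
rewrite pend_cat; case: (pend v) => [s|]; last by rewrite foldr_push_None.
case/foldr_push_pend => s1 [k [-> /esym/eqP]].
by rewrite -size_eq0 size_cat addn_eq0 size_eq0 => /andP[/eqP ->].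
Qed.

Lemma pend0_ht w : pend w = Some [::] -> (0 <= ht w)%R.
Proof.
move=> E; have := npend_ht; move=> /(_ w); rewrite E {2}/npend E => <- //=; lia.
Qed.

Definition is_closing (l : letter) : bool := if l is AlphaInv _ then true else false.

(** A last letter is added at the far end of the reading, where the effect on [pend] is not visible.
    For [bar] it is a single [push], and [npend_ht] before and after carries the count back. *)
Lemma npend_rcons w l : pend (rcons w l) != None ->
  npend (rcons w l) =
    (npend w + (is_closing l && (pend (bar w) == Some [::])))%N.
Proof.
move=> a; have aw : pend w != None by move: a; rewrite -cats1; exact: pend_prefix.
have := npend_ht aw; have := npend_ht a; rewrite ht_rcons.
move: a; rewrite -pend_bar_None bar_rcons {1 2}/npend pend_cons /=.
rewrite -pend_bar_None in aw.
rewrite /npend; case: (pend (bar w)) aw => [s|] // _.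
case: l => j /=; first by case: (pend w) (pend (rcons w _)) => [s2|] [s3|] /=; lia.
case: s => [|i s] /=; first by case: (pend w) (pend (rcons w _)) => [s2|] [s3|] /=; lia.
case: (i == j) => //= _.
by case: (pend w) (pend (rcons w _)) => [s2|] [s3|] /=; lia.
Qed.

(** The first closing to remain free would find no waiting opening, so the height just after it
    would be -1. *)
Lemma pend0_prefixes w : pend w != None ->
  (forall k, (k <= size w)%N -> (0 <= ht (take k w))%R) -> pend w = Some [::].
Proof.
elim/last_ind: w => // w l IH a H.
have aw : pend w != None by move: a; rewrite -cats1; exact: pend_prefix.
have Ew : pend w = Some [::].
  apply: IH => // k kw; have := H k; rewrite size_rcons -cats1 takel_cat //.
  by apply; apply: leqW.
have := npend_rcons a; have h2 := npend_ht a; have := H _ (leqnn _).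
rewrite take_size -h2; case E: (pend (rcons w l)) a => [s|] // _.
rewrite {2}/npend E {2}/npend E {2}/npend Ew bar_rcons /npend pend_cons /=.
case: eqP => [-> /=|_]; last by rewrite andbF; case: s {E} => // i s _ /=; lia.
case: l {H h2 E} => j /=; last by case: s => //= i s; lia.
by case: s.
Qed.

(** Free closings precede free openings, so a word can be cut between the two kinds. Summing over
    the cuts will bound the partition function. *)
Lemma pend_split w : pend w != None ->
  exists2 k, (k <= size w)%N &
    pend (bar (take k w)) = Some [::] /\ pend (drop k w) = Some [::].
Proof.
elim: w => [|l w IH] a; first by exists 0%N.
have [k kw [h1 h2]] := IH (@pend_suffix [:: l] w a).
have Eb : pend (bar (take k.+1 (l :: w))) = foldr push (push (inv_letter l) (Some [::]))
  (bar (take k w)).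
  by rewrite /= bar_cons -cats1 pend_cat pend_cons.
have b : pend (take k.+1 (l :: w)) != None.
  by apply: (@pend_prefix _ (drop k.+1 (l :: w))); rewrite cat_take_drop.
case: l => j in a Eb b *; last by exists k.+1 => //; rewrite Eb.
have := b; rewrite -pend_bar_None Eb /=.
case E: (foldr _ _ _) => [s|] // _.
have [s1 [i]] := foldr_push_pend E; rewrite h1 => -[[<-]] Es /=; rewrite {}Es in E.
case: i => [|i] /= in E; last by exists k.+1 => //; rewrite Eb E.
(* The new opening stays free in the left piece, so nothing after it in that piece is a free
   closing; the cut moves to 0. *)
have c : pend (take k w) != None by apply: (@pend_suffix [:: Alpha j]).
have E0 : pend (take k w) = Some [::].
  have := npend_ht b; have := npend_ht c; rewrite /npend Eb /= E h1 ht_cons.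
  move: b; rewrite /= pend_cons /=.
  case: (pend (take k w)) c => [[|i s']|] //= _.
  by case: ifP => //= _ _; lia.
exists 0%N => //; rewrite drop0; split=> //.
have : pend w = Some [::] by rewrite -(cat_take_drop k w) pend_cat h2.
by rewrite pend_cons => ->.
Qed.

(** The opening finds no partner in [w], hence acts as a barrier between [a] and [w]. The exchange
    of words rests on this. *)
Lemma pend_through a j w : pend w = Some [::] -> pend (a ++ Alpha j :: w) = pend a.
Proof. by move=> E; rewrite pend_cat pend_cons E. Qed.

Local Open Scope ring_scope.

(** * Reference measures on words *)

(** A list instead of a finite type of tuples: words of all lengths share one type, so they can be
    cut, joined and reversed without casts. *)
Fixpoint words (n : nat) : seq (seq letter) :=
  if n is n'.+1 then [seq l :: w | l <- enum {: letter}, w <- words n']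
  else [:: [::]].

Lemma mem_words n w : (w \in words n) = (size w == n).
Proof.
elim: n w => [|n IH] w /=; first by rewrite inE size_eq0.
apply/allpairsP/idP => [[[l v] /= [_ + ->]]|]; first by rewrite IH eqSS.
by case: w => // l w; rewrite eqSS -IH => h; exists (l, w); rewrite mem_enum.
Qed.

Lemma uniq_words n : uniq (words n).
Proof.
elim: n => //= n IH; apply: allpairs_uniq => //; first exact: enum_uniq.
by case=> l w [l' w'] /= _ _ [-> ->].
Qed.

Section sums.
Variable V : nmodType.
Implicit Type G : seq letter -> V.

Lemma big_words0 G : \sum_(w <- words 0) G w = G [::].
Proof. by rewrite big_seq1. Qed.

Lemma big_wordsS n G :
  \sum_(w <- words n.+1) G w = \sum_(l : letter) \sum_(w <- words n) G (l :: w).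
Proof. by rewrite /= big_allpairs_dep big_enum. Qed.

Lemma big_words_cat m n G :
  \sum_(w <- words (m + n)) G w =
  \sum_(b <- words m) \sum_(r <- words n) G (b ++ r).
Proof.
elim: m G => [|m IH] G; first by rewrite big_words0.
rewrite addSn !big_wordsS; apply: eq_bigr => l _; exact: IH.
Qed.

Lemma big_words_rcons n G :
  \sum_(w <- words n.+1) G w = \sum_(w <- words n) \sum_(l : letter) G (rcons w l).
Proof.
rewrite -addn1 big_words_cat; apply: eq_bigr => w _.
rewrite big_wordsS; apply: eq_bigr => l _; by rewrite big_words0 cats1.
Qed.

Lemma big_words_bar n G :
  \sum_(w <- words n) G (bar w) = \sum_(w <- words n) G w.
Proof.
rewrite -(big_map bar xpredT G); apply: perm_big; apply: uniq_perm.
- by rewrite map_inj_uniq ?uniq_words //; apply: (can_inj barK).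
- exact: uniq_words.
- move=> w; rewrite mem_words -{1}(barK w) mem_map ?mem_words ?size_bar //.
  exact: (can_inj barK).
Qed.

Lemma big_words_tuple n (P : pred (seq letter)) G :
  \sum_(a : n.-tuple letter | P a) G a = \sum_(w <- words n | P w) G w.
Proof.
rewrite -(big_map val P G) -[RHS]big_filter -[LHS]big_filter; apply: perm_big.
apply: perm_filter; rewrite -[X in map _ X]enumT; apply: uniq_perm.
- by rewrite map_inj_uniq ?enum_uniq //; apply: val_inj.
- exact: uniq_words.
- move=> w; rewrite mem_words; apply/mapP/idP => [[a _ ->]|h].
    by rewrite size_tuple.
  by exists (Tuple h); rewrite ?mem_enum.
Qed.

Lemma sum_letter (G : letter -> V) :
  \sum_(l : letter) G l = (G (Alpha false) + G (Alpha true)) +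
                 (G (AlphaInv false) + G (AlphaInv true)).
Proof.
rewrite (reindex letter_of_sum); last first.
  by exists letter_to_sum => -[] // j; rewrite ?inE.
by rewrite big_sumType /= !big_bool; congr (_ + _); rewrite addrC.
Qed.

End sums.

Lemma eq_big_words (V : nmodType) n (G H : seq letter -> V) :
  (forall w, size w = n -> G w = H w) ->
  \sum_(w <- words n) G w = \sum_(w <- words n) H w.
Proof.
move=> h; apply: eq_big_seq => w.
by rewrite mem_words => /eqP; exact: h.
Qed.

Lemma le_big_words (R : numDomainType) n (G H : seq letter -> R) :
  (forall w, size w = n -> G w <= H w) ->
  \sum_(w <- words n) G w <= \sum_(w <- words n) H w.
Proof.
move=> h; rewrite big_seq [leRHS]big_seq; apply: ler_sum => w.
by rewrite mem_words => /eqP; exact: h.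
Qed.

Section reference.
Variables (R : realType) (F : letter -> R).

Definition wt (w : seq letter) : R := \sum_(l <- w) F l.

Definition wopen : R := expR (F (Alpha false)) + expR (F (Alpha true)).

Definition wpair : R := \sum_(j : bool) expR (F (Alpha j) + F (AlphaInv j)).

Definition lam (t : R) : R := t + wpair / t.

(** The logarithm of the product of the transition weights. A pending closing j carries an extra
    factor e^(F(alpha_j)) / t, which combines with the weight t / lam of its later opening to
    e^(F(alpha_j)) / lam. On the empty stack the type j of an opening has probability e^(F(alpha_j))
    / wopen, so a free opening carries an extra t / wopen. By [npend_ht] the number of free openings
    is [npend w + ht w]. *)
Definition lnq (t : R) (w : seq letter) : R :=
  - (size w)%:R * ln (lam t) + wt w
  + \sum_(j <- odflt [::] (pend w)) (F (Alpha j) - ln t)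
  + (ln t - ln wopen) * ((npend w)%:Z + ht w)%:~R.

Definition q (t : R) (w : seq letter) : R :=
  if pend w == None then 0 else expR (lnq t w).

Lemma wt_cat u v : wt (u ++ v) = wt u + wt v.
Proof. by rewrite /wt big_cat. Qed.

Lemma wt_cons l v : wt (l :: v) = F l + wt v.
Proof. by rewrite /wt big_cons. Qed.

Lemma wopen_gt0 : 0 < wopen.
Proof. by rewrite addr_gt0 // expR_gt0. Qed.

Lemma wpair_gt0 : 0 < wpair.
Proof. by rewrite /wpair big_bool addr_gt0 // expR_gt0. Qed.

Lemma lam_gt0 (t : R) : 0 < t -> 0 < lam t.
Proof. by move=> t0; rewrite addr_gt0 // divr_gt0 // wpair_gt0. Qed.

Lemma q_ge0 (t : R) w : 0 <= q t w.
Proof. by rewrite /q; case: ifP => // _; exact: expR_ge0. Qed.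

Lemma q_gt0 t w : pend w != None -> 0 < q t w.
Proof. by rewrite /q => /negbTE ->; exact: expR_gt0. Qed.

Lemma q_nil t : q t [::] = 1.
Proof.
rewrite /q /lnq /= /wt /npend ht_nil /pend /= !big_nil /=.
by rewrite oppr0 mul0r !mulr0 !addr0 expR0.
Qed.

Lemma lnq_cons t l w s : pend w = Some s -> pend (l :: w) != None ->
  lnq t (l :: w) = lnq t w +
    match l with
    | AlphaInv j => - ln (lam t) + F (AlphaInv j) + F (Alpha j) - ln t
    | Alpha j => - ln (lam t) + (if s is [::] then F (Alpha j) + (ln t - ln wopen) else
      ln t)
    end.
Proof.
rewrite pend_cons /lnq wt_cons ht_cons /npend pend_cons /= => ->.
case: l => j /=; last first.
  by move=> _; rewrite big_cons -[(size w).+1]addn1 natrD -[(size s).+1]addn1 PoszD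
    !intrD; ring.
case: s => [|i s] /=.
  by move=> _; rewrite !big_nil -[(size w).+1]addn1 natrD !intrD; ring.
have [->|_] /= := eqVneq i j; last by [].
by move=> _; rewrite big_cons -[(size w).+1]addn1 natrD -[(size s).+1]addn1 PoszD !intrD;
  ring.
Qed.

(** Whatever the stack, the closings have total weight wpair / (t lam) and the openings t / lam;
    [lam] is the normalisation that makes these add up to 1. *)
Lemma q_cons (t : R) w : 0 < t -> \sum_(l : letter) q t (l :: w) = q t w.
Proof.
move=> t0; have l0 := lam_gt0 t0.
rewrite sum_letter {5}/q; case E: (pend w) => [s|] /=; last first.
  by rewrite /q !pend_cons E /= !addr0.
have qE l : pend (l :: w) != None -> q t (l :: w) = expR (lnq t w) * expR (lnq t (l :: w)
  - lnq t w).
  by move=> h; rewrite /q (negbTE h) -expRD; congr expR; ring.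
have qI j : q t (AlphaInv j :: w) = expR (lnq t w) * (expR (F (Alpha j) + F (AlphaInv j))
  / (t * lam t)).
  have h : pend (AlphaInv j :: w) != None by rewrite pend_cons E.
  rewrite qE // (lnq_cons _ E h); congr (_ * _).
  rewrite -[X in _ / X](@lnK _) ?posrE ?mulr_gt0 // [ln (t * _)]lnM ?posrE // -expRN
    -expRD.
  by congr expR; ring.
have qA : q t (Alpha false :: w) + q t (Alpha true :: w) = expR (lnq t w) * (t / lam t).
  have E1 : expR (ln t - ln (lam t)) = t / lam t.
    by rewrite expRD expRN !lnK ?posrE.
  case: s E => [|i s] E.
    have h j : pend (Alpha j :: w) != None by rewrite pend_cons E.
    rewrite !qE // !(lnq_cons _ E (h _)) -mulrDr; congr (_ * _).
    have H j : - ln (lam t) + (F (Alpha j) + (ln t - ln wopen)) = (ln t - ln (lam t)) +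
      (F (Alpha j) - ln wopen) by ring.
    rewrite ![lnq t w + _]addrC !addrK !H 2!(expRD (ln t - _)) -mulrDr E1 2!expRD -mulrDl.
    by rewrite -/wopen expRN lnK ?posrE ?wopen_gt0 // divff ?mulr1 // gt_eqF // wopen_gt0.
  have h : pend (Alpha i :: w) != None by rewrite pend_cons E /= eqxx.
  have -> : expR (lnq t w) * (t / lam t) = q t (Alpha i :: w).
    by rewrite qE // (lnq_cons _ E h) [lnq t w + _]addrC addrK addrC E1.
  have H2 : forall G : bool -> R, G false + G true = G i + G (~~ i).
    by move=> G; case: i {E h} => //=; rewrite addrC.
  rewrite (H2 (fun j => q t (Alpha j :: w))).
  rewrite {2}/q pend_cons E /= (_ : (i == ~~ i) = false) /=; first by rewrite addr0.
  by clear; case: i.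
rewrite qA !qI -!mulrDr -[RHS]mulr1; congr (_ * _).
have -> : t / lam t = (lam t - wpair / t) / lam t by rewrite {2}/lam addrK.
have -> : wpair = expR (F (Alpha false) + F (AlphaInv false)) + expR (F (Alpha true) + F
  (AlphaInv true)).
  by rewrite /wpair big_bool /= addrC.
by field; rewrite !gt_eqF.
Qed.

Lemma sum_q_cat (t : R) n w : 0 < t -> \sum_(b <- words n) q t (b ++ w) = q t w.
Proof.
move=> t0; elim: n => [|n IH]; first by rewrite big_words0.
rewrite big_wordsS exchange_big /= -[RHS]IH; apply: eq_bigr => b _.
exact: q_cons.
Qed.

Lemma sum_q (t : R) n : 0 < t -> \sum_(w <- words n) q t w = 1.
Proof.
by move=> t0; rewrite -(q_nil t) -(sum_q_cat n _ t0); apply: eq_bigr => w _;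
  rewrite cats0.
Qed.

End reference.

(** * Entropy estimates for word distributions *)

Section asymptotics.
Variable R : realType.
Implicit Types (e : nat -> R).

(** This notion and the next are one-sided: they bound from above only, so a two-sided estimate is
    expressed by two statements. *)
Definition eventually_small e :=
  forall eps : R, 0 < eps -> exists n0, forall n, (n0 <= n)%N -> e n <= eps.

Definition sublinear e :=
  forall eps : R, 0 < eps -> exists n0, forall n, (n0 <= n)%N -> e n <= eps * n%:R.

Lemma large_nat (C eps : R) : 0 < eps ->
  exists n0, forall n, (n0 <= n)%N -> C <= eps * n%:R.
Proof.
move=> e0; exists (Num.truncn (`|C| / eps)).+1 => n hn.
rewrite mulrC -ler_pdivrMr //; apply: le_trans (_ : `|C| / eps <= _).
  by rewrite ler_pM2r ?invr_gt0 // ler_norm.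
apply: le_trans (_ : (Num.truncn (`|C| / eps)).+1%:R <= _); last by rewrite ler_nat.
by apply/ltW; apply: truncnS_gt.
Qed.

(** A Cesaro average: increments are eventually below eps / 2, and the initial value is absorbed by
    the other half. *)
Lemma sublinear_of_increments e (d : nat -> R) :
  (forall n, e n.+1 <= e n + d n) -> eventually_small d -> sublinear e.
Proof.
move=> H sd eps e0; have e2 : 0 < eps / 2 by rewrite divr_gt0.
have [n1 h1] := sd _ e2.
have B k : e (n1 + k)%N <= e n1 + eps / 2 * k%:R.
  elim: k => [|k IH]; first by rewrite addn0 mulr0 addr0.
  rewrite addnS; apply: le_trans (H _) _; have := h1 (n1 + k)%N (leq_addr _ _).
  by rewrite -[k.+1]addn1 natrD; lra.
have [n2 h2] := large_nat (e n1) e2.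
exists (n1 + n2)%N => n hn; have E : n = (n1 + (n - n1))%N by lia.
rewrite {1}E; apply: le_trans (B _) _.
have := h2 n (leq_trans (leq_addl _ _) hn).
have : (n - n1)%:R <= n%:R :> R by rewrite ler_nat leq_subr.
move: ((n - n1)%:R) => x; have := e2; nra.
Qed.

Lemma sublinearD e1 e2 : sublinear e1 -> sublinear e2 -> sublinear (fun n => e1 n + e2 n).
Proof.
move=> h1 h2 eps e0; have e2' : 0 < eps / 2 by rewrite divr_gt0.
have [n1 g1] := h1 _ e2'; have [n2 g2] := h2 _ e2'.
exists (maxn n1 n2) => n; rewrite geq_max => /andP[/g1 + /g2]; lra.
Qed.

Lemma sublinearZ e (c : R) : 0 <= c -> sublinear e -> sublinear (fun n => c * e n).
Proof.
move=> c0 h eps e0; have c1 : 0 < c + 1 by lra.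
have [n1 g1] := h _ (divr_gt0 e0 c1).
exists n1 => n /g1 h1; apply: le_trans (ler_wpM2l c0 h1) _.
rewrite mulrA ler_wpM2r // mulrCA ger_pMr // ler_pdivrMr //; lra.
Qed.

End asymptotics.

Section inequalities.
Variable R : realType.

(** This is ln s <= s - 1 at s = sqrt y / sqrt x. The summands [- x + y] make the inequality hold
    term by term and vanish when summed over two measures of equal mass. *)
Lemma kl_ge_hellinger (x y : R) : 0 < x -> 0 < y ->
  (Num.sqrt x - Num.sqrt y) ^+ 2 <= x * (ln x - ln y) - x + y.
Proof.
move=> x0 y0; have sx : 0 < Num.sqrt x by rewrite sqrtr_gt0.
have sy : 0 < Num.sqrt y by rewrite sqrtr_gt0.
have Ex : x = Num.sqrt x ^+ 2 by rewrite sqr_sqrtr // ltW.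
have Ey : y = Num.sqrt y ^+ 2 by rewrite sqr_sqrtr // ltW.
move: (Num.sqrt x) (Num.sqrt y) sx sy Ex Ey => a b a0 b0 -> ->.
rewrite !lnXn //.
have ba : 0 < b / a by rewrite divr_gt0.
have := @le_ln1Dx R (b / a - 1); rewrite [1 + _](_ : _ = b / a); last by ring.
rewrite (_ : -1 < b / a - 1) => [/(_ isT)|]; last by lra.
rewrite ln_div ?posrE // => h.
have : a ^+ 2 * (ln b - ln a) <= a ^+ 2 * (b / a - 1) by rewrite ler_wpM2l // sqr_ge0.
have -> : a ^+ 2 * (b / a - 1) = a * b - a ^+ 2 by field; rewrite gt_eqF.
by move=> g; lra.
Qed.

(** A weighted arithmetic-geometric mean inequality in place of Cauchy-Schwarz: it can be summed
    term by term, with [d] chosen at the end. *)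
Lemma dist_le_hellinger (x y d : R) : 0 <= x -> 0 <= y -> 0 < d ->
  `|x - y| <= d * (x + y) + (Num.sqrt x - Num.sqrt y) ^+ 2 / d.
Proof.
move=> x0 y0 d0.
have sx : 0 <= Num.sqrt x by rewrite sqrtr_ge0.
have sy : 0 <= Num.sqrt y by rewrite sqrtr_ge0.
have Ex : x = Num.sqrt x ^+ 2 by rewrite sqr_sqrtr.
have Ey : y = Num.sqrt y ^+ 2 by rewrite sqr_sqrtr.
move: (Num.sqrt x) (Num.sqrt y) sx sy Ex Ey => a b a0 b0 -> ->.
rewrite subr_sqr normrM (ger0_norm (addr_ge0 a0 b0)).
rewrite -(ler_pM2l d0) [d * (_ + _ / d)]mulrDr [d * (_ / d)]mulrC divfK ?gt_eqF // -[(a -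
  b) ^+ 2]real_normK ?num_real //.
move: (`|a - b|) (normr_ge0 (a - b)) => c c0.
have : 0 <= (c - d * (a + b) / 2) ^+ 2 by apply: sqr_ge0.
have : 0 <= d ^+ 2 * (a - b) ^+ 2 by rewrite mulr_ge0 // sqr_ge0.
nra.
Qed.

Definition eta (x : R) : R := - (x * ln x).

(** Monotonicity of the logarithm. It bounds the entropy of a measure by those of its unnormalised
    parts. *)
Lemma eta_subadditive (x y : R) : 0 <= x -> 0 <= y -> eta (x + y) <= eta x + eta y.
Proof.
rewrite /eta => x0 y0; move: x0; rewrite le_eqVlt => /orP[/eqP <-|x0].
  by rewrite add0r mul0r oppr0 add0r.
move: y0; rewrite le_eqVlt => /orP[/eqP <-|y0].
  by rewrite addr0 mul0r oppr0 addr0.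
have h1 : ln x <= ln (x + y) by rewrite ler_ln ?posrE //; lra.
have h2 : ln y <= ln (x + y) by rewrite ler_ln ?posrE //; lra.
have := ler_wpM2l (ltW x0) h1; have := ler_wpM2l (ltW y0) h2; lra.
Qed.

End inequalities.

Section word_distributions.
Variables (R : realType).
Implicit Type p : seq letter -> R.

(* The distributions of finite words under a finite shift-invariant measure on
   the Dyck shift; the total mass is [p [::]]. *)
Definition word_dist p : Prop :=
  [/\ forall w, 0 <= p w,
      forall w, \sum_(l : letter) p (l :: w) = p w,
      forall w, \sum_(l : letter) p (rcons w l) = p w
    & forall w, pend w = None -> p w = 0].

Lemma word_dist_bar p : word_dist p -> word_dist (p \o bar).
Proof.
case=> h1 h2 h3 h4; split=> /= [w|w|w|w].
- exact: h1.
- rewrite -h3 !sum_letter !bar_cons /=; ring.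
- rewrite -h2 !sum_letter !bar_rcons /=; ring.
- by move/eqP; rewrite -pend_bar_None => /eqP /h4.
Qed.

Lemma sum_dist_cat p n w : word_dist p -> \sum_(b <- words n) p (b ++ w) = p w.
Proof.
case=> _ h2 _ _; elim: n => [|n IH]; first by rewrite big_words0.
rewrite big_wordsS exchange_big /= -[RHS]IH; apply: eq_bigr => b _; exact: h2.
Qed.

Lemma sum_dist p n : word_dist p -> \sum_(w <- words n) p w = p [::].
Proof. by move=> dp; rewrite -(sum_dist_cat n [::] dp); apply: eq_bigr => w _;
  rewrite cats0. Qed.

Lemma dist_cat_le p b w : word_dist p -> p (b ++ w) <= p w.
Proof.
move=> [h1 h2 h3 h4]; elim: b => //= l b IH; apply: le_trans IH.
rewrite -[leRHS]h2 (bigD1 l) //= lerDl; apply: sumr_ge0 => *; exact: h1.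
Qed.

Definition mean_npend p (n : nat) : R := \sum_(w <- words n) p w * (npend w)%:R.

(** The increment of [mean_npend], by [npend_rcons]: the mass of words whose last letter is a
    closing without a partner among the n letters before it. *)
Definition defect p (n : nat) : R :=
  \sum_(w <- words n) \sum_(l : letter)
     p (rcons w l) * (is_closing l && (pend (bar w) == Some [::]))%:R.

Lemma sublinear_mean_npend p :
  word_dist p -> eventually_small (defect p) -> sublinear (mean_npend p).
Proof.
move=> [h1 h2 h3 h4]; apply: sublinear_of_increments => n.
rewrite /mean_npend /defect big_words_rcons -big_split /= le_eqVlt; apply/orP; left;
  apply/eqP.
apply: eq_bigr => w _; rewrite -h3 mulr_suml -big_split /=; apply: eq_bigr => l _.
have [E|E] := eqVneq (pend (rcons w l)) None; first by rewrite (h4 _ E) !mul0r addr0.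
by rewrite (npend_rcons E) natrD mulrDr.
Qed.

Variable F : letter -> R.
Variable t : R.
Hypothesis t0 : 0 < t.

(* [Jfun] is the entropy plus the energy of the n-letter words, [Kfun] their
   relative entropy with respect to [q], and [kernel] replaces the conditional law
   of the block b given the following word r by that of [q]. *)
Definition Jfun p (n : nat) : R := \sum_(w <- words n) (eta (p w) + p w * wt F w).

Definition Kfun p (n : nat) : R := \sum_(w <- words n) p w * (ln (p w) - lnq F t w).

Definition kernel p (b r : seq letter) : R := p r * (q F t (b ++ r) / q F t r).

Definition hell p (L n : nat) : R :=
  \sum_(b <- words L) \sum_(r <- words n)
     (Num.sqrt (p (b ++ r)) - Num.sqrt (kernel p b r)) ^+ 2.

Lemma kernel_ge0 p b r : word_dist p -> 0 <= kernel p b r.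
Proof. by case=> h _ _ _; rewrite mulr_ge0 // divr_ge0 // q_ge0. Qed.

Lemma sum_kernel p L r : word_dist p -> \sum_(b <- words L) kernel p b r = p r.
Proof.
move=> [h1 h2 h3 h4]; rewrite /kernel -mulr_sumr -mulr_suml sum_q_cat //.
have [/h4 ->|E] := eqVneq (pend r) None; first by rewrite mul0r.
by rewrite divff ?mulr1 // gt_eqF // q_gt0.
Qed.

(** The chain rule: the growth of [Kfun] is the relative entropy of the law of (b, r) with respect
    to [kernel], and this dominates the squared Hellinger distance [hell]. *)
Lemma Kfun_increment p L n : word_dist p -> hell p L n + Kfun p n <= Kfun p (L + n).
Proof.
move=> dp; have [h1 h2 h3 h4] := dp.
rewrite -lerBrDr /Kfun big_words_cat.
have -> : \sum_(w <- words n) p w * (ln (p w) - lnq F t w) =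
    \sum_(b <- words L) \sum_(r <- words n) p (b ++ r) * (ln (p r) - lnq F t r).
  rewrite exchange_big /=; apply: eq_bigr => r _.
  by rewrite -mulr_suml sum_dist_cat.
(* For each [r] both measures have mass [p r], so the added sum is 0; it allows a comparison term by
   term. *)
set Z := _ - _; have -> : Z = Z + \sum_(b <- words L) \sum_(r <- words n) (kernel p b r -
  p (b ++ r)).
  rewrite exchange_big big1 ?addr0 //= => r _.
  by rewrite sumrB sum_kernel // sum_dist_cat // subrr.
rewrite {}/Z -sumrB -big_split /=; apply: ler_sum => b _.
rewrite -sumrB -big_split /=; apply: ler_sum => r _.
have := h1 (b ++ r); rewrite le_eqVlt => /orP[/eqP <-|p0].
  by rewrite sqrtr0 sub0r sqrrN sqr_sqrtr ?kernel_ge0 // !mul0r !subr0 add0r.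
have Nbr : pend (b ++ r) != None by apply/eqP => /h4 E; rewrite E ltxx in p0.
have Nr := pend_suffix Nbr.
have pr : 0 < p r by apply: lt_le_trans p0 _; exact: dist_cat_le.
have k0 : 0 < kernel p b r by rewrite mulr_gt0 // divr_gt0 // q_gt0.
apply: le_trans (kl_ge_hellinger p0 k0) _.
have -> : ln (kernel p b r) = ln (p r) + lnq F t (b ++ r) - lnq F t r.
  rewrite lnM ?posrE ?divr_gt0 ?q_gt0 // ln_div ?posrE ?q_gt0 //.
  by rewrite /q (negbTE Nbr) (negbTE Nr) !expRK addrA.
lra.
Qed.

Lemma hell_ge0 p L n : 0 <= hell p L n.
Proof. by apply: sumr_ge0 => b _; apply: sumr_ge0 => r _; exact: sqr_ge0. Qed.

Lemma Kfun_ge p n : word_dist p -> Kfun p 0 <= Kfun p n.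
Proof.
by move=> dp; have := Kfun_increment n 0 dp; rewrite addn0; have := hell_ge0 p n 0; lra.
Qed.

(** Otherwise [Kfun] would gain more than [d] with every [L] further letters and grow linearly. Only
    the sum of the gains is controlled, which is why the conclusion concerns some large [n] instead
    of all. *)
Lemma hell_small p L (d : R) n0 : word_dist p -> sublinear (Kfun p) -> 0 < d ->
  exists2 n, (n0 <= n)%N & hell p L n <= d.
Proof.
move=> dp sK d0; apply/not_exists2P => H.
have {}H n : (n0 <= n)%N -> d < hell p L n.
  by move=> hn; have [] := H n => // /negP; rewrite -ltNge.
have B j : Kfun p n0 + j%:R * d <= Kfun p (j * L + n0).
  elim: j => [|j IH]; first by rewrite mul0r addr0 mul0n.
  rewrite mulSn -addnA; have := Kfun_increment L (j * L + n0) dp.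
  have := H (j * L + n0)%N (leq_addl _ _); rewrite -[j.+1]addn1 natrD mulrDl mul1r; lra.
have L0 : 0 < L%:R + 1 :> R by rewrite ltr_wpDl.
have [n1 h1] := sK _ (divr_gt0 (divr_gt0 d0 (ltr0n _ 2)) L0).
have d2 : 0 < d / 2 by rewrite divr_gt0.
have [n2 h2] := large_nat (d * n0%:R - Kfun p n0 + 1) d2.
set j := (n1 + n2 + 1)%N.
(* For [L = 0] no letter is added and the growth argument is void; but then [kernel] agrees with [p]
   and [hell] is 0. *)
case: (posnP L) => [E|Lp].
  have := H n0 (leqnn _); rewrite /hell E big_words0 big1; first by lra.
  move=> r _ /=; rewrite /kernel /=.
  have [h1' _ _ h4] := dp.
  have [/h4 ->|Er] := eqVneq (pend r) None; first by rewrite mul0r sqrtr0 subrr expr0n.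
  by rewrite divff ?mulr1 ?subrr ?expr0n // gt_eqF // q_gt0.
have := B j; have := h1 (j * L + n0)%N _; have := h2 j _.
have -> : (n2 <= j)%N by rewrite /j; lia.
have -> : (n1 <= j * L + n0)%N by rewrite /j; nia.
move=> /(_ isT) a /(_ isT) b c.
have : d / 2 / (L%:R + 1) * (j * L + n0)%:R <= d / 2 * (j%:R + n0%:R).
  rewrite -mulrA ler_pM2l // mulrC ler_pdivrMr // natrD natrM.
  have := ler0n R L; have := ler0n R j; have := ler0n R n0; nra.
move: a b c; have : 0 <= d * n0%:R by rewrite mulr_ge0 // ltW.
lra.
Qed.

Lemma kernel_dist_small p L (eps : R) n0 :
  word_dist p -> sublinear (Kfun p) -> 0 < eps ->
  exists2 n, (n0 <= n)%N &
    \sum_(b <- words L) \sum_(r <- words n) `|p (b ++ r) - kernel p b r| <= eps.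
Proof.
move=> dp sK e0; have [h1 h2 h3 h4] := dp.
(* With this value the first term of [dist_le_hellinger] sums to 2 d p([::]) <= eps / 2. *)
set d := eps / (4 * (p [::] + 1)).
have m0 : 0 < p [::] + 1 by rewrite ltr_wpDl.
have d0 : 0 < d by rewrite divr_gt0 // mulr_gt0.
have [n hn H] := hell_small L n0 dp sK (mulr_gt0 d0 (divr_gt0 e0 (ltr0n _ 2))).
exists n => //.
apply: le_trans (_ : d * (p [::] + p [::]) + hell p L n / d <= _); last first.
  have : hell p L n / d <= eps / 2 by rewrite ler_pdivrMr // mulrC.
  have : d * (4 * (p [::] + 1)) = eps by rewrite /d divfK // gt_eqF // mulr_gt0.
  have := h1 [::]; have := d0; nra.
have -> : p [::] + p [::] = \sum_(b <- words L) \sum_(r <- words n) (p (b ++ r) + kernel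
  p b r).
  rewrite exchange_big -[in LHS](sum_dist n dp) -big_split /=; apply: eq_bigr => r _.
  by rewrite big_split /= sum_dist_cat // sum_kernel.
rewrite /hell mulr_sumr mulr_suml -big_split /=; apply: ler_sum => b _.
rewrite mulr_sumr mulr_suml -big_split /=; apply: ler_sum => r _.
by apply: dist_le_hellinger => //; exact: kernel_ge0.
Qed.

(** In [Jfun + Kfun] the logarithms of [p] cancel, and after subtracting n ln lam only the factors
    of free letters remain. [B] bounds the cost of a free closing, [C] that of a free opening, which
    is 0 for [t = wopen F]. *)
Lemma Jfun_le p : word_dist p -> sublinear (mean_npend p) ->
  t = wopen F \/ sublinear (mean_npend (p \o bar)) ->
  sublinear (fun n => Jfun p n + Kfun p n - n%:R * (p [::] * ln (lam F t))).
Proof.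
move=> dp sE sE'; have [h1 h2 h3 h4] := dp.
pose B := `|F (Alpha false) - ln t| + `|F (Alpha true) - ln t|.
pose C := `|ln t - ln (wopen F)|.
have B0 : 0 <= B by rewrite addr_ge0.
have sum_le s : - (\sum_(j <- s) (F (Alpha j) - ln t)) <= B * (size s)%:R.
  elim: s => [|j s IH]; first by rewrite big_nil mulr0 oppr0.
  rewrite big_cons /= -[(size s).+1]addn1 natrD mulrDr mulr1 opprD addrC lerD //.
  apply: le_trans (ler_norm _) _; rewrite normrN /B.
  by case: j; rewrite ?lerDr ?lerDl.
have main n : Jfun p n + Kfun p n - n%:R * (p [::] * ln (lam F t)) <=
    B * mean_npend p n + C * mean_npend (p \o bar) n.
  rewrite -(sum_dist n dp) /Jfun /Kfun -big_split /= mulr_suml mulr_sumr -sumrB.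
  rewrite /mean_npend -[X in C * X]big_words_bar !mulr_sumr -big_split /=.
  apply: le_big_words => w wn; rewrite barK /eta.
  have [E|E] := eqVneq (pend w) None; first by rewrite (h4 _ E); lra.
  have -> : - (p w * ln (p w)) + p w * wt F w + p w * (ln (p w) - lnq F t w) -
    n%:R * (p w * ln (lam F t)) = p w * (wt F w - lnq F t w - n%:R * ln (lam F t)) by
      ring.
  rewrite mulrCA [C * _]mulrCA -mulrDr ler_wpM2l //.
  rewrite /lnq wn -(npend_ht E) [_ + (_ - _)]addrCA subrr addr0.
  have -> : (npend (bar w))%:Z%:~R = (npend (bar w))%:R :> R by [].
  case Ew : (pend w) E => [s|] // _ /=.
  have := sum_le s; rewrite /npend Ew.
  have : - (ln t - ln (wopen F)) * (npend (bar w))%:R <= C * (npend (bar w))%:R.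
    by rewrite ler_wpM2r //; apply: le_trans (ler_norm _) _; rewrite normrN.
  rewrite -/(npend (bar w)); lra.
have S : sublinear (fun n => B * mean_npend p n + C * mean_npend (p \o bar) n).
  case: sE' => [E|sE']; last by apply: sublinearD; apply: sublinearZ => //;
    exact: normr_ge0.
  move=> eps e0; have [n1 g] := sublinearZ B0 sE e0; exists n1 => n /g.
  by rewrite /C E subrr normr0 mul0r addr0.
by move=> eps /S[n1 g]; exists n1 => n /g; apply: le_trans.
Qed.

Lemma Jfun_upper p : word_dist p -> sublinear (mean_npend p) ->
  t = wopen F \/ sublinear (mean_npend (p \o bar)) ->
  sublinear (fun n => Jfun p n - n%:R * (p [::] * ln (lam F t))).
Proof.
move=> dp h1 h2 eps e0; have e2 : 0 < eps / 2 by rewrite divr_gt0.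
have [n1 g1] := Jfun_le dp h1 h2 e2; have [n2 g2] := large_nat (- Kfun p 0) e2.
exists (maxn n1 n2) => n; rewrite geq_max => /andP[/g1 + /g2].
have := Kfun_ge n dp; lra.
Qed.

End word_distributions.

(** * Exchanging two words behind a common free opening *)

Section word_exchange.
Variables (R : realType) (F : letter -> R) (p : seq letter -> R).
Hypothesis dp : word_dist p.
Let t := wopen F.

(** [b] and [r] surround the window. The letter of [b] followed by exactly [d] letters of [b] is an
    opening that stays free both in [b ++ u ++ r] and in [b ++ v ++ r]. *)
Definition good_pair (u v : seq letter) (d : nat) (b r : seq letter) : bool :=
  let c := drop (size b - d) b in
  [&& (d < size b)%N, ~~ is_closing (nth (AlphaInv true) b (size b - d.+1)),
      pend (c ++ u ++ r) == Some [::] & pend (c ++ v ++ r) == Some [::]].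

(** By [pend_through] both words have the pending closings of what precedes the opening, and at
    [t = wopen F] the number of free openings, which may differ, has coefficient 0. Only the weights
    of [u] and [v] remain. *)
Lemma q_exchange u v d b r : size u = size v -> good_pair u v d b r ->
  q F t (b ++ v ++ r) = expR (wt F v - wt F u) * q F t (b ++ u ++ r).
Proof.
move=> uv /and4P[db]; set c := drop _ b.
have E : b = take (size b - d.+1) b ++ nth (AlphaInv true) b (size b - d.+1) :: c.
  rewrite -[LHS](cat_take_drop (size b - d.+1)); congr (_ ++ _).
  by rewrite (drop_nth (AlphaInv true)) ?[c]/(drop _ b); [congr (_ :: drop _ _);
    lia | lia].
case: (nth _ b _) E => // j E _ /eqP pu /eqP pv.
move: (take _ b) E => a ->; rewrite -!catA !cat_cons /q /lnq /npend !pend_through //.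
case: eqP => [|_]; first by rewrite mulr0.
rewrite -expRD; congr expR.
rewrite /t subrr !mul0r !addr0 !(wt_cat, wt_cons) !size_cat /= !size_cat uv; ring.
Qed.

(** The window is counted as part of the block of length [m + size u], whose law given [r] is close
    to that of [q]; for [q] the exchange is exact. Uniformity in [e] matters because [e] will depend
    on the [n] found here. *)
Lemma exchange_sum_small u v d m (eps : R) n0 : size u = size v ->
  sublinear (Kfun F t p) -> 0 < eps ->
  exists2 n, (n0 <= n)%N &
    forall e : seq letter -> seq letter -> bool,
    `|\sum_(b <- words m) \sum_(r <- words n)
        (e b r && good_pair u v d b r)%:R *
          (p (b ++ v ++ r) - expR (wt F v - wt F u) * p (b ++ u ++ r))| <= eps.
Proof.
move=> uv sK e0; set D := expR _.
have D0 : 0 < 1 + D by rewrite addr_gt0 // expR_gt0.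
have [n hn H] := kernel_dist_small (wopen_gt0 F) (m + size u) n0 dp sK (divr_gt0 e0 D0).
exists n => // e; move: H; rewrite ler_pdivlMr // => H; apply: le_trans _ H.
have B w : size w = size u -> \sum_(b <- words m) \sum_(r <- words n)
    `|p (b ++ w ++ r) - kernel F t p (b ++ w) r| <=
    \sum_(b <- words (m + size u)) \sum_(r <- words n) `|p (b ++ r) - kernel F t p b r|.
  move=> wu; rewrite big_words_cat; apply: ler_sum => b _.
  rewrite [leRHS](bigD1_seq w) ?uniq_words ?mem_words ?wu //=.
  rewrite -[leLHS]addr0; apply: lerD; first by apply: ler_sum => r _; rewrite catA.
  by apply: sumr_ge0 => w' _; apply: sumr_ge0.
rewrite mulrDr mulr1;
  apply: le_trans _ (lerD (B v (esym uv)) (ler_wpM2r (expR_ge0 _) (B u erefl))).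
rewrite mulr_suml -big_split /=; apply: le_trans (ler_norm_sum _ _ _) _;
  apply: ler_sum => b _.
rewrite mulr_suml -big_split /=; apply: le_trans (ler_norm_sum _ _ _) _;
  apply: ler_sum => r _.
rewrite normrM; case: (boolP (e b r && _)) => [/andP[_ g]|_]; last first.
  by rewrite normr0 mul0r addr_ge0 // mulr_ge0 // expR_ge0.
have -> : p (b ++ v ++ r) - D * p (b ++ u ++ r) =
   (p (b ++ v ++ r) - kernel F t p (b ++ v) r) - D * (p (b ++ u ++ r) - kernel F t p (b
     ++ u) r).
  by rewrite /kernel -!catA (q_exchange uv g) -/D; ring.
rewrite normr1 mul1r; apply: le_trans (ler_normB _ _) _.
by rewrite normrM (ger0_norm (expR_ge0 _)) lerD2l mulrC.
Qed.

End word_exchange.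

(** * Bi-infinite sequences and their free letters *)

Definition win (x : fullshift) (a : int) (n : nat) : seq letter :=
  mkseq (fun i => x (a + i%:Z)) n.

Lemma size_win x a n : size (win x a n) = n.
Proof. exact: size_mkseq. Qed.

Lemma nth_win l x a n i : (i < n)%N -> nth l (win x a n) i = x (a + i%:Z).
Proof. exact: nth_mkseq. Qed.

Lemma eq_win x y a b n : (forall i, (i < n)%N -> x (a + i%:Z) = y (b + i%:Z)) ->
  win x a n = win y b n.
Proof.
move=> h; apply: (@eq_from_nth _ (Alpha false)); rewrite ?size_win // => i hi.
by rewrite !nth_win // h.
Qed.

Lemma win_agree x y a n : win x a n = win y a n ->
  forall k : int, a <= k < a + n%:Z -> x k = y k.
Proof.
move=> h k hk; have -> : k = a + (`|k - a|%N)%:Z by lia.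
have hi : (`|k - a| < n)%N by lia.
by rewrite -(nth_win (Alpha false) x a hi) -(nth_win (Alpha false) y a hi) h.
Qed.

Lemma win_cat x a m n : win x a (m + n) = win x a m ++ win x (a + m%:Z) n.
Proof.
apply: (@eq_from_nth _ (Alpha false)); rewrite ?size_cat ?size_win // => i hi.
rewrite nth_win // nth_cat size_win; case: ltnP => him; rewrite nth_win //; last by lia.
by congr x; lia.
Qed.

Lemma win_cons x a n : win x a n.+1 = x a :: win x (a + 1) n.
Proof. by rewrite -add1n win_cat /win /mkseq /= addr0. Qed.

Lemma win_rcons x a n : win x a n.+1 = rcons (win x a n) (x (a + n%:Z)).
Proof. by rewrite -addn1 win_cat cats1 /win /mkseq /= addr0. Qed.

Lemma take_win x a m n : (m <= n)%N -> take m (win x a n) = win x a m.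
Proof. by move=> h; rewrite -(subnKC h) win_cat take_size_cat ?size_win. Qed.

Lemma drop_win x a m n : (m <= n)%N -> drop m (win x a n) = win x (a + m%:Z) (n - m).
Proof. by move=> h; rewrite -{1}(subnKC h) win_cat drop_size_cat ?size_win. Qed.

Lemma win_shift k x a n : win (shiftz k x) a n = win x (a + k) n.
Proof. by apply: eq_win => i _; rewrite /shiftz addrAC. Qed.

Lemma win_infix x a m b n : b <= a -> a + m%:Z <= b + n%:Z ->
  win x b n = win x b `|a - b| ++ win x a m ++ win x (a + m%:Z) (n - m - `|a - b|).
Proof.
move=> ba h; have E : n = (`|a - b| + (m + (n - m - `|a - b|)))%N by lia.
rewrite {1}E !win_cat; have -> : b + `|a - b|%:Z = a by lia.
by [].
Qed.

Lemma dyckP x : dyck x <-> forall a n, pend (win x a n) != None.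
Proof.
split=> [h a n|h a n]; last by move/reduces_pend/eqP; apply/negP; exact: h.
by apply/eqP => /pend_reduces; exact: h.
Qed.

Lemma dyck_shift k x : dyck (shiftz k x) <-> dyck x.
Proof.
split=> /dyckP h; apply/dyckP => a n; last by rewrite win_shift.
by have := h (a - k) n; rewrite win_shift subrK.
Qed.

(** The two-sided counterpart of [bar]: it preserves the Dyck shift and exchanges free openings with
    free closings, so that [downs] inherits what is proved for [ups]. *)
Definition rho (x : fullshift) : fullshift := fun k => inv_letter (x (- k)).

Lemma rhoK : involutive rho.
Proof. by move=> x; apply/funext => k; rewrite /rho opprK inv_letterK. Qed.

Lemma win_rho x a n : win (rho x) a n = bar (win x (1 - a - n%:Z) n).
Proof.
apply: (@eq_from_nth _ (Alpha false)); rewrite ?size_bar ?size_win // => i hi.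
rewrite nth_win // /bar (nth_map (Alpha false)) ?size_rev ?size_win // nth_rev ?size_win
  //.
by rewrite nth_win; [rewrite /rho; congr (inv_letter (x _)); lia | lia].
Qed.

Lemma dyck_rho x : dyck (rho x) <-> dyck x.
Proof.
suff h y : dyck y -> dyck (rho y) by split => [/h|/h //]; rewrite rhoK.
by move/dyckP => h; apply/dyckP => a n; rewrite win_rho pend_bar_None.
Qed.

Lemma rho_shift k x : rho (shiftz k x) = shiftz (- k) (rho x).
Proof. by apply/funext => i; rewrite /rho /shiftz opprD opprK. Qed.

Definition free_opening (x : fullshift) (k : int) : Prop :=
  ~~ is_closing (x k) /\ forall n, pend (win x (k + 1) n) = Some [::].

Definition free_closing (x : fullshift) (k : int) : Prop :=
  is_closing (x k) /\ forall n, pend (bar (win x (k - n%:Z) n)) = Some [::].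

Lemma is_closing_inv l : is_closing (inv_letter l) = ~~ is_closing l.
Proof. by case: l. Qed.

Lemma free_opening_rho x k : free_opening (rho x) k <-> free_closing x (- k).
Proof.
rewrite /free_opening /free_closing {1}/rho is_closing_inv negbK.
by split=> -[h1 h2]; split=> // n; have := h2 n; rewrite win_rho;
  have -> : 1 - (k + 1) - n%:Z = - k - n%:Z by lia.
Qed.

Lemma free_closing_rho x k : free_closing (rho x) k <-> free_opening x (- k).
Proof. by rewrite -{2}(rhoK x) -{1}(opprK k); split => /free_opening_rho. Qed.

Lemma free_opening_shift m x k : free_opening (shiftz m x) k <-> free_opening x (k + m).
Proof.
rewrite /free_opening {1}/shiftz; split=> -[h1 h2]; split=> // n; have := h2 n;
  by rewrite win_shift addrAC.
Qed.

Lemma free_closing_shift m x k : free_closing (shiftz m x) k <-> free_closing x (k + m).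
Proof.
rewrite /free_closing {1}/shiftz; split=> -[h1 h2]; split=> // n; have := h2 n;
  by rewrite win_shift addrAC.
Qed.

(** The word between the two would have no free letters, hence height 0, and the closing would bring
    the height to -1. *)
Lemma opening_before_closing x l k : dyck x -> free_opening x l -> free_closing x k -> ~
  l < k.
Proof.
move=> /dyckP D [_ ho] [kc hc] lk.
set n := `|(k - (l + 1))%R|%N; have E : k = l + 1 + n%:Z by rewrite /n; lia.
have := hc n; have -> : k - n%:Z = l + 1 by lia.
move=> hb; have := ho n.+1; rewrite win_rcons -E => h1; have h0 := ho n.
have := npend_ht (D (l + 1) n); rewrite /npend hb h0 /= subr0 => h2.
have := pend0_ht h1; rewrite ht_rcons -h2; by case: (x k) kc.
Qed.

(** Written with natural numbers so that it is a countable combination of measurable sets; [upsP]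
    and [ups_of] translate to integers. *)
Definition ups : set fullshift := [set x | dyck x /\
  forall N : nat, exists j : nat, free_opening x (- (N + j)%N%:Z)].

Definition downs : set fullshift := [set x | ups (rho x)].

Definition matched : set fullshift := [set x | dyck x /\
  forall k, ~ free_opening x k /\ ~ free_closing x k].

Lemma upsP x (N : int) : ups x -> exists2 k : int, k < N & free_opening x k.
Proof.
by case=> _ /(_ (`|N| + 1)%N) [j h]; exists (- (`|N| + 1 + j)%N%:Z) => //; lia.
Qed.

Lemma ups_of x : dyck x -> (forall N : int, exists2 k : int, k < N & free_opening x k) ->
  ups x.
Proof.
move=> D h; split=> // N; have [k kN hk] := h (- N%:Z).
exists `|(- k - N%:Z)%R|%N; have -> : (- (N + `|(- k - N%:Z)%R|)%N%:Z) = k by lia.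
by [].
Qed.

Lemma ups_shift k x : ups (shiftz k x) <-> ups x.
Proof.
split=> u; apply: ups_of; try by apply/(dyck_shift k); case: u.
- move=> N; have [i iN] := upsP (N - k) u; rewrite free_opening_shift => h.
  by exists (i + k) => //; lia.
- move=> N; have [i iN h] := upsP (N + k) u; exists (i - k); first by lia.
  by rewrite free_opening_shift subrK.
Qed.

Lemma ups_no_closing x k : ups x -> ~ free_closing x k.
Proof.
move=> u c; have [l lk o] := upsP k u; case: u => d _.
exact: opening_before_closing d o c lk.
Qed.

Lemma ht_win_change x y (a : int) n (b : int) m :
  (forall k : int, k < a \/ a + n%:Z <= k -> x k = y k) ->
  ht (win x b m) - ht (win y b m) <= 2 * n%:Z.
Proof.
move=> xy.
(* The induction needs a running count: two for each position of the changed window up to the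
   current one. *)
suff : ht (win x b m) - ht (win y b m) <=
    if b + m%:Z <= a then 0 else if b + m%:Z <= a + n%:Z then 2 * (b + m%:Z - a) else 2 *
      n%:Z.
  by do !case: ifP; lia.
elim: m => [|m IH]; first by rewrite /win /mkseq /= ht_nil; do !case: ifP; lia.
rewrite !win_rcons !ht_rcons.
have S l : -1 <= sgn_letter l <= 1 by case: l.
have := S (x (b + m%:Z)); have := S (y (b + m%:Z)).
have [h|h] : (b + m%:Z < a \/ a + n%:Z <= b + m%:Z) \/ (a <= b + m%:Z < a + n%:Z) by lia.
  by rewrite (xy _ h); move: IH; do !case: ifP; lia.
by move: IH; do !case: ifP; lia.
Qed.

(** Passing one more free opening of [x] to the left adds one to all heights further right, so from
    some free opening the heights of [x] are at least 2 n from the window on. In [y] they are lower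
    by at most 2 n, hence nonnegative, and [pend0_prefixes] applies. *)
Lemma common_free_opening x y (a : int) n (N : int) : ups x -> dyck y ->
  (forall k : int, k < a \/ a + n%:Z <= k -> x k = y k) ->
  exists k : int, [/\ k < a, k < N, free_opening x k & free_opening y k].
Proof.
move=> u /dyckP dy xy.
have P K : exists k : int, [/\ k < a, k < N, free_opening x k &
    forall m, a <= k + 1 + m%:Z -> K%:Z <= ht (win x (k + 1) m)].
  elim: K => [|K [k [ka kN ok hk]]].
    have [k kN ok] := upsP (Num.min a N) u; move: kN; rewrite lt_min => /andP[ka kN].
    by exists k; split=> // m _; apply: pend0_ht; case: ok.
  have [l lk ol] := upsP k u; exists l; split=> //; try by lia.
  move=> m hm; have E : m = (`|(k - (l + 1))%R| + (`|((l + 1 + m%:Z) - (k + 1))%R|).+1)%N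
    by lia.
  rewrite E win_cat ht_cat win_cons ht_cons.
  have -> : l + 1 + `|(k - (l + 1))%R|%N%:Z = k by lia.
  have h1 : 0 <= ht (win x (l + 1) `|(k - (l + 1))%R|%N) by apply: pend0_ht; case: ol.
  have := hk `|((l + 1 + m%:Z) - (k + 1))%R|%N; case: ok => + _.
  case: (x k) => //= _ _. lia.
have [k [ka kN ok hk]] := P (2 * n)%N.
exists k; split=> //; split; first by rewrite -xy; [case: ok | left].
move=> m; apply: pend0_prefixes => // i; rewrite size_win => im; rewrite take_win //.
have [h|h] : k + 1 + i%:Z <= a \/ a <= k + 1 + i%:Z by lia.
  rewrite (@eq_win y x (k + 1) (k + 1)); first by apply: pend0_ht; case: ok.
  by move=> j ji; rewrite xy //; left; lia.
have := hk i h; have := @ht_win_change x y a n (k + 1) i xy; lia.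
Qed.

Lemma ups_change x y (a : int) n : ups x -> dyck y ->
  (forall k : int, k < a \/ a + n%:Z <= k -> x k = y k) -> ups y.
Proof.
move=> u d xy; apply: ups_of => // N.
by have [k [_ kN _ o]] := common_free_opening N u d xy; exists k.
Qed.

Local Open Scope classical_set_scope.
Local Open Scope ring_scope.

(** * The pressure *)

Section partition_sums.
Variable R : realType.
Implicit Type F : letter -> R.

Definition Zsum F (n : nat) : R :=
  \sum_(w <- words n) (pend w != None)%:R * expR (wt F w).

Lemma wt_bar F w : wt (F \o inv_letter) (bar w) = wt F w.
Proof.
rewrite /wt /bar big_map (perm_big _ (permEl (perm_rev w))) /=.
by apply: eq_bigr => l _; rewrite /= inv_letterK.
Qed.

Lemma Zsum_bar F n : Zsum (F \o inv_letter) n = Zsum F n.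
Proof.
rewrite /Zsum -big_words_bar; apply: eq_bigr => w _.
by rewrite wt_bar pend_bar_None.
Qed.

Lemma wpair_bar F : wpair (F \o inv_letter) = wpair F.
Proof. by rewrite /wpair !big_bool /= ![F (AlphaInv _) + _]addrC. Qed.

Definition lamo F : R := lam F (wopen F).

Definition lamF F : R := Num.max (lamo F) (lamo (F \o inv_letter)).

Lemma lamo_gt0 F : 0 < lamo F.
Proof. by rewrite lam_gt0 // wopen_gt0. Qed.

Lemma lamF_gt0 F : 0 < lamF F.
Proof. by rewrite /lamF lt_max lamo_gt0. Qed.

Lemma lnq_wopen F w s : pend w = Some s ->
  lnq F (wopen F) w = - (size w)%:R * ln (lamo F) + wt F w
    + \sum_(j <- s) (F (Alpha j) - ln (wopen F)).
Proof. by move=> E; rewrite /lnq E subrr mul0r addr0. Qed.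

Lemma F_le_ln_wopen F j : F (Alpha j) <= ln (wopen F).
Proof.
rewrite -[leLHS]expRK ler_ln ?posrE ?expR_gt0 ?wopen_gt0 //.
by rewrite /wopen; case: j; rewrite ?lerDl ?lerDr expR_ge0.
Qed.

(** A pending closing only lowers [lnq], since F(alpha_j) <= ln wopen; hence lamo^n q(w) <= e^(wt
    w), and [q] has mass 1. Without pending closings this is an equality, which gives
    [open_sum_le]. *)
Lemma lamo_le_Zsum F n : lamo F ^+ n <= Zsum F n.
Proof.
have l0 : 0 < lamo F ^+ n by rewrite exprn_gt0 // lamo_gt0.
rewrite -[leLHS]mulr1 -[X in _ * X <= _](sum_q F n (wopen_gt0 F)) mulr_sumr.
apply: le_big_words => w wn; rewrite /q.
have [E|E] := eqVneq (pend w) None; first by rewrite mulr0 mul0r.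
rewrite mul1r; case Es : (pend w) E => [s|] // _.
rewrite -[lamo F ^+ n]lnK ?posrE // -expRD ler_expR (lnq_wopen _ Es) wn lnXn ?lamo_gt0 //.
have : \sum_(j <- s) (F (Alpha j) - ln (wopen F)) <= 0.
  by apply: sumr_le0 => j _; rewrite subr_le0 F_le_ln_wopen.
rewrite -mulr_natl; lra.
Qed.

Lemma open_sum_le F n :
  \sum_(w <- words n) (pend w == Some [::])%:R * expR (wt F w) <= lamo F ^+ n.
Proof.
have l0 : 0 < lamo F ^+ n by rewrite exprn_gt0 // lamo_gt0.
rewrite -[leRHS]mulr1 -[X in _ <= _ * X](sum_q F n (wopen_gt0 F)) mulr_sumr.
apply: le_big_words => w wn; have [E|E] := eqVneq (pend w) (Some [::]); last first.
  by rewrite mul0r mulr_ge0 ?q_ge0 // ltW.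
rewrite /= mul1r /q E /= -[lamo F ^+ n]lnK ?posrE // -expRD ler_expR.
by rewrite (lnq_wopen _ E) big_nil wn lnXn ?lamo_gt0 // -mulr_natl; lra.
Qed.

(** Each word is cut as in [pend_split]; [open_sum_le] covers the right piece and, after [bar], the
    left one. The factor n + 1 counts the cuts. *)
Lemma Zsum_le F n : Zsum F n <= n.+1%:R * lamF F ^+ n.
Proof.
pose T (k : nat) := (\sum_(u <- words k) (pend (bar u) == Some [::])%:R * expR (wt F u)) *
  (\sum_(v <- words (n - k)) (pend v == Some [::])%:R * expR (wt F v)).
apply: le_trans (_ : \sum_(k < n.+1) T k <= _); last first.
  have -> : n.+1%:R * lamF F ^+ n = \sum_(k < n.+1) lamF F ^+ k * lamF F ^+ (n - k).
    rewrite (eq_bigr (fun=> lamF F ^+ n)); first by rewrite sumr_const card_ord mulr_natl.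
    by move=> k _; rewrite -exprD subnKC // -ltnS ltn_ord.
  apply: ler_sum => k _; apply: ler_pM.
  - by apply: sumr_ge0 => *; rewrite mulr_ge0 // expR_ge0.
  - by apply: sumr_ge0 => *; rewrite mulr_ge0 // expR_ge0.
  - apply: le_trans (_ : lamo (F \o inv_letter) ^+ k <= _); last first.
      by apply: lerXn2r; rewrite ?nnegrE ?(ltW (lamF_gt0 _)) ?(ltW (lamo_gt0 _)) // /lamF
        le_max lexx orbT.
    apply: le_trans (open_sum_le _ _); rewrite -[leRHS]big_words_bar.
    by apply: ler_sum => w _; rewrite wt_bar.
  - apply: le_trans (open_sum_le _ _) _.
    by apply: lerXn2r; rewrite ?nnegrE ?(ltW (lamF_gt0 _)) ?(ltW (lamo_gt0 _)) // /lamF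
      le_max lexx.
have TE (k : 'I_n.+1) : T k = \sum_(w <- words n)
    ((pend (bar (take k w)) == Some [::]) && (pend (drop k w) == Some [::]))%:R * expR
      (wt F w).
  have kn : (k <= n)%N by rewrite -ltnS ltn_ord.
  rewrite -{2}(subnKC kn) big_words_cat /T mulr_suml; apply: eq_big_words => u uk.
  rewrite mulr_sumr; apply: eq_bigr => v _.
  by rewrite take_size_cat // drop_size_cat // wt_cat expRD -mulnb natrM; ring.
rewrite (eq_bigr _ (fun k _ => TE k)) exchange_big /=; apply: le_big_words => w wn.
have [E|E] := eqVneq (pend w) None.
  by rewrite mul0r; apply: sumr_ge0 => *; rewrite mulr_ge0 // expR_ge0.
have [k kw [h1 h2]] := pend_split E; rewrite wn -ltnS in kw.
rewrite (bigD1 (Ordinal kw)) //= h1 h2 !eqxx lerDl.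
by apply: sumr_ge0 => *; rewrite mulr_ge0 // expR_ge0.
Qed.

Lemma lamF_le_Zsum F n : lamF F ^+ n <= Zsum F n.
Proof.
rewrite /lamF; case: (leP (lamo F)) => _; last exact: lamo_le_Zsum.
by rewrite -Zsum_bar; exact: lamo_le_Zsum.
Qed.

Lemma cvg_ln_Zsum F : (fun n => n%:R^-1 * ln (Zsum F n)) @ \oo --> ln (lamF F).
Proof.
apply/cvgrPdist_le => e e0; have e2 : 0 < e / 2 by rewrite divr_gt0.
have [n1 h1] := large_nat (e / 2 - ln (e / 2)) e2.
exists (maxn n1 1) => // n /=; rewrite geq_max => /andP[/h1 h n0].
have lF := lamF_gt0 F; have Z1 := lamF_le_Zsum F n; have Z2 := Zsum_le F n.
have lFn : 0 < lamF F ^+ n by rewrite exprn_gt0.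
have Z0 : 0 < Zsum F n by apply: lt_le_trans Z1.
have n0' : 0 < n%:R :> R by rewrite ltr0n.
have L1 : n%:R * ln (lamF F) <= ln (Zsum F n).
  by rewrite mulr_natl -lnXn // ler_ln ?posrE.
have L2 : ln (Zsum F n) <= ln n.+1%:R + n%:R * ln (lamF F).
  by rewrite mulr_natl -lnXn // -lnM ?posrE ?ltr0n // ler_ln ?posrE ?mulr_gt0 ?ltr0n.
have L3 : ln n.+1%:R <= e / 2 * n.+1%:R - ln (e / 2).
  have x0 : 0 < e / 2 * n.+1%:R by rewrite mulr_gt0 ?ltr0n.
  have := @le_ln1Dx R (e / 2 * n.+1%:R - 1); rewrite [1 + _](_ : _ = e / 2 * n.+1%:R);
    last by ring.
  rewrite (_ : -1 < _) => [/(_ isT)|]; last by lra.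
  by rewrite lnM ?posrE ?ltr0n //; lra.
rewrite distrC ger0_norm;
  last by rewrite subr_ge0 -(ler_pM2l n0') mulrA divff ?gt_eqF // mul1r.
rewrite lerBlDr -(ler_pM2l n0') mulrA divff ?gt_eqF // mul1r.
move: L2 L3; rewrite -[n.+1]addn1 natrD; lra.
Qed.

Lemma lam_gap F : 2 * Num.sqrt (wpair F) < lamF F.
Proof.
set a := wpair F; have a0 : 0 < a := wpair_gt0 F.
have s0 : 0 < Num.sqrt a by rewrite sqrtr_gt0.
have Ea : a = Num.sqrt a ^+ 2 by rewrite sqr_sqrtr // ltW.
move: (Num.sqrt a) s0 Ea => s s0 Ea.
have gt_of t : 0 < t -> t != s -> 2 * s < t + a / t.
  move=> t0 ts; rewrite -(ltr_pM2l t0) mulrDr [t * (a / t)]mulrC divfK ?gt_eqF //.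
  have : 0 < (t - s) ^+ 2 by rewrite exprn_even_gt0 //= subr_eq0.
  by rewrite Ea; lra.
have [E1|N1] := eqVneq (wopen F) s; last first.
  by rewrite /lamF lt_max /lamo /lam gt_of ?wopen_gt0.
have [E2|N2] := eqVneq (wopen (F \o inv_letter)) s; last first.
  by rewrite /lamF lt_max /lamo /lam wpair_bar [X in _ || X]gt_of ?wopen_gt0 ?orbT.
(* Equality in both cases contradicts the two mixed terms, such as e^(F(alpha_1)) e^(F(alpha_2^-1)),
   by which the product exceeds [wpair F]. *)
have : wopen F * wopen (F \o inv_letter) = a by rewrite E1 E2 -expr2 -Ea.
rewrite /a /wpair big_bool /wopen /= !expRD => E.
have := mulr_gt0 (expR_gt0 (F (Alpha false))) (expR_gt0 (F (AlphaInv true))).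
have := mulr_gt0 (expR_gt0 (F (Alpha true))) (expR_gt0 (F (AlphaInv false))).
by nra.
Qed.

End partition_sums.

(** Continue with openings to the right and closings to the left: the former leave the stack empty,
    and a closing never causes a mismatch when it is read. *)
Lemma exists_dyck_word w : pend w != None -> exists2 x, dyck x & win x 1 (size w) = w.
Proof.
move=> aw; pose n := size w.
pose x : fullshift := fun k => if k <= 0 then AlphaInv false else
  if k <= n%:Z then nth (Alpha false) w `|(k - 1)%R|%N else Alpha false.
have xw : win x 1 n = w.
  apply: (@eq_from_nth _ (Alpha false)); rewrite size_win // => i hi.
  rewrite nth_win // /x; have -> : (1 + i%:Z <= 0) = false by lia.
  have -> : (1 + i%:Z <= n%:Z) by lia.
  by congr nth; lia.
have xl a m : a + m%:Z <= 1 -> win x a m = map AlphaInv (nseq m false).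
  move=> h; apply: (@eq_from_nth _ (Alpha false));
    rewrite size_win ?size_map ?size_nseq // => i hi.
  by rewrite nth_win // (nth_map false) ?size_nseq // nth_nseq hi /x; case: ifP => //;
    lia.
have xr a m : n%:Z < a -> win x a m = map Alpha (nseq m false).
  move=> h; apply: (@eq_from_nth _ (Alpha false));
    rewrite size_win ?size_map ?size_nseq // => i hi.
  rewrite nth_win // (nth_map false) ?size_nseq // nth_nseq hi /x;
    do 2?[case: ifP => //]; lia.
exists x => //; apply/dyckP => a m.
suff H b k : b <= 1 -> 1 + n%:Z <= b + k%:Z -> pend (win x b k) != None.
  have := H (Num.min a 1) (m + `|a| + n + 2)%N _ _.
  rewrite (@win_infix x a m (Num.min a 1)); [|lia|lia].
  by move=> h; apply: (@pend_prefix _ (win x (a + m%:Z) _));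
    apply: (@pend_suffix (win x (Num.min a 1) _)); apply: h; lia.
move=> b1 bk; rewrite (@win_infix x 1 n b) // xw xl; last by lia.
rewrite xr; last by lia.
rewrite !pend_cat pend_openings -/(pend w).
by case E : (pend w) aw => [s|] // _; rewrite foldr_closings.
Qed.

Section pressure.
Variables (R : realType) (f : fullshift -> R) (F : letter -> R).
Hypothesis fF : forall x, dyck x -> f x = F (x 0).

Lemma birkhoff_wt x n : dyck x ->
  \sum_(1 <= m < n.+1) f (iter m shift_map x) = wt F (win x 1 n).
Proof.
move=> dx; rewrite /wt /win /mkseq big_map big_add1 /= /index_iota subn0.
apply: eq_bigr => i _.
rewrite -[shift_map _]/(iter i.+1 shift_map x) iter_shift fF; last by apply/dyck_shift.
by rewrite /shiftz; congr (F (x _)); lia.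
Qed.

Lemma word_win n x : tval (word n x) = win x 1 n.
Proof.
rewrite /win; apply: (@eq_from_nth _ (Alpha false)).
  by rewrite size_tuple size_mkseq.
move=> i; rewrite size_tuple => hi; rewrite nth_mkseq //.
rewrite (_ : i = Ordinal hi) // -tnth_nth tnth_mktuple /=.
by congr x; lia.
Qed.

Lemma languageP n (a : n.-tuple letter) : (a \in @language n) = (pend a != None).
Proof.
apply/idP/idP; rewrite inE.
  by case=> x dx <-; rewrite word_win; move/dyckP: dx.
move=> h; have [x dx E] := exists_dyck_word h; exists x => //.
by apply: val_inj; rewrite /= -[RHS]E size_tuple; exact: word_win.
Qed.

Lemma partition_function_Zsum n : partition_function f n = Zsum F n.
Proof.
rewrite /partition_function (eq_bigl _ _ (@languageP n)) (eq_bigr (fun a : n.-tuple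
  letter => expR (wt F a))).
  by rewrite (big_words_tuple n (fun w => pend w != None) (fun w => expR (wt F w))) /=
    big_mkcond; apply: eq_bigr => w _; case: ifP => _; rewrite ?mul1r ?mul0r.
move=> a aL; congr expR; rewrite -[RHS]sup1; congr sup.
apply/seteqP; split => [r /= [x [dx <-] <-]|r /= ->].
  by rewrite birkhoff_wt // word_win.
have [x dx E] := exists_dyck_word aL; rewrite size_tuple in E.
by exists x; [split=> //; apply: val_inj; rewrite /= word_win | rewrite birkhoff_wt // E].
Qed.

Lemma pressureE : pressure f = ln (lamF F).
Proof.
rewrite /pressure (_ : (fun n => _) = (fun n => n%:R^-1 * ln (Zsum F n))).
  by apply: cvg_lim (@cvg_ln_Zsum _ F) => //; exact: Rhausdorff.
by apply/funext => n; rewrite partition_function_Zsum.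
Qed.

End pressure.

(** * Measurability *)

Definition agree (N : nat) (x y : fullshift) : Prop :=
  forall k : int, - N%:Z <= k <= N%:Z -> x k = y k.

(** These events form a generating algebra, used both to identify measures and to approximate
    measurable sets. *)
Definition window_event (E : set fullshift) : Prop :=
  exists N, forall x y, agree N x y -> E x -> E y.

Lemma agree_le M N x y : (M <= N)%N -> agree N x y -> agree M x y.
Proof. by move=> MN h k hk; apply: h; lia. Qed.

Lemma agree_sym N x y : agree N x y -> agree N y x.
Proof. by move=> h k hk; rewrite h. Qed.

Lemma window_eventT : window_event setT.
Proof. by exists 0%N. Qed.

Lemma window_event0 : window_event set0.
Proof. by exists 0%N. Qed.

Lemma window_eventI E G : window_event E -> window_event G -> window_event (E `&` G).
Proof.
move=> [M hE] [N hG]; exists (maxn M N) => x y xy [Ex Gx]; split.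
  by apply: hE Ex; apply: agree_le xy; rewrite leq_maxl.
by apply: hG Gx; apply: agree_le xy; rewrite leq_maxr.
Qed.

Lemma window_eventC E : window_event E -> window_event (~` E).
Proof. by move=> [N h]; exists N => x y /agree_sym xy nE Ey; apply: nE; apply: h Ey. Qed.

Lemma window_eventU E G : window_event E -> window_event G -> window_event (E `|` G).
Proof.
move=> hE hG; rewrite -[E `|` G]setCK setCU; apply: window_eventC.
by apply: window_eventI; apply: window_eventC.
Qed.

Lemma window_event_letter (P : letter -> Prop) k : window_event [set x | P (x k)].
Proof. by exists `|k|%N => x y xy /=; rewrite xy //; lia. Qed.

Lemma agree_filter x : Filter [set E : set fullshift | exists N, agree N x `<=` E].
Proof.
split; first by exists 0%N.
- move=> P Q [M hP] [N hQ]; exists (maxn M N) => y xy; split.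
    by apply: hP; apply: agree_le xy; rewrite leq_maxl.
  by apply: hQ; apply: agree_le xy; rewrite leq_maxr.
- by move=> P Q PQ [N hP]; exists N; exact: subset_trans PQ.
Qed.

Lemma agree_nbhs (x : fullshift) :
  {ptws, [set E : set fullshift | exists N, agree N x `<=` E] --> (x : int -> letter)}.
Proof.
have ? := agree_filter x; apply/cvg_sup => k U [V] [[W] oW <-] WxN WU.
exists `|k|%N => y xy; apply: WU => /=; rewrite -xy //; lia.
Qed.

Lemma open_agree (U : set {ptws int -> letter}) x : open U -> U x ->
  exists N, agree N x `<=` U.
Proof. by move=> oU Ux; apply: (@agree_nbhs x); exact: open_nbhs_nbhs. Qed.

Lemma measurable_letter (k : int) (l : letter) : measurable [set x : fullshift | x k = l].
Proof.
apply: sub_sigma_algebra;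
  have := @proj_continuous int (fun _ => letter : topologicalType) k.
case: (@continuousP {ptws int -> letter} letter (fun x => x k)) => h _ /h /(_ [set l]) H;
  apply: H.
exact: discrete_open.
Qed.

Lemma measurable_win_fun d (T : measurableType d) (g : T -> fullshift)
    (P : seq letter -> Prop) a n :
  (forall k l, measurable [set t | g t k = l]) ->
  measurable [set t | P (win (g t) a n)].
Proof.
move=> h.
have cyl w b : measurable [set t | win (g t) b (size w) = w].
  elim: w b => [|l w IH] b; first by rewrite (_ : [set _ | _] = setT) //; apply/seteqP;
    split.
  rewrite (_ : [set _ | _] = [set t | g t b = l] `&` [set t | win (g t) (b + 1) (size w)
    = w]).
    by apply: measurableI; [exact: h | exact: IH].
  by apply/seteqP; split=> x /=; rewrite win_cons; [case | case=> -> ->].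
rewrite (_ : [set _ | _] = \big[setU/set0]_(w <- words n | `[< P w >]) [set t | win (g t)
  a (size w) = w]).
  by apply: bigsetU_measurable => w _; exact: cyl.
apply/seteqP; split=> x /=.
  move=> Px; rewrite -bigcup_seq_cond; exists (win (g x) a n);
    last by rewrite /= size_win.
  by rewrite /= mem_words size_win eqxx; apply/asboolP.
rewrite -bigcup_seq_cond => -[w] /= /andP[]; rewrite mem_words => /eqP -> /asboolP Pw E.
by rewrite E.
Qed.

Lemma measurable_win (P : seq letter -> Prop) a n :
  measurable [set x : fullshift | P (win x a n)].
Proof. by apply: (@measurable_win_fun _ fullshift id); exact: measurable_letter. Qed.

Definition wide (N : nat) (x : fullshift) : seq letter := win x (- N%:Z) (2 * N).+1.

Lemma agreeP N x y : agree N x y <-> wide N x = wide N y.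
Proof.
split=> [h|/win_agree h k hk]; last by apply: h; lia.
by apply: eq_win => i hi; apply: h; lia.
Qed.

Lemma window_eventP E : window_event E -> exists N (P : seq letter -> Prop),
  E = [set x | P (wide N x)].
Proof.
move=> [N h]; exists N, (fun w => exists2 x, E x & wide N x = w).
apply/seteqP; split=> x /=; first by exists x.
by case=> y Ey /agreeP/h; apply.
Qed.

Lemma measurable_window E : window_event E -> measurable E.
Proof. by move=> /window_eventP[N [P ->]]; exact: measurable_win. Qed.

(** An open set is the countable union over [N] of the window events formed by the points whose
    [N]-window already forces membership. *)
Lemma measurable_fullshiftE : @measurable _ fullshift = <<s window_event >>.
Proof.
apply/seteqP; split; apply: smallest_sub.
- exact: smallest_sigma_algebra.
- move=> U oU; rewrite (_ : U = \bigcup_N [set x | agree N x `<=` U]).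
    apply: (@sigma_algebra_bigcup _ setT window_event) => N; apply: sub_sigma_algebra.
    by exists N => x y xy h z yz; apply: h => k hk; rewrite xy // yz.
  apply/seteqP; split=> x /=; last by case=> N _; apply.
  by move=> Ux; have [N h] := open_agree oU Ux; exists N.
- exact: sigma_algebra_measurable.
- exact: measurable_window.
Qed.

Lemma measurable_to_fullshift d (T : measurableType d) (g : T -> fullshift) :
  (forall k l, measurable [set t | g t k = l]) -> measurable_fun setT g.
Proof.
move=> h _ E; rewrite measurable_fullshiftE setTI => sE.
suff H : <<s window_event >> `<=` [set E | measurable (g @^-1` E)] by exact: H.
apply: smallest_sub.
  split=> [|G mG|G mG] /=.
  - by rewrite preimage_set0.
  - by rewrite setTD preimage_setC; exact: measurableC.
  - by rewrite preimage_bigcup; exact: bigcupT_measurable.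
move=> {}E {sE} /window_eventP[N [P ->]] /=.
exact: (@measurable_win_fun _ _ g P (- N%:Z) (2 * N).+1 h).
Qed.

Lemma measurable_shiftz k : measurable_fun setT (shiftz k).
Proof. apply: measurable_to_fullshift => i l; exact: measurable_letter. Qed.

Lemma measurable_rho : measurable_fun setT rho.
Proof.
apply: measurable_to_fullshift => i l.
rewrite (_ : [set _ | _] = [set x : fullshift | x (- i) = inv_letter l]).
  exact: measurable_letter.
by apply/seteqP; split=> x; rewrite /mkset /rho; [move=> <-|move=> ->];
  rewrite inv_letterK.
Qed.

Definition subst (a : int) (v : seq letter) (x : fullshift) : fullshift :=
  fun k => if a <= k < a + (size v)%:Z then nth (Alpha false) v `|(k - a)%R|%N else x k.

Lemma subst_out a v x k : k < a \/ a + (size v)%:Z <= k -> subst a v x k = x k.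
Proof. by move=> h; rewrite /subst; case: ifP => //; lia. Qed.

Lemma win_subst a v x : win (subst a v x) a (size v) = v.
Proof.
apply: (@eq_from_nth _ (Alpha false)); rewrite size_win // => i hi.
rewrite nth_win // /subst; have -> : (a <= a + i%:Z < a + (size v)%:Z) by lia.
by congr nth; lia.
Qed.

Lemma subst_subst a u v x : size u = size v -> subst a u (subst a v x) = subst a u x.
Proof.
by move=> uv; apply/funext => k; rewrite /subst uv; case: ifP => // ->.
Qed.

Lemma subst_win a x n : subst a (win x a n) x = x.
Proof.
apply/funext => k; rewrite /subst size_win; case: ifP => // h.
by rewrite nth_win; [congr x; lia | lia].
Qed.

Lemma measurable_subst a v : measurable_fun setT (subst a v).
Proof.
apply: measurable_to_fullshift => k l; rewrite /subst; case: (a <= k < a + (size v)%:Z).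
  exact: (measurable_win (fun w => nth (Alpha false) v `|(k - a)%R|%N = l) 0 0).
exact: measurable_letter.
Qed.

Lemma measurable_preimage d d' (T : measurableType d) (T' : measurableType d')
  (g : T -> T') E : measurable_fun setT g -> measurable E -> measurable (g @^-1` E).
Proof. by move=> mg mE; rewrite -[_ @^-1` _]setTI; exact: mg. Qed.

Lemma measurable_forall_int (E : int -> set fullshift) :
  (forall k, measurable (E k)) -> measurable [set x | forall k, E k x].
Proof.
move=> mE; rewrite (_ : [set _ | _] = \bigcap_n (E n%:Z `&` E (- n%:Z))).
  by apply: bigcapT_measurable => n; apply: measurableI.
apply/seteqP; split=> x /= h; first by move=> n _; split; exact: h.
move=> k; have := h `|k|%N I; have [k0|k0] := leP 0 k; case=> h1 h2.
  by move: h1; rewrite (_ : `|k|%N%:Z = k) //; lia.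
by move: h2; rewrite (_ : - `|k|%N%:Z = k) //; lia.
Qed.

Lemma measurable_dyck : measurable dyck.
Proof.
rewrite (_ : dyck = [set x | forall a : int, (\bigcap_n [set x | pend (win x a n) !=
  None]) x]).
  apply: measurable_forall_int => a; apply: bigcapT_measurable => n.
  exact: (measurable_win (fun w => pend w != None)).
apply/seteqP; split=> x /=.
  by move/dyckP => h a n _; exact: h.
by move=> h; apply/dyckP => a n; exact: (h a n I).
Qed.

Lemma measurable_free_opening k : measurable [set x | free_opening x k].
Proof.
rewrite (_ : [set _ | _] = [set x | ~~ is_closing (x k)] `&`
   \bigcap_n [set x | pend (win x (k + 1) n) = Some [::]]).
  apply: measurableI; first by apply: measurable_window;
    exact: (window_event_letter (fun l => ~~ is_closing l)).
  by apply: bigcapT_measurable => n;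
    exact: (measurable_win (fun w => pend w = Some [::])).
by apply/seteqP; split=> x /= -[h1 h2]; split=> // n; [move=> _;
  exact: h2 | exact: (h2 n I)].
Qed.

Lemma measurable_free_closing k : measurable [set x | free_closing x k].
Proof.
rewrite (_ : [set _ | _] = rho @^-1` [set x | free_opening x (- k)]).
  by apply: measurable_preimage; [exact: measurable_rho | exact: measurable_free_opening].
by apply/seteqP; split=> x; rewrite /preimage /mkset free_opening_rho opprK.
Qed.

Lemma measurable_ups : measurable ups.
Proof.
rewrite (_ : ups = dyck `&` \bigcap_N \bigcup_j [set x | free_opening x (- (N +
  j)%N%:Z)]).
  apply: measurableI; first exact: measurable_dyck.
  apply: bigcapT_measurable => N; apply: bigcupT_measurable => j.
  exact: measurable_free_opening.
apply/seteqP; split=> x /= -[h1 h2]; split=> // N.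
  by move=> _; have [j h] := h2 N; exists j.
by have [j _ h] := h2 N I; exists j.
Qed.

Lemma measurable_downs : measurable downs.
Proof. by apply: measurable_preimage;
  [exact: measurable_rho | exact: measurable_ups]. Qed.

Lemma measurable_matched : measurable matched.
Proof.
rewrite (_ : matched = dyck `&` [set x | forall k : int, (~` [set x | free_opening x k]
  `&` ~` [set x | free_closing x k]) x]).
  apply: measurableI; first exact: measurable_dyck.
  apply: measurable_forall_int => k; apply: measurableI; apply: measurableC.
    exact: measurable_free_opening.
  exact: measurable_free_closing.
by apply/seteqP; split.
Qed.

(** * Word distributions of invariant measures *)

Section real_probability.
Context d (T : measurableType d) (R : realType) (mu : probability T R).

Definition pr (E : set T) : R := fine (mu E).

Lemma prE E : measurable E -> mu E = (pr E)%:E.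
Proof. by move=> mE; rewrite fineK // fin_num_measure. Qed.

Lemma pr_ge0 E : 0 <= pr E.
Proof. by rewrite fine_ge0. Qed.

Lemma pr0 : pr set0 = 0.
Proof. by rewrite /pr measure0. Qed.

Lemma prT : pr setT = 1.
Proof. by rewrite /pr probability_setT. Qed.

Lemma pr_le E G : measurable E -> measurable G -> E `<=` G -> pr E <= pr G.
Proof. by move=> mE mG EG; rewrite -lee_fin -!prE // le_measure ?inE. Qed.

Lemma pr_le1 E : measurable E -> pr E <= 1.
Proof. by move=> mE; rewrite -prT pr_le. Qed.

Lemma prU E G : measurable E -> measurable G -> E `&` G = set0 ->
  pr (E `|` G) = pr E + pr G.
Proof.
move=> mE mG EG; apply: EFin_inj; rewrite EFinD -!prE //; last exact: measurableU.
by rewrite measureU.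
Qed.

Lemma prU_le E G : measurable E -> measurable G -> pr (E `|` G) <= pr E + pr G.
Proof.
move=> mE mG; rewrite -lee_fin EFinD -!prE //; last exact: measurableU.
exact: measureU2.
Qed.

Lemma pr_partition (K : eqType) (s : seq K) (g : T -> K) E : uniq s ->
  (forall v, measurable [set x | g x = v]) -> measurable E ->
  (forall x, E x -> g x \in s) ->
  pr E = \sum_(v <- s) pr (E `&` [set x | g x = v]).
Proof.
move=> us mg mE Es.
have ms (s' : seq K) : measurable [set x | g x \in s'].
  elim: s' => [|v s' IH]; first by rewrite (_ : [set _ | _] = set0) //; apply/seteqP;
    split.
  rewrite (_ : [set _ | _] = [set x | g x = v] `|` [set x | g x \in s']);
    first exact: measurableU.
  by apply/seteqP; split=> x /=; rewrite inE; [move=> /orP[/eqP|];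
    [left|right] | move=> [->|->]; rewrite ?eqxx ?orbT].
suff H (s' : seq K) : uniq s' -> pr (E `&` [set x | g x \in s']) = \sum_(v <- s') pr (E
  `&` [set x | g x = v]).
  rewrite -H //; congr pr; apply/seteqP; split=> x; last by case.
  by move=> Ex; split=> //; exact: Es.
elim: s' => [|v s' IH] /=.
  by rewrite big_nil (_ : _ `&` _ = set0) ?pr0 //; apply/seteqP; split=> x // [].
move=> /andP[vs us']; rewrite big_cons -IH // -prU; try exact: measurableI.
  congr pr; apply/seteqP; split=> x /=; rewrite inE.
    by case=> Ex /orP[/eqP|]; [left|right].
  by case=> -[Ex ->]; rewrite ?eqxx ?orbT.
by apply/seteqP; split=> x //= -[[_ gv] [_ gs]]; rewrite gv (negbTE vs) in gs.
Qed.

Lemma pr_decreasing (E : nat -> set T) (e : R) : (forall n, measurable (E n)) ->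
  (forall n, E n.+1 `<=` E n) -> 0 < e ->
  exists n0, forall n, (n0 <= n)%N -> pr (E n) <= pr (\bigcap_n E n) + e.
Proof.
move=> mE dE e0; have mI : measurable (\bigcap_n E n) by exact: bigcapT_measurable.
have H : mu \o E @ \oo --> mu (\bigcap_n E n).
  apply: nonincreasing_cvg_mu => //; first by rewrite ltey_eq fin_num_measure.
  by apply/nonincreasing_seqP => n; apply/subsetPset; exact: dE.
have {}H : (fun n => pr (E n)) @ \oo --> pr (\bigcap_n E n).
  by apply: fine_cvg; rewrite -prE.
move/cvgrPdist_le : H => /(_ _ e0) [n0 _ h]; exists n0 => n hn.
by have := h n hn; rewrite /= ler_norml; lra.
Qed.

Lemma pr_increasing (E : nat -> set T) (e : R) : (forall n, measurable (E n)) ->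
  (forall n, E n `<=` E n.+1) -> 0 < e ->
  exists n0, forall n, (n0 <= n)%N -> pr (\bigcup_n E n) <= pr (E n) + e.
Proof.
move=> mE dE e0.
have [||n0 h] := @pr_decreasing (fun n => ~` E n) _ _ _ e0.
- by move=> n; apply: measurableC.
- by move=> n; apply: subsetC; exact: dE.
exists n0 => n /h; have mU : measurable (\bigcup_n E n) by exact: bigcupT_measurable.
have C G : measurable G -> pr (~` G) = 1 - pr G.
  move=> mG; rewrite -prT -(setUv G) prU ?setICr //; last exact: measurableC.
  by rewrite addrAC subrr add0r.
by rewrite -setC_bigcup !C //; lra.
Qed.

End real_probability.

Section stationary.
Variables (R : realType) (mu : probability fullshift R).
Hypothesis inv : shift_invariant mu.

Lemma mu_shiftz k E : measurable E -> mu (shiftz k @^-1` E) = mu E.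
Proof.
have H (n : nat) G : measurable G -> mu (shiftz n%:Z @^-1` G) = mu G.
  elim: n G => [|n IH] G mG.
    by congr (mu _); apply/seteqP; split=> x; rewrite /preimage /mkset /shiftz;
      (rewrite (_ : (fun k0 : int => x (k0 + 0%N)) = x); last by apply/funext => i;
        rewrite addr0).
  rewrite -[RHS]inv // -[RHS]IH //; last by apply: measurable_preimage => //;
    exact: measurable_shiftz.
  have -> : n.+1%:Z = 1 + n%:Z by lia.
  by congr (mu _); apply/seteqP; split=> x; rewrite /preimage /mkset /shift_map shiftzD.
move=> mE; case: k => n; first exact: H.
rewrite -[LHS](H n.+1); last by apply: measurable_preimage => //;
  exact: measurable_shiftz.
congr (mu _); apply/seteqP; split=> x; rewrite /preimage /mkset shiftzD NegzE addNr;
  by (rewrite (_ : shiftz 0 x = x); last by apply/funext => i; rewrite /shiftz addr0).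
Qed.

Variable U : set fullshift.
Hypotheses (mU : measurable U) (Ushift : forall k x, U (shiftz k x) <-> U x)
  (Udyck : U `<=` dyck).

(** Restricting to an invariant set keeps stationarity, so [ups], [downs] and [matched] each yield a
    [word_dist], with mass [pr mu U]. *)
Definition pword (w : seq letter) : R := pr mu ([set x | win x 1 (size w) = w] `&` U).

Lemma pr_shift k E : measurable E -> pr mu (shiftz k @^-1` E `&` U) = pr mu (E `&` U).
Proof.
move=> mE; rewrite /pr -[in RHS](mu_shiftz k); last exact: measurableI.
rewrite preimage_setI; congr (fine (mu (_ `&` _))).
by apply/seteqP; split=> x; rewrite /preimage /mkset Ushift.
Qed.

Lemma pr_cyl a w : pr mu ([set x | win x a (size w) = w] `&` U) = pword w.
Proof.
rewrite /pword -[RHS](pr_shift (a - 1)) //; last exact: (measurable_win (fun z => z = w)).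
congr (pr mu (_ `&` _)); apply/seteqP; split=> x; rewrite /preimage /mkset win_shift;
by have -> : 1 + (a - 1) = a by lia.
Qed.

Lemma pr_win (P : pred (seq letter)) a n :
  pr mu ([set x | P (win x a n)] `&` U) = \sum_(w <- words n) (P w)%:R * pword w.
Proof.
rewrite (@pr_partition _ _ _ _ _ (words n) (fun x => win x a n)) ?uniq_words //.
- apply: eq_big_words => w wn; rewrite -(pr_cyl a) wn.
  case Pw : (P w); rewrite ?mul1r ?mul0r.
    congr pr; apply/seteqP; split=> x /=; first by case=> -[].
    by case=> E Ux; rewrite E.
  by rewrite (_ : _ `&` _ = set0) ?pr0 //; apply/seteqP; split=> x //= -[[+ _] E];
    rewrite E Pw.
- by move=> v; exact: (measurable_win (fun z => z = v)).
- by apply: measurableI => //; exact: (measurable_win (fun z => P z)).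
- by move=> x _; rewrite mem_words size_win.
Qed.

Lemma word_dist_pword : word_dist pword.
Proof.
split=> [w|w|w|w E].
- exact: pr_ge0.
- rewrite -[RHS](pr_cyl 2) [RHS](@pr_partition _ _ _ _ _ (enum {: letter}) (fun x :
  fullshift => x 1)) ?enum_uniq //.
  + rewrite big_enum; apply: eq_bigr => l _; rewrite -(pr_cyl 1); congr pr.
    apply/seteqP; split=> x;
      rewrite /setI /mkset (_ : size (l :: w) = (size w).+1) // win_cons.
      by case=> -[E1 E2] Ux; split=> //; split=> //; exact: E2.
    by case=> -[E1 Ux] E2; split=> //; rewrite E2; congr (_ :: _); exact: E1.
  + by move=> l; exact: measurable_letter.
  + by apply: measurableI => //; exact: (measurable_win (fun z => z = w)).
  + by move=> x _; rewrite mem_enum.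
- rewrite -[RHS](pr_cyl 1) [RHS](@pr_partition _ _ _ _ _ (enum {: letter}) (fun x :
  fullshift => x (1 + (size w)%:Z))) ?enum_uniq //.
  + rewrite big_enum; apply: eq_bigr => l _; rewrite -(pr_cyl 1); congr pr.
    apply/seteqP; split=> x; rewrite /setI /mkset size_rcons win_rcons.
      by case=> /eqP; rewrite eqseq_rcons => /andP[/eqP h1 /eqP h2] Ux.
    by case=> -[E1 Ux] E2; rewrite E1 E2.
  + by move=> l; exact: measurable_letter.
  + by apply: measurableI => //; exact: (measurable_win (fun z => z = w)).
  + by move=> x _; rewrite mem_enum.
- rewrite /pword (_ : _ `&` _ = set0) ?pr0 //; apply/seteqP; split=> x //= -[xw Ux].
  by have /dyckP/(_ 1 (size w)) := Udyck Ux; rewrite xw E.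
Qed.

Lemma pword_nil : pword [::] = pr mu U.
Proof. by rewrite /pword (_ : [set _ | _] = setT) ?setTI //; apply/seteqP; split. Qed.

(** The defect is the measure of the event that 0 carries a closing without a partner among the n
    letters before it. These events decrease to a free closing at 0, which [U] excludes. *)
Lemma defect_pword_small : (forall x, U x -> ~ free_closing x 0) ->
  eventually_small (defect pword).
Proof.
move=> nc e e0.
pose P n (z : seq letter) := is_closing (last (Alpha false) z) && (pend (bar (take n z))
  == Some [::]).
pose D n := [set x | P n (win x (- n%:Z) n.+1)] `&` U.
have DE n x : D n x <-> [/\ is_closing (x 0), pend (bar (win x (- n%:Z) n)) = Some [::] &
  U x].
  rewrite /D /P /setI /mkset win_rcons last_rcons addNr -cats1 take_cat size_win ltnn
    subnn take0 cats0.
  by split=> [[/andP[h1 /eqP h2] h3]|[h1 h2 h3]]; split=> //; rewrite h1 h2.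
have mD n : measurable (D n) by apply: measurableI => //; exact: (measurable_win (P n)).
have dD n : D n.+1 `<=` D n.
  move=> x /DE[h1 h2 h3]; apply/DE; split=> //; move: h2.
  rewrite win_cons bar_cons -cats1 => /pend_prefix0.
  by have -> : - n.+1%:Z + 1 = - n%:Z by lia.
have [n0 h] := pr_decreasing mu mD dD e0.
exists n0 => n /h; rewrite (_ : \bigcap_n D n = set0).
  rewrite pr0 add0r; apply: le_trans; rewrite pr_win /defect big_words_rcons le_eqVlt;
    apply/orP; left; apply/eqP.
  apply: eq_big_words => w wn; apply: eq_bigr => l _.
  by rewrite /P last_rcons -cats1 take_cat wn ltnn subnn take0 cats0 mulrC.
apply/seteqP; split=> x // Dx; have /DE[_ _ Ux] := Dx 0%N I.
apply: (nc x Ux); split; first by have /DE[] := Dx 0%N I.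
by move=> n'; have /DE[] := Dx n' I; rewrite sub0r.
Qed.

End stationary.

(** * The exchange identity *)

(** Both sides are finite measures in [E], and the window events are a generating pi-system. *)
Lemma window_measure_unique (R : realType) (mu : probability fullshift R)
    (phi : fullshift -> fullshift) (D1 D2 : set fullshift) (c : R) :
  measurable_fun setT phi -> measurable D1 -> measurable D2 -> 0 <= c ->
  (forall E, window_event E -> pr mu (phi @^-1` E `&` D1) = c * pr mu (E `&` D2)) ->
  forall E, measurable E -> pr mu (phi @^-1` E `&` D1) = c * pr mu (E `&` D2).
Proof.
move=> mphi m1 m2 c0 H E mE.
have mp G : measurable G -> measurable (phi @^-1` G `&` D1).
  by move=> mG; apply: measurableI => //; exact: measurable_preimage.
pose nu1 : {measure set fullshift -> \bar R} :=
  measure_function_pushforward__canonical__measure_function_Measure (mrestr mu m1) mphi.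
pose nu2 : {measure set fullshift -> \bar R} := mscale (NngNum c0) (mrestr mu m2).
have E1 G : measurable G -> nu1 G = (pr mu (phi @^-1` G `&` D1))%:E.
  by move=> mG; rewrite -prE //; exact: mp.
have E2 G : measurable G -> nu2 G = (c * pr mu (G `&` D2))%:E.
  by move=> mG; rewrite EFinM -prE //; exact: measurableI.
apply: EFin_inj; rewrite -E1 // -E2 //.
apply: (measure_unique window_event (fun _ => setT)) => //.
- exact: measurable_fullshiftE.
- exact: window_eventI.
- by move=> _; exact: window_eventT.
- by apply/seteqP; split=> // x _; exists 0%N.
- by move=> G wG; have mG := measurable_window wG; rewrite E1 // E2 // H.
- by move=> _; rewrite E1 // ltry.
Qed.

Section measure_exchange.
Variables (R : realType) (mu : probability fullshift R) (F : letter -> R).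
Hypothesis inv : shift_invariant mu.

Let p := pword mu ups.

Lemma word_dist_ups : word_dist p.
Proof.
apply: word_dist_pword => //; first exact: measurable_ups.
- by move=> k x; exact: ups_shift.
- by move=> x [].
Qed.

Hypothesis sK : sublinear (Kfun F (wopen F) p).

Lemma pr_ups_pattern (h : seq letter -> seq letter -> bool) w a m i :
  pr mu ([set x | win x a (size w) = w /\ h (win x (a - m%:Z) m) (win x (a + (size w)%:Z)
    i)] `&` ups) =
  \sum_(b <- words m) \sum_(r <- words i) (h b r)%:R * p (b ++ w ++ r).
Proof.
pose P (z : seq letter) := (take (size w) (drop m z) == w) && h (take m z) (drop (m +
  size w) z).
have PE x : P (win x (a - m%:Z) (m + (size w + i))) <->
    win x a (size w) = w /\ h (win x (a - m%:Z) m) (win x (a + (size w)%:Z) i).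
  rewrite /P win_cat subrK (win_cat x a) take_size_cat ?size_win // drop_size_cat
    ?size_win //.
  rewrite take_size_cat ?size_win // catA drop_size_cat ?size_cat ?size_win //.
  by split=> [/andP[/eqP]|[-> ->]] //; rewrite eqxx.
rewrite (_ : _ `&` ups = [set x | P (win x (a - m%:Z) (m + (size w + i)))] `&` ups);
  last first.
  by apply/seteqP; split=> x [/PE h1 h2].
rewrite (pr_win inv measurable_ups ups_shift) big_words_cat; apply: eq_big_words => b bm.
rewrite big_words_cat (bigD1_seq w) ?uniq_words ?mem_words //= [X in _ + X]big1_seq
  ?addr0.
  apply: eq_bigr => r _; rewrite /P drop_size_cat // take_size_cat // eqxx /=.
  by rewrite take_size_cat // catA drop_size_cat ?size_cat ?bm.
move=> w' /andP[w'w]; rewrite mem_words => /eqP sw.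
rewrite big1 // => r _; rewrite /P drop_size_cat // take_size_cat //.
by rewrite (negbTE w'w) mul0r.
Qed.

Variables (a : int) (u v : seq letter) (d : nat).
Hypothesis uv : size u = size v.
Let D := expR (wt F v - wt F u).

(* The opening at distance d to the left of the window has no partner among the
   letters up to the i-th one after the window, before and after the replacement
   of u by v. *)
Definition exch_set (i : nat) : set fullshift :=
  [set x | [/\ win x a (size u) = u, ~~ is_closing (x (a - d.+1%:Z)),
    pend (win x (a - d%:Z) (d + (size u + i))) = Some [::] &
    pend (win (subst a v x) (a - d%:Z) (d + (size u + i))) = Some [::]]].

Lemma win_subst_split x m i : win (subst a v x) (a - m%:Z) (m + (size u + i)) =
  win x (a - m%:Z) m ++ v ++ win x (a + (size u)%:Z) i.
Proof.
rewrite uv win_cat subrK (win_cat _ a) win_subst; congr (_ ++ (_ ++ _)).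
  by apply: eq_win => j hj; rewrite subst_out //; lia.
by apply: eq_win => j hj; rewrite subst_out //; lia.
Qed.

Lemma exch_setP x m i : (d < m)%N -> win x a (size u) = u ->
  (good_pair u v d (win x (a - m%:Z) m) (win x (a + (size u)%:Z) i) <-> exch_set i x).
Proof.
move=> dm xu.
have Ec : drop (m - d) (win x (a - m%:Z) m) = win x (a - d%:Z) d.
  by rewrite drop_win ?leq_subr //; congr (win x _ _); lia.
rewrite /good_pair size_win Ec dm /= nth_win; last by lia.
have -> : a - m%:Z + (m - d.+1)%N%:Z = a - d.+1%:Z by lia.
rewrite /exch_set /mkset win_subst_split win_cat subrK (win_cat x a) xu.
by split=> [/and3P[h1 /eqP h2 /eqP h3]|[_ h1 h2 h3]]; [split | apply/and3P; split=> //;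
  apply/eqP].
Qed.

Lemma exch_set_decreasing i : exch_set i.+1 `<=` exch_set i.
Proof.
move=> x [h1 h2 h3 h4]; split=> //.
- by move: h3; rewrite !addnS win_rcons -cats1 => /pend_prefix0.
- by move: h4; rewrite !addnS win_rcons -cats1 => /pend_prefix0.
Qed.

Lemma measurable_exch_set i : measurable (exch_set i).
Proof.
rewrite (_ : exch_set i = [set x | win x a (size u) = u] `&` ([set x | ~~ is_closing (x
  (a - d.+1%:Z))]
  `&` ([set x | pend (win x (a - d%:Z) (d + (size u + i))) = Some [::]] `&`
  [set x | pend (win (subst a v x) (a - d%:Z) (d + (size u + i))) = Some [::]]))).
  apply: measurableI; first exact: (measurable_win (fun z => z = u)).
  apply: measurableI; first by apply: measurable_window;
    exact: (window_event_letter (fun l => ~~ is_closing l)).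
  apply: measurableI; first exact: (measurable_win (fun z => pend z = Some [::])).
  exact: (measurable_preimage (measurable_subst a v) (measurable_win (fun z => pend z =
    Some [::]) (a - d%:Z) (d + (size u + i)))).
by apply/seteqP; split=> x; rewrite /exch_set /setI /mkset; [case | case=> h1 [h2 []]].
Qed.

Lemma measurable_exch : measurable (\bigcap_i exch_set i).
Proof. by apply: bigcapT_measurable; exact: measurable_exch_set. Qed.

(** For large [i] the letters around the window decide [E], so [exchange_sum_small] compares [Y i]
    with [X i]. These sets decrease to the two in the statement, so a single large [i] with a small
    error is enough, and such [i] is all that is available. *)
Lemma exchange_window E : window_event E ->
  pr mu (subst a u @^-1` E `&` ([set y | win y a (size v) = v] `&` (subst a u @^-1`
    (\bigcap_i exch_set i)) `&` ups)) =
  D * pr mu (E `&` (\bigcap_i exch_set i `&` ups)).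
Proof.
move=> wE; have mE := measurable_window wE; case: (wE) => N hE.
pose Y i := (subst a u @^-1` (E `&` exch_set i) `&` [set y | win y a (size v) = v]) `&`
  ups.
pose X i := (E `&` exch_set i) `&` ups.
have mX i : measurable (X i).
  by apply: measurableI; [apply: measurableI => //;
    exact: measurable_exch_set | exact: measurable_ups].
have mY i : measurable (Y i).
  apply: measurableI; last exact: measurable_ups.
  apply: measurableI; last exact: (measurable_win (fun z => z = v)).
  apply: (measurable_preimage (measurable_subst a u)).
  by apply: measurableI => //; exact: measurable_exch_set.
have dX i : X i.+1 `<=` X i by move=> x [[h1 /exch_set_decreasing h2] h3].
have dY i : Y i.+1 `<=` Y i by move=> x [[[h1 /exch_set_decreasing h2] h3] h4].
have D0 : 0 < D by exact: expR_gt0.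
rewrite (_ : _ `&` (_ `&` ups) = \bigcap_i Y i); last first.
  apply/seteqP; split=> x.
    by case=> h1 [[h2 h3] h4] i _; split=> //; split=> //; split=> //; exact: h3.
  move=> h; have [[[h1 _] h2] h3] := h 0%N I; split=> //; split=> //; split=> // i _.
  by have [[[]]] := h i I.
rewrite (_ : E `&` (_ `&` ups) = \bigcap_i X i); last first.
  apply/seteqP; split=> x.
    by case=> h1 [h2 h3] i _; split=> //; split=> //; exact: h2.
  move=> h; have [[h1 _] h2] := h 0%N I; split=> //; split=> // i _.
  by have [[]] := h i I.
(* The left block must reach the coordinates of [E] before the window and the opening at
   [a - d.+1%:Z]. *)
pose m := (`|a| + N + d).+1.
pose e i (b r : seq letter) := `[< exists x, [/\ E x, win x a (size u) = u, win x (a -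
  m%:Z) m = b & win x (a + (size u)%:Z) i = r] >].
have eP x i : (`|a| + N < i)%N -> win x a (size u) = u ->
    e i (win x (a - m%:Z) m) (win x (a + (size u)%:Z) i) <-> E x.
  move=> hi xu; split=> [/asboolP [y [Ey yu yb yr]]|Ex]; last by apply/asboolP; exists x.
  apply: hE Ey => k hk.
  have [k1|[k1|k1]] : (a - m%:Z <= k < a - m%:Z + m%:Z) \/ ((a <= k < a + (size u)%:Z) \/
      (a + (size u)%:Z <= k < a + (size u)%:Z + i%:Z)) by rewrite /m; lia.
  - exact: (win_agree yb k1).
  - by apply: (@win_agree y x a (size u)); rewrite ?xu.
  - exact: (win_agree yr k1).
have XE i : (`|a| + N < i)%N -> pr mu (X i) = \sum_(b <- words m) \sum_(r <- words i)
    (e i b r && good_pair u v d b r)%:R * p (b ++ u ++ r).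
  move=> hi; rewrite -(pr_ups_pattern (fun b r => e i b r && good_pair u v d b r) u a).
  congr pr; apply/seteqP; split=> x.
    move=> [[Ex gx] ux]; have xu : win x a (size u) = u by case: gx.
    split=> //; split=> //; apply/andP; split; first exact/eP.
    by apply/(exch_setP _ _ xu) => //; rewrite /m; lia.
  move=> [[xu /andP[/(eP _ _ hi xu) Ex]]] g ux; split=> //; split=> //.
  by apply/(@exch_setP x m i) => //; rewrite /m; lia.
have YE i : (`|a| + N < i)%N -> pr mu (Y i) = \sum_(b <- words m) \sum_(r <- words i)
    (e i b r && good_pair u v d b r)%:R * p (b ++ v ++ r).
  move=> hi; rewrite -(pr_ups_pattern (fun b r => e i b r && good_pair u v d b r) v a).
  congr pr; apply/seteqP; split=> y; rewrite /Y /setI /preimage /mkset -uv.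
    move=> [[[Ex gx] yv] uy]; split=> //; split=> //.
    have xu : win (subst a u y) a (size u) = u by exact: win_subst.
    have := (eP _ _ hi xu).2 Ex.
    have mm : (d < m)%N by rewrite /m; lia.
    have := (exch_setP i mm xu).2 gx.
    rewrite (@eq_win (subst a u y) y (a - m%:Z) (a - m%:Z) m); last by move=> j hj;
      rewrite subst_out //; lia.
    rewrite (@eq_win (subst a u y) y (a + (size u)%:Z) (a + (size u)%:Z) i);
      last by move=> j hj; rewrite subst_out //; lia.
    by move=> -> ->.
  move=> [[yv g] uy].
  have xu : win (subst a u y) a (size u) = u by exact: win_subst.
  have mm : (d < m)%N by rewrite /m; lia.
  have [E1 E2] : win y (a - m%:Z) m = win (subst a u y) (a - m%:Z) m /\
     win y (a + (size u)%:Z) i = win (subst a u y) (a + (size u)%:Z) i.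
    by split; apply: eq_win => j hj; rewrite subst_out //; lia.
  move: g; rewrite E1 E2 => /andP[/(eP _ _ hi xu) Ey /(exch_setP i mm xu) gy].
  by [].
apply/eqP; rewrite -subr_eq0 -normr_le0; apply/ler_addgt0Pl => eps e0; rewrite addr0.
(* One share for the limit of [Y], one for the exchange and [D] shares for the limit of [X]. *)
have eps1 : 0 < eps / (2 + D) by rewrite divr_gt0 //; lra.
have [n1 h1] := pr_decreasing mu mX dX eps1.
have [n2 h2] := pr_decreasing mu mY dY eps1.
have [i hi H] := exchange_sum_small word_dist_ups d m (`|a| + N + n1 + n2).+1 uv sK eps1.
have hi' : (`|a| + N < i)%N by lia.
have {}H := H (e i); have {}h1 := h1 i _; have {}h2 := h2 i _.
have E0 : pr mu (Y i) - D * pr mu (X i) = \sum_(b <- words m) \sum_(r <- words i)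
        (e i b r && good_pair u v d b r)%:R *
          (p (b ++ v ++ r) - D * p (b ++ u ++ r)).
  rewrite XE // YE // mulr_sumr -sumrB; apply: eq_bigr => b _.
  rewrite mulr_sumr -sumrB; apply: eq_bigr => r _; ring.
have g1 : pr mu (\bigcap_n X n) <= pr mu (X i).
  apply: pr_le => //; first exact: bigcapT_measurable.
  by move=> x; apply.
have g2 : pr mu (\bigcap_n Y n) <= pr mu (Y i).
  apply: pr_le => //; first exact: bigcapT_measurable.
  by move=> x; apply.
move: H; rewrite -E0 ler_norml => /andP[H1 H2].
have := h1 ltac:(lia); have := h2 ltac:(lia) => {}h2 {}h1.
have Ee : eps = 2 * (eps / (2 + D)) + D * (eps / (2 + D)).
  by rewrite -mulrDl mulrC divfK // gt_eqF //; lra.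
have k1 : D * pr mu (\bigcap_n X n) <= D * pr mu (X i) by rewrite ler_pM2l.
have k2 : D * pr mu (X i) <= D * pr mu (\bigcap_n X n) + D * (eps / (2 + D)).
  by rewrite -mulrDr ler_pM2l.
rewrite ler_norml {2}Ee; move: (D * (eps / (2 + D))) k2 Ee => Z k2 Ee.
by apply/andP; split; lra.
Qed.

Lemma exchange_ups_d E : measurable E ->
  pr mu (subst a u @^-1` E `&` ([set y | win y a (size v) = v] `&` (subst a u @^-1`
    (\bigcap_i exch_set i)) `&` ups)) =
  D * pr mu (E `&` (\bigcap_i exch_set i `&` ups)).
Proof.
apply: window_measure_unique.
- exact: measurable_subst.
- apply: measurableI; last exact: measurable_ups.
  apply: measurableI; first exact: (measurable_win (fun z => z = v)).
  apply: (measurable_preimage (measurable_subst a u)); exact: measurable_exch.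
- by apply: measurableI; [exact: measurable_exch | exact: measurable_ups].
- exact: expR_ge0.
- exact: exchange_window.
Qed.

End measure_exchange.

HB.instance Definition _ :=
  isMeasurableFun.Build _ _ fullshift fullshift rho measurable_rho.

(** * The exchange identity on [ups], and the reflected measure *)

Section rho_exchange.
Variables (R : realType) (F : letter -> R).

(** By [common_free_opening] the sets [C d] cover the points concerned, but with unbounded [d]. The
    identity [H] is additive over disjoint sets, so it is collected over [d < n] and carried to the
    limit. *)
Lemma exchange_ups (mu : probability fullshift R) (a : int) u v B :
  shift_invariant mu -> sublinear (Kfun F (wopen F) (pword mu ups)) ->
  size u = size v -> measurable B -> B `<=` dyck ->
  pr mu ([set y | win y a (size v) = v /\ B (subst a u y)] `&` ups) =
  expR (wt F v - wt F u) *
    pr mu ([set x | [/\ B x, win x a (size u) = u & dyck (subst a v x)]] `&` ups).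
Proof.
move=> inv sK uv mB Bd; set D := expR _.
pose T E := (subst a u @^-1` E `&` [set y | win y a (size v) = v]) `&` ups.
pose H E := pr mu (T E) = D * pr mu (E `&` ups).
have mT E : measurable E -> measurable (T E).
  move=> mE; apply: measurableI; last exact: measurable_ups.
  apply: measurableI; last exact: (measurable_win (fun z => z = v)).
  exact: (measurable_preimage (measurable_subst a u)).
have mI E : measurable E -> measurable (E `&` ups) by move=> mE;
  apply: measurableI => //; exact: measurable_ups.
have HU E G : measurable E -> measurable G -> E `&` G = set0 -> H E -> H G -> H (E `|` G).
  move=> mE mG EG hE hG; rewrite /H setIUl prU; [|exact: mI|exact: mI|]; last first.
    by apply/seteqP; split=> x // [[Ex _] [Gx _]]; rewrite -EG.
  rewrite mulrDr -hE -hG -prU; [|exact: mT|exact: mT|]; last first.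
    apply/seteqP; split=> x // [[[Ex _] _] [[Gx _] _]].
    by have : (E `&` G) (subst a u x) by []; rewrite EG.
  congr pr; apply/seteqP; split=> x; first by move=> [[[Ex|Ex] h] h']; [left|right].
  by move=> [[[Ex h] h']|[[Ex h] h']]; split=> //; split=> //; [left|right].
pose C (d : nat) := \bigcap_i exch_set a u v d i.
have mC d : measurable (C d) by exact: measurable_exch.
have Hd d E : measurable E -> E `<=` C d -> H E.
  move=> mE EC; have := exchange_ups_d inv sK a d uv mE.
  rewrite [E `&` (_ `&` ups)]setIA (setIidl EC) => Q; rewrite /H /D -Q; congr pr;
    apply/seteqP; split=> x.
    by move=> [[h1 h2] h3]; split=> //; split=> //; split=> //; exact: EC.
  by move=> [h1 [[h2 h3] h4]].
pose S := [set x | [/\ B x, win x a (size u) = u & dyck (subst a v x)]].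
have mS : measurable S.
  rewrite (_ : S = B `&` ([set x | win x a (size u) = u] `&` subst a v @^-1` dyck)).
    apply: measurableI => //; apply: measurableI;
      first exact: (measurable_win (fun z => z = u)).
    by apply: (measurable_preimage (measurable_subst a v)); exact: measurable_dyck.
  by apply/seteqP; split=> x; rewrite /S /setI /mkset; [case | case=> h1 [h2 h3]].
pose CC n := \bigcup_(d < n) C d.
have mCC n : measurable (CC n) by apply: bigcup_measurable => d _; exact: mC.
have HS n : H ((S `&` CC n) `&` ups).
  elim: n => [|n IH].
    have -> : (S `&` CC 0) `&` ups = set0 by rewrite /CC bigcup_mkord big_ord0 setI0
      set0I.
    rewrite /H set0I pr0 mulr0 (_ : T set0 = set0) ?pr0 //.
    by apply/seteqP; split=> x // [[]].
  have -> : (S `&` CC n.+1) `&` ups = ((S `&` CC n) `&` ups) `|` (((S `&` C n) `\` CC n)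
    `&` ups).
    rewrite /CC !bigcup_mkord big_ord_recr /=; apply/seteqP; split=> x.
      move=> [[Sx [h|h]] ux]; first by left.
      by have [h'|h'] := pselect ((\big[setU/set0]_(i < n) C i) x); [left|right].
    by move=> [[[Sx h] ux]|[[[Sx h] h'] ux]]; split=> //; split=> //; [left|right].
  apply: HU => //.
  - by apply: mI; exact: measurableI.
  - by apply: mI; apply: measurableD => //; exact: measurableI.
  - by apply/seteqP; split=> x // [[[_ h] _] [[_ h'] _]].
  - apply: (Hd n); last by move=> x [[[_ h] _] _].
    by apply: mI; apply: measurableD => //; exact: measurableI.
have cov x : S x -> ups x -> exists n, CC n x.
  move=> [Bx xu dv] ux.
  have [|k [ka _ [p1 p2] [p3 p4]]] := @common_free_opening x (subst a v x) a (size u) a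
    ux dv.
    by move=> k hk; rewrite subst_out // -uv.
  exists (`|(a - 1 - k)%R|%N).+1, `|(a - 1 - k)%R|%N; first by rewrite /=.
  have Ek : k + 1 = a - (`|(a - 1 - k)%R|%N)%:Z by lia.
  move=> i _; split=> //; try by rewrite -Ek.
  by have -> : a - (`|(a - 1 - k)%R|%N).+1%:Z = k by lia.
(* Replacing finitely many letters does not leave [ups], by [ups_change]. *)
have TE : [set y | win y a (size v) = v /\ B (subst a u y)] `&` ups = T (S `&` ups).
  apply/seteqP; split=> y.
    move=> [[yv By] uy]; split=> //; split=> //.
    have dy : dyck y by case: uy.
    have Sy : S (subst a u y).
      split=> //; first exact: win_subst.
      by rewrite subst_subst // -{1}yv subst_win.
    split=> //; apply: (@ups_change y _ a (size u)) => //; first exact: Bd.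
    by move=> k hk; rewrite subst_out.
  by move=> [[[[By _ _] _] yv] uy].
have D0 : 0 < D by exact: expR_gt0.
rewrite TE -/S; apply/eqP; rewrite -subr_eq0 -normr_le0; apply/ler_addgt0Pl => eps e0;
  rewrite addr0.
have eps1 : 0 < eps / (1 + D) by rewrite divr_gt0 //; lra.
have cCC n : CC n `<=` CC n.+1 by move=> x [d /= dn h]; exists d => //=; apply: ltnW.
have [||n1 h1] := @pr_increasing _ _ _ mu (fun n => (S `&` CC n) `&` ups) (eps / (1 + D))
  _ _ eps1.
- by move=> n; apply: mI; exact: measurableI.
- by move=> n x [[h1 /cCC h2] h3].
have [||n2 h2] := @pr_increasing _ _ _ mu (fun n => T ((S `&` CC n) `&` ups)) (eps / (1 +
  D)) _ _ eps1.
- by move=> n; apply: mT; apply: mI; exact: measurableI.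
- by move=> n x [[[[h2 /cCC h3] h4] h5] h6].
have {}h1 := h1 _ (leq_addr n2 n1); have {}h2 := h2 _ (leq_addl n1 n2).
move: h1 h2; set n := (n1 + n2)%N.
have -> : \bigcup_n ((S `&` CC n) `&` ups) = S `&` ups.
  apply/seteqP; split=> x; first by case=> k _ [[]].
  by move=> [Sx ux]; have [k hk] := cov x Sx ux; exists k.
have -> : \bigcup_n (T ((S `&` CC n) `&` ups)) = T (S `&` ups).
  apply/seteqP; split=> x; first by case=> k _ [[[[]]]].
  move=> [[[Sx ux] h] h']; have [k hk] := cov _ Sx ux; exists k => //.
have e1 : pr mu ((S `&` CC n) `&` ups) <= pr mu (S `&` ups).
  by apply: pr_le; [apply: mI; exact: measurableI | exact: mI | move=> x [[]]].
have e2 : pr mu (T ((S `&` CC n) `&` ups)) <= pr mu (T (S `&` ups)).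
  apply: pr_le; [by apply: mT; apply: mI; exact: measurableI | by apply: mT; exact: mI |].
  by move=> x [[[[]]]].
have := HS n; rewrite /H (_ : ((S `&` CC n) `&` ups) `&` ups = (S `&` CC n) `&` ups);
  last first.
  by rewrite -[LHS]setIA setIid.
move=> HSn h1 h2.
have k1 : D * pr mu (S `&` ups) <= D * pr mu ((S `&` CC n) `&` ups) + D * (eps / (1 + D)).
  by rewrite -mulrDr ler_pM2l.
have k2 : D * pr mu ((S `&` CC n) `&` ups) <= D * pr mu (S `&` ups) by rewrite ler_pM2l.
have Ee : eps = eps / (1 + D) + D * (eps / (1 + D)).
  by rewrite -{1}[eps / (1 + D)]mul1r -mulrDl mulrC divfK // gt_eqF //; lra.
move: (eps / (1 + D)) Ee h1 h2 k1 k2 => t Ee h1 h2 k1 k2; rewrite ler_norml; apply/andP.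
by split; lra.
Qed.

Variable mu : probability fullshift R.
Hypothesis inv : shift_invariant mu.

Definition mu_rho : probability fullshift R := distribution mu rho.

Lemma pr_rho E : pr mu_rho E = pr mu (rho @^-1` E).
Proof. by []. Qed.

Lemma inv_rho : shift_invariant mu_rho.
Proof.
move=> E mE; rewrite /mu_rho /distribution /pushforward.
rewrite -[RHS](mu_shiftz inv (- 1)); last exact: measurable_preimage measurable_rho mE.
have e x : rho (shiftz (- 1) x) = shift_map (rho x) by rewrite rho_shift opprK.
by congr (mu _); apply/seteqP; split=> x; rewrite /preimage /= e.
Qed.

Lemma subst_rho a v x :
  subst (1 - a - (size v)%:Z) (bar v) (rho x) = rho (subst a v x).
Proof.
apply/funext => k; rewrite /rho /subst size_bar.
have -> : (a <= - k < a + (size v)%:Z) = (1 - a - (size v)%:Z <= k < 1 - a - (size v)%:Z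
  + (size v)%:Z) by lia.
case: ifP => // h; rewrite /bar (nth_map (Alpha false)) ?size_rev; last by lia.
by rewrite nth_rev; [congr (inv_letter (nth _ _ _)); lia | lia].
Qed.

Lemma pword_rho_bar U w :
  measurable U -> (forall k x, U (shiftz k x) <-> U x) ->
  pword mu_rho U (bar w) = pword mu (rho @^-1` U) w.
Proof.
move=> mU hU; rewrite /pword pr_rho.
rewrite -[RHS](pr_cyl inv _ _ (- (size w)%:Z) w).
- congr pr; apply/seteqP; split=> x;
  rewrite /setI /preimage /mkset size_bar win_rho subrr sub0r.
    by case=> /(congr1 bar); rewrite !barK.
  by case=> ->.
- exact: measurable_preimage measurable_rho mU.
- by move=> k x; rewrite /preimage /mkset rho_shift.
Qed.

Lemma Jfun_rho U n :
  measurable U -> (forall k x, U (shiftz k x) <-> U x) ->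
  Jfun (F \o inv_letter) (pword mu_rho U) n = Jfun F (pword mu (rho @^-1` U)) n.
Proof.
move=> mU hU; rewrite /Jfun -[LHS]big_words_bar; apply: eq_bigr => w _.
by rewrite pword_rho_bar // wt_bar.
Qed.

End rho_exchange.

(** * Recurrence of free letters *)

Section decomposition.
Variable R : realType.
Implicit Type mu : probability fullshift R.

Definition first_opening : set fullshift :=
  [set x | free_opening x 0 /\ forall j : nat, ~ free_opening x (- j.+1%:Z)].

Lemma measurable_first_opening : measurable first_opening.
Proof.
rewrite (_ : first_opening = [set x | free_opening x 0] `&` \bigcap_j ~` [set x |
  free_opening x (- j.+1%:Z)]).
  apply: measurableI; first exact: measurable_free_opening.
  by apply: bigcapT_measurable => j; apply: measurableC; exact: measurable_free_opening.
by apply/seteqP; split=> x [h1 h2]; split=> // j; [move=> _; exact: h2 | exact: (h2 j I)].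
Qed.

(** The shifts of this event are pairwise disjoint and have equal measure. *)
Lemma first_opening_null mu : shift_invariant mu -> pr mu first_opening = 0.
Proof.
move=> inv; have mF := measurable_first_opening.
have mS n : measurable (shiftz n @^-1` first_opening).
  exact: measurable_preimage (measurable_shiftz n) mF.
pose G n := \bigcup_(i < n) (shiftz i%:Z @^-1` first_opening).
have mG n : measurable (G n) by apply: bigcup_measurable => i _; exact: mS.
have E n : pr mu (G n) = n%:R * pr mu first_opening.
  elim: n => [|n IH]; first by rewrite /G bigcup_mkord big_ord0 pr0 mul0r.
  rewrite (_ : G n.+1 = G n `|` shiftz n%:Z @^-1` first_opening); last first.
    by rewrite /G !bigcup_mkord big_ord_recr.
  rewrite prU //; first by rewrite IH -[n.+1]addn1 natrD mulrDl mul1r {2}/pr mu_shiftz.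
  apply/seteqP; split=> x // [[i /= lin [hi _]] [_ hn]].
  apply: (hn (n - i.+1)%N); move: hi; rewrite !free_opening_shift.
  by have -> : - (n - i.+1).+1%:Z + n%:Z = 0 + i%:Z by lia.
apply/eqP; rewrite eq_le pr_ge0 andbT leNgt; apply/negP => p0.
have [n0 h] := large_nat 2 p0; have := h n0 (leqnn _).
by rewrite mulrC -E; have := pr_le1 mu (mG n0); lra.
Qed.

Definition opening_transient : set fullshift :=
  [set x | [/\ dyck x, exists k, free_opening x k & ~ ups x]].

(** Such a point has a leftmost free opening, so one of its countably many shifts lies in
    [first_opening]. *)
Lemma opening_transient_null mu : shift_invariant mu -> mu.-negligible opening_transient.
Proof.
move=> inv; have mF := measurable_first_opening.
have nF k : mu.-negligible (shiftz k @^-1` first_opening).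
  exists (shiftz k @^-1` first_opening); split=> //.
    exact: measurable_preimage (measurable_shiftz k) mF.
  rewrite mu_shiftz // prE //; by rewrite first_opening_null.
apply: negligibleS (negligible_bigcup (fun n : nat => negligibleU (nF n%:Z) (nF (-
  n%:Z)))).
move=> x [dx [k ok] nu].
have [N hN] : exists N : int, forall l : int, l < N -> ~ free_opening x l.
  apply: contrapT => hN; apply: nu; apply: ups_of => // N; apply: contrapT => h.
  by apply: hN; exists N => l lN ol; apply: h; exists l.
have ex : exists n, `[< free_opening x (N + n%:Z) >].
  exists `|(k - N)%R|%N; apply/asboolP; have kN : N <= k by rewrite leNgt;
    apply/negP => /hN.
  by have -> : N + (`|(k - N)%R|%N)%:Z = k by lia.
have [j /asboolP oj jmin] := ex_minnP ex.
have Fx : first_opening (shiftz (N + j%:Z) x).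
  split; first by rewrite free_opening_shift add0r.
  move=> i; rewrite free_opening_shift => oi.
  have [ij|ji] := ltnP i j; last by apply: (hN _ _ oi); lia.
  have := jmin (j - i.+1)%N;
    have -> : N + (j - i.+1)%N%:Z = - i.+1%:Z + (N + j%:Z) by lia.
  by move=> h; have := h (asboolT oi); lia.
exists `|(N + j%:Z)%R|%N => //; have [h|h] := leP 0 (N + j%:Z); [left|right].
  by rewrite /preimage /mkset (_ : (`|(N + j%:Z)%R|%N)%:Z = N + j%:Z) //; lia.
by rewrite /preimage /mkset (_ : - (`|(N + j%:Z)%R|%N)%:Z = N + j%:Z) //; lia.
Qed.

Lemma pr_decomposition mu E : shift_invariant mu -> measurable E -> E `<=` dyck ->
  pr mu E = pr mu (E `&` ups) + pr mu (E `&` downs) + pr mu (E `&` matched).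
Proof.
move=> inv mE Ed.
have mI G : measurable G -> measurable (E `&` G) by move=> mG; exact: measurableI.
have mu1 := mI _ measurable_ups; have mu2 := mI _ measurable_downs;
  have mu3 := mI _ measurable_matched.
pose Q := (E `&` ups `|` E `&` downs) `|` E `&` matched.
have mQ : measurable Q by apply: measurableU => //; exact: measurableU.
have dis1 : (E `&` ups `|` E `&` downs) `&` (E `&` matched) = set0.
  apply/seteqP; split=> x // [[[_ ux]|[_ ux]] [_ [_ m]]].
    by have [k _ o] := upsP 0 ux; case: (m k).
  by have [k _ /free_opening_rho o] := upsP 0 ux; case: (m (- k)).
have dis2 : (E `&` ups) `&` (E `&` downs) = set0.
  apply/seteqP; split=> x // [[_ ux] [_ dx]].
  by have [k _ /free_opening_rho o] := upsP 0 dx; exact: (ups_no_closing ux o).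
rewrite -prU // -prU //; last exact: measurableU.
apply/eqP; rewrite eq_le; apply/andP; split; last by apply: pr_le => // x [[[]|[]]|[]].
rewrite -/Q -[leRHS]addr0 -[X in _ + X](_ : pr mu (E `\` Q) = 0).
  rewrite -prU //; [|exact: measurableD|by rewrite setIDA setIC -setIDA setDv setI0].
  apply: pr_le => //; first by apply: measurableU => //; exact: measurableD.
  by move=> x Ex; have [h|h] := pselect (Q x); [left|right].
rewrite /pr; suff -> : mu (E `\` Q) = 0%E by [].
apply: measure_negligible; first exact: measurableD.
have N1 := opening_transient_null inv.
have N2 : mu.-negligible (rho @^-1` opening_transient).
  have [G [mG G0 sG]] := opening_transient_null (inv_rho inv).
  exists (rho @^-1` G); split;
    [exact: measurable_preimage measurable_rho mG | exact: G0 |].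
  by move=> x; exact: sG.
apply: negligibleS (negligibleU N1 N2) => x [Ex nQ].
have dx := Ed _ Ex.
have nu : ~ ups x by move=> h; apply: nQ; left; left.
have nd : ~ downs x by move=> h; apply: nQ; left; right.
have [ho|no] := pselect (exists k, free_opening x k); first by left.
have [ho|nc] := pselect (exists k, free_opening (rho x) k).
  by right; split=> //; apply/dyck_rho.
case: nQ; right; split=> //; split=> // k; split=> h; first by apply: no; exists k.
by apply: nc; exists (- k); apply/free_opening_rho; rewrite opprK.
Qed.

End decomposition.

(** * Entropy of the generating partition *)

Section approximation.
Variables (R : realType) (mu : probability fullshift R).

Definition symdiff (E G : set fullshift) := (E `\` G) `|` (G `\` E).

Lemma measurable_symdiff E G : measurable E -> measurable G -> measurable (symdiff E G).
Proof. by move=> mE mG; apply: measurableU; apply: measurableD. Qed.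

Definition approximable (E : set fullshift) : Prop := measurable E /\
  forall e : R, 0 < e -> exists2 G, window_event G & pr mu (symdiff E G) <= e.

Lemma approximableU E1 E2 : approximable E1 -> approximable E2 -> approximable (E1 `|`
  E2).
Proof.
move=> [m1 h1] [m2 h2]; split; first exact: measurableU.
move=> e e0; have e2 : 0 < e / 2 by rewrite divr_gt0.
have [G1 w1 p1] := h1 _ e2; have [G2 w2 p2] := h2 _ e2.
have g1 := measurable_window w1; have g2 := measurable_window w2.
exists (G1 `|` G2); first exact: window_eventU.
have s1 := measurable_symdiff m1 g1; have s2 := measurable_symdiff m2 g2.
apply: le_trans (_ : pr mu (symdiff E1 G1 `|` symdiff E2 G2) <= _).
  apply: pr_le; [by apply: measurable_symdiff; apply: measurableU | exact: measurableU |].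
  move=> x [[[h|h] n]|[[h|h] n]].
  - by left; left; split=> // g; apply: n; left.
  - by right; left; split=> // g; apply: n; right.
  - by left; right; split=> // g; apply: n; left.
  - by right; right; split=> // g; apply: n; right.
by have := prU_le mu s1 s2; lra.
Qed.

(** The approximable sets form a sigma-algebra containing the window events. For a countable union,
    a finite subunion is approximated. *)
Lemma measurable_approximable E : measurable E -> approximable E.
Proof.
rewrite measurable_fullshiftE => sE.
suff H : <<s window_event >> `<=` approximable by exact: H.
have C0 : approximable set0.
  split=> // e e0; exists set0; first exact: window_event0.
  by rewrite /symdiff setDv setU0 pr0 ltW.
apply: smallest_sub => [|{}E {sE} wE]; last first.
  split; first exact: measurable_window.
  by move=> e e0; exists E => //; rewrite /symdiff setDv setU0 pr0 ltW.
split=> // [E1|E1] => [[m1 h1]|h1].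
  rewrite setTD; split; first exact: measurableC.
  move=> e /h1[G wG pG]; exists (~` G); first exact: window_eventC.
  suff -> : symdiff (~` E1) (~` G) = symdiff E1 G by [].
  rewrite /symdiff !setDE !setCK; apply/seteqP.
  by split=> x [[a b]|[a b]]; [right|left|right|left].
have mE n : measurable (E1 n) by case: (h1 n).
pose V n := \bigcup_(i < n) E1 i.
have aV n : approximable (V n).
  elim: n => [|n IH]; first by rewrite /V bigcup_mkord big_ord0.
  rewrite (_ : V n.+1 = V n `|` E1 n); first exact: approximableU.
  by rewrite /V !bigcup_mkord big_ord_recr.
have mV n : measurable (V n) by case: (aV n).
have UV : \bigcup_n V n = \bigcup_n E1 n.
  apply/seteqP; split=> x; first by move=> [n _ [i _ h]]; exists i.
  by move=> [n _ h]; exists n.+1 => //; exists n => /=.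
have mU : measurable (\bigcup_n E1 n) by exact: bigcupT_measurable.
split=> // e e0; have e2 : 0 < e / 2 by rewrite divr_gt0.
have dV n : V n `<=` V n.+1 by move=> x [i /= lin h]; exists i => //=; apply: ltnW.
have [n hn] := pr_increasing mu mV dV e2.
have [_ /(_ _ e2) [G wG pG]] := aV n.
have mG := measurable_window wG.
exists G => //; have ms := measurable_symdiff (mV n) mG.
apply: le_trans (_ : pr mu ((\bigcup_n E1 n) `\` V n `|` symdiff (V n) G) <= _).
  apply: pr_le; [exact: measurable_symdiff | by apply: measurableU => //;
    exact: measurableD |].
  move=> x [[h n1]|[h n1]].
    by have [v|v] := pselect (V n x); [right; left | left].
  right; right; split=> // v; apply: n1; rewrite -UV; by exists n.
apply: le_trans (prU_le _ _ _) _ => //; first exact: measurableD.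
have : pr mu (\bigcup_n E1 n) = pr mu ((\bigcup_n E1 n) `\` V n) + pr mu (V n).
  rewrite -prU //; [|exact: measurableD|by apply/seteqP; split=> x // [[]]].
  congr pr; apply/seteqP; split=> x.
    by move=> h; have [v|v] := pselect (V n x); [right|left].
  by case=> [[]//|v]; rewrite -UV; exists n.
by have := hn n (leqnn _); rewrite UV; lra.
Qed.

Lemma pr_bigU_le (I : Type) (s : seq I) (E : I -> set fullshift) :
  (forall i, measurable (E i)) ->
  pr mu (\big[setU/set0]_(i <- s) E i) <= \sum_(i <- s) pr mu (E i).
Proof.
move=> mE; elim: s => [|i s IH]; first by rewrite !big_nil pr0.
rewrite !big_cons; apply: le_trans (prU_le _ (mE i) _) _.
  by apply: bigsetU_measurable => j _.
by rewrite lerD2l.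
Qed.

(** Approximate each piece within e / k by a window event and let the first event containing the
    point decide. A wrong decision places the point in one of the symmetric differences. *)
Lemma approx_partition k (xi : fullshift -> 'I_k) (e : R) :
  (forall i, measurable (xi @^-1` [set i])) -> 0 < e ->
  exists N (g : seq letter -> 'I_k),
    pr mu [set x | xi x != g (wide N x)] <= e.
Proof.
move=> mxi e0.
have k0 : (0 < k)%N by case: (xi point) => i; exact: leq_ltn_trans.
have ek : 0 < e / k%:R by rewrite divr_gt0 // ltr0n.
have /choice[G hG] : forall i, exists G, window_event G /\ pr mu (symdiff (xi @^-1` [set
  i]) G) <= e / k%:R.
  by move=> i; have [_ /(_ _ ek) [G wG pG]] := measurable_approximable (mxi i); exists G.
have /choice[Ns hN] : forall i, exists N, forall x y, agree N x y -> G i x -> G i y.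
  by move=> i; case: (hG i).
pose N := \max_i Ns i.
pose xi' x := odflt (xi point) [pick i | `[< G i x >]].
have dxi x y : wide N x = wide N y -> xi' x = xi' y.
  move=> /agreeP xy; rewrite /xi'; congr odflt; apply: eq_pick => i;
    apply/asboolP/asboolP.
    by apply: hN; apply: agree_le xy; exact: leq_bigmax.
  by apply: hN; apply: agree_le (agree_sym xy); exact: leq_bigmax.
(* A word is completed to some point showing it; by [dxi] the result does not depend on the
   completion. *)
exists N, (fun w => xi' (xget point [set x | wide N x = w])).
have E x : xi' (xget point [set y | wide N y = wide N x]) = xi' x.
  by apply: dxi; exact: (@xgetPex _ point [set y | wide N y = wide N x] (ex_intro _ x
    erefl)).
have mS i : measurable (symdiff (xi @^-1` [set i]) (G i)).
  by apply: measurable_symdiff => //; apply: measurable_window; case: (hG i).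
have mW : measurable [set x | xi' x = xi x].
  rewrite (_ : [set _ | _] = \big[setU/set0]_(i <- index_enum 'I_k) (xi @^-1` [set i] `&`
    [set x | xi' x = i])).
    apply: bigsetU_measurable => i _; apply: measurableI => //.
    rewrite (_ : [set _ | _] = [set x | (fun w => xi' (xget point [set y | wide N y = w])
      = i) (wide N x)]).
      exact: (measurable_win (fun w => xi' (xget point [set y | wide N y = w]) = i) (-
        N%:Z) (2 * N).+1).
    by apply/seteqP; split=> x /=; rewrite E.
  rewrite -bigcup_seq; apply/seteqP; split=> x /=.
    by move=> h; exists (xi x); rewrite /= ?mem_index_enum.
  by case=> i _ [<-].
apply: le_trans (_ : pr mu (\big[setU/set0]_(i <- index_enum 'I_k) symdiff (xi @^-1` [set
  i]) (G i)) <= _).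
  apply: pr_le.
  - rewrite (_ : [set _ | _] = ~` [set x | xi' x = xi x]); first exact: measurableC.
    apply/seteqP; split=> x /=; rewrite E; first by move=> /eqP h h1; apply: h.
    by move=> h; apply/eqP => h1; apply: h.
  - by apply: bigsetU_measurable => i _.
  - move=> x /=; rewrite E => nx; rewrite -bigcup_seq; apply: contrapT => nS.
    have H i : G i x <-> xi x = i.
      split=> h; apply: contrapT => h'; apply: nS; exists i;
        rewrite /= ?mem_index_enum //.
        by right; split.
      by left; split.
    move/eqP: nx; apply; rewrite /xi';
      case: pickP => [i /asboolP /H //|/(_ (xi x)) /asboolP h].
    by case: h; apply/H.
apply: le_trans (pr_bigU_le _ mS) _.
apply: le_trans (_ : \sum_(i : 'I_k) e / k%:R <= _).
  by apply: ler_sum => i _; case: (hG i).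
by rewrite sumr_const card_ord -[_ *+ k]mulr_natr divfK // pnatr_eq0 -lt0n.
Qed.

End approximation.

Section finite_entropy.
Variable R : realType.

(* Gibbs' inequality against the reference measure [Q w * r i w]. *)
Lemma entropy_le_cond (I : finType) (K : eqType) (ws : seq K) (p r : I -> K -> R) :
  (forall i w, 0 <= p i w) -> (forall i w, 0 < r i w) ->
  (forall w, \sum_i r i w = 1) ->
  \sum_i eta (\sum_(w <- ws) p i w) <=
  \sum_(w <- ws) eta (\sum_i p i w) - \sum_(w <- ws) \sum_i p i w * ln (r i w).
Proof.
move=> p0 r0 r1; pose P i := \sum_(w <- ws) p i w; pose Q w := \sum_i p i w.
have PE : \sum_i eta (P i) = - \sum_(w <- ws) \sum_i p i w * ln (P i).
  rewrite exchange_big -sumrN; apply: eq_bigr => i _; by rewrite /eta -mulr_suml.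
have QE : \sum_(w <- ws) eta (Q w) = - \sum_(w <- ws) \sum_i p i w * ln (Q w).
  rewrite -sumrN; apply: eq_bigr => w _; by rewrite /eta -mulr_suml.
rewrite -/(P _) PE QE -opprD lerN2 -big_split /=.
have -> : \sum_(w <- ws) \sum_i p i w * ln (P i) =
  \sum_(w <- ws) \sum_i (p i w * ln (P i) + (Q w * r i w - p i w)).
  apply: eq_big_seq => w _; rewrite big_split /= sumrB -mulr_sumr r1 mulr1 -/(Q w).
  by rewrite subrr addr0.
rewrite !big_seq; apply: ler_sum => w wws; rewrite -big_split; apply: ler_sum => i _ /=.
have Q0 : 0 <= Q w by apply: sumr_ge0.
have := p0 i w; rewrite le_eqVlt => /orP[/eqP <-|pw].
  by rewrite !mul0r addr0 add0r subr0 mulr_ge0 // ltW.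
have pP : p i w <= P i.
  rewrite /P (big_rem w) //= lerDl; exact: sumr_ge0.
have pQ : p i w <= Q w.
  by rewrite /Q (bigD1 i) //= lerDl; exact: sumr_ge0.
have Pp : 0 < P i by apply: lt_le_trans pP.
have Qp : 0 < Q w by apply: lt_le_trans pQ.
have z0 : 0 < Q w * r i w / P i by rewrite divr_gt0 // mulr_gt0.
have := @le_ln1Dx R (Q w * r i w / P i - 1).
rewrite [1 + _](_ : _ = Q w * r i w / P i); last by ring.
rewrite (_ : -1 < _) => [/(_ isT)|]; last by lra.
rewrite ln_div ?posrE ?mulr_gt0 // lnM ?posrE // => h.
have h1 := ler_wpM2l (ltW pw) h.
have h2 : p i w * (Q w * r i w / P i) <= Q w * r i w.
  rewrite mulrCA ger_pMr ?mulr_gt0 //.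
  by rewrite ler_pdivrMr // mul1r.
lra.
Qed.

End finite_entropy.

Lemma measurable_forall_fin d (T : measurableType d) (I : finType) (E : I -> set T) :
  (forall i, measurable (E i)) -> measurable [set x | forall i, E i x].
Proof.
move=> mE; rewrite (_ : [set _ | _] = ~` \big[setU/set0]_(i <- index_enum I) ~` E i).
  by apply: measurableC; apply: bigsetU_measurable => i _; apply: measurableC.
rewrite -bigcup_seq setC_bigcup; apply/seteqP; split=> x h.
  by move=> i _; rewrite setCK; exact: h.
by move=> i; have := h i; rewrite setCK; apply; rewrite /= mem_index_enum.
Qed.

Section generator.
Variables (R : realType) (mu : probability fullshift R).
Hypothesis inv : shift_invariant mu.

Definition word_entropy (n : nat) : R := \sum_(w <- words n) eta (pword mu setT w).

(** A coding argument: each piece is guessed from [2 * r + 1] letters by a function [g] that errs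
    rarely. Given the word, a piece costs at most eps / 2, and at most [c2] more if the guess is
    wrong. *)
Lemma block_entropy_le k (xi : fullshift -> 'I_k) (eps : R) :
  (forall i, measurable (xi @^-1` [set i])) -> 0 < eps ->
  exists r, forall n, block_entropy mu shift_map xi n <= word_entropy (n + 2 * r) + eps *
    n%:R.
Proof.
move=> mxi e0.
have k0 : 0 < k%:R :> R by rewrite ltr0n; case: (xi point) => i; exact: leq_ltn_trans.
(* Chosen so that - ln (1 - d) = eps / 2. *)
pose d : R := 1 - expR (- (eps / 2)).
have d0 : 0 < d by rewrite subr_gt0 -expR0 ltr_expR oppr_lt0 divr_gt0.
have d1 : d < 1 by rewrite /d gtrBl expR_gt0.
have dk : 0 < d / k%:R by rewrite divr_gt0.
pose c2 := `|ln (d / k%:R)|.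
have c20 : 0 <= c2 by exact: normr_ge0.
(* An error rate at which the errors contribute at most eps / 2 per letter. *)
have e1 : 0 < eps / 2 / (c2 + 1) by rewrite !divr_gt0 //; lra.
have [r [g hg]] := approx_partition mu mxi e1.
exists r => n; pose m := (n + 2 * r)%N.
pose X x : {ffun 'I_n -> 'I_k} := [ffun i : 'I_n => xi (iter i shift_map x)].
pose Wn x := win x (- r%:Z) m.
pose part (j : nat) (w : seq letter) := take (2 * r).+1 (drop j w).
(* The guess, mixed with the uniform law to keep the cost of an error finite. *)
pose kap (a b : 'I_k) : R := (1 - d) * (a == b)%:R + d / k%:R.
pose q (i : {ffun 'I_n -> 'I_k}) (w : seq letter) : R := \prod_(j < n) kap (i j) (g (part
  j w)).
pose p (i : {ffun 'I_n -> 'I_k}) (w : seq letter) : R := pr mu ([set x | X x = i] `&`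
  [set x | Wn x = w]).
have kap0 a b : 0 < kap a b.
  by rewrite /kap ltr_wpDl // mulr_ge0 // subr_ge0 ltW.
have kap1 b : \sum_a kap a b = 1.
  rewrite /kap big_split /= sumr_const card_ord -mulr_sumr -[(d / _) *+ _]mulr_natr divfK
    ?gt_eqF //.
  rewrite (bigD1 b) //= eqxx big1 ?addr0; first by rewrite mulr1 subrK.
  by move=> a /negbTE ->.
have kapl a b : - ln (kap a b) <= eps / 2 + c2 * (a != b)%:R.
  have [->|ab] := eqVneq a b.
    rewrite mulr0 addr0 lerNl -[leLHS]expRK ler_ln ?posrE ?expR_gt0 //.
    by rewrite /kap eqxx mulr1 {1}/d; have := dk; lra.
  rewrite mulr1 /kap (negbTE ab) mulr0 add0r.
  have := ler_norm (- ln (d / k%:R)); rewrite normrN -/c2; lra.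
have mX i : measurable [set x | X x = i].
  rewrite (_ : [set _ | _] = [set x | forall j : 'I_n, (shiftz (j : nat)%:Z @^-1` (xi
    @^-1` [set i j])) x]).
    by apply: measurable_forall_fin => j;
      exact: measurable_preimage (measurable_shiftz _) (mxi _).
  apply/seteqP; split=> x; rewrite /preimage /mkset.
    by move=> <- j; rewrite /X ffunE iter_shift.
  by move=> h; apply/ffunP => j; rewrite /X ffunE iter_shift; exact: h.
have mWn w : measurable [set x | Wn x = w] by exact: (measurable_win (fun z => z = w)).
have wW x : Wn x \in words m by rewrite mem_words size_win.
have pP i : \sum_(w <- words m) p i w = pr mu [set x | X x = i].
  by rewrite (@pr_partition _ _ _ mu _ (words m) Wn) ?uniq_words.
have pQ w : w \in words m -> \sum_i p i w = pword mu setT w.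
  rewrite mem_words => /eqP wm.
  rewrite -[RHS](pr_cyl inv measurableT _ (- r%:Z)) // setIT wm.
  rewrite (@pr_partition _ _ _ mu _ (index_enum _) X) ?index_enum_uniq //.
  by apply: eq_bigr => i _; rewrite /p setIC.
have E1 : block_entropy mu shift_map xi n = \sum_i eta (\sum_(w <- words m) p i w).
  rewrite /block_entropy -sumrN; apply: eq_bigr => i _; rewrite pP /eta /pr.
  suff -> : refinement_cell shift_map xi i = [set x | X x = i] by [].
  apply/seteqP; split=> x; rewrite /refinement_cell /mkset.
    by move=> h; apply/ffunP => j; rewrite ffunE.
  by move=> <- j; rewrite ffunE.
rewrite E1; apply: le_trans (entropy_le_cond (words m) _ (r := q) _ _) _.
- by move=> i w; exact: pr_ge0.
- by move=> i w; apply: prodr_gt0 => j _.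
- move=> w; rewrite /q -(bigA_distr_bigA (fun (j : 'I_n) a => kap a (g (part j w)))) /=.
  by apply: big1 => j _; exact: kap1.
have -> : \sum_(w <- words m) eta (\sum_i p i w) = word_entropy m.
  by apply: eq_big_seq => w /pQ ->.
rewrite lerD2l.
have total : \sum_(w <- words m) \sum_i p i w = 1.
  rewrite -(prT mu) (@pr_partition _ _ _ mu _ (words m) Wn) ?uniq_words //.
  apply: eq_bigr => w _; rewrite setTI.
  rewrite (@pr_partition _ _ _ mu _ (index_enum _) X) ?index_enum_uniq //.
  by apply: eq_bigr => i _; rewrite /p setIC.
have mis (j : 'I_n) : \sum_(w <- words m) \sum_i p i w * (i j != g (part j w))%:R <= eps
  / 2 / (c2 + 1).
  pose B := [set x | X x j != g (part j (Wn x))].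
  have BE : B = shiftz (j : nat)%:Z @^-1` [set x | xi x != g (wide r x)].
    apply/seteqP; split=> x;
      rewrite /B /preimage /mkset /X ffunE iter_shift /wide win_shift /part /Wn;
    rewrite drop_win ?take_win; try (by have := ltn_ord j; rewrite /m; lia);
    by rewrite (_ : - r%:Z + (j : nat)%:Z = - r%:Z + (j : nat)%:Z).
  have mxw : measurable [set x | xi x != g (wide r x)].
    rewrite (_ : [set _ | _] = \big[setU/set0]_(i <- index_enum 'I_k) (xi @^-1` [set i]
      `&` [set x | i != g (wide r x)])).
      apply: bigsetU_measurable => i _; apply: measurableI => //.
      exact: (measurable_win (fun w => i != g w) (- r%:Z) (2 * r).+1).
    rewrite -bigcup_seq; apply/seteqP; split=> x /=.
      by move=> h; exists (xi x); rewrite /= ?mem_index_enum.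
    by case=> i _ [<-].
  have mB' : measurable B by rewrite BE;
    exact: measurable_preimage (measurable_shiftz _) mxw.
  have : pr mu B <= eps / 2 / (c2 + 1) by rewrite BE {1}/pr (mu_shiftz inv).
  apply: le_trans.
  rewrite le_eqVlt; apply/orP; left; apply/eqP.
  rewrite (@pr_partition _ _ _ mu _ (words m) Wn B) ?uniq_words //.
  apply: eq_bigr => w _.
  rewrite (@pr_partition _ _ _ mu _ (index_enum {ffun 'I_n -> 'I_k}) X) ?index_enum_uniq
    //.
  - apply: eq_bigr => i _; rewrite /p.
    case H : (i j != g (part j w)); rewrite ?mulr1 ?mulr0.
      congr pr; apply/seteqP; split=> x; rewrite /B /setI /mkset; last by case=> -[].
      by case=> h1 h2; split=> //; split=> //; rewrite h1 h2.
    rewrite (_ : _ `&` _ = set0) ?pr0 //; apply/seteqP; split=> x //.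
    by rewrite /B /setI /mkset => -[[h1 h2] h3]; rewrite h3 h2 H in h1.
  - exact: measurableI.
apply: le_trans (_ : \sum_(j < n) (eps / 2 * (\sum_(w <- words m) \sum_i p i w) +
    c2 * \sum_(w <- words m) \sum_i p i w * (i j != g (part j w))%:R) <= _).
  rewrite -sumrN.
  have -> : \sum_(j < n) (eps / 2 * (\sum_(w <- words m) \sum_i p i w) +
    c2 * \sum_(w <- words m) \sum_i p i w * (i j != g (part j w))%:R) =
    \sum_(w <- words m) \sum_i \sum_(j < n) p i w * (eps / 2 + c2 * (i j != g (part j
      w))%:R).
    transitivity (\sum_(j < n) \sum_(w <- words m) \sum_i p i w * (eps / 2 + c2 * (i j !=
      g (part j w))%:R)).
      apply: eq_bigr => j _; rewrite !mulr_sumr -big_split; apply: eq_bigr => w _ /=.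
      rewrite !mulr_sumr -big_split; apply: eq_bigr => i _ /=; ring.
    rewrite exchange_big; apply: eq_bigr => w _; exact: exchange_big.
  apply: ler_sum => w _; rewrite -sumrN; apply: ler_sum => i _.
  rewrite -mulr_sumr -mulrN; apply: ler_wpM2l; first exact: pr_ge0.
  have -> : - ln (q i w) = \sum_(j < n) - ln (kap (i j) (g (part j w))).
    rewrite sumrN /q; congr (- _).
    pose P (x y : R) := 0 < x /\ ln x = y.
    suff [] : P (\prod_(j < n) kap (i j) (g (part j w))) (\sum_(j < n) ln (kap (i j) (g
      (part j w)))) by [].
    apply: (big_ind2 P) => [|x1 x2 y1 y2 [x0 <-] [y0 <-]|j _] //.
    - by rewrite /P ln1.
    - by split; [exact: mulr_gt0 | rewrite lnM ?posrE].
  by apply: ler_sum => j _; exact: kapl.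
rewrite total mulr1; apply: le_trans (_ : \sum_(j < n) eps <= _);
  last by rewrite sumr_const card_ord mulr_natr.
apply: ler_sum => j _; have := ler_wpM2l c20 (mis j).
have c21 : 0 < c2 + 1 by lra.
have : c2 * (eps / 2 / (c2 + 1)) <= eps / 2.
  by rewrite mulrCA ger_pMr ?divr_gt0 // ler_pdivrMr //; lra.
lra.
Qed.

Lemma word_entropy_ge0 n : 0 <= word_entropy n.
Proof.
apply: sumr_ge0 => w _; rewrite /eta -mulrN mulr_ge0 ?pr_ge0 // oppr_ge0 ln_le0 //.
apply: pr_le1; rewrite setIT; exact: (measurable_win (fun z => z = w)).
Qed.

(** A partition of nearly maximal entropy is compared with words by [block_entropy_le]. The four
    quarters of [eps] pay for the supremum, the comparison, the limit and the [2 * r] extra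
    letters. *)
Lemma word_entropy_lower (h eps : R) :
  kolmogorov_entropy mu shift_map = h%:E -> 0 < eps ->
  exists n0, forall n, (n0 <= n)%N -> (h - eps) * n%:R <= word_entropy n.
Proof.
move=> hE e0; have e4 : 0 < eps / 4 by rewrite divr_gt0.
have : (((h - eps / 4)%:E) < kolmogorov_entropy mu shift_map)%E.
  by rewrite hE lte_fin; lra.
rewrite /kolmogorov_entropy => /ereal_sup_gt [_ [k [xi [mxi ->]]]]; rewrite lte_fin => hx.
(* If the defining limit does not exist, [partition_entropy] is the junk value 0
   and the bound is trivial, so no subadditivity argument is needed. *)
have [cv|ncv] := pselect (cvgn (fun n : nat => n%:R^-1 * block_entropy mu shift_map xi
  n)); last first.
  have pe0 : partition_entropy mu shift_map xi = 0.
    rewrite /partition_entropy /lim /lim_in /= xgetPN //.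
    by move=> l hl; apply: ncv; apply/cvg_ex; exists l.
  exists 0%N => n _; apply: le_trans (word_entropy_ge0 n).
  by rewrite pe0 in hx; rewrite mulr_le0_ge0 //; lra.
have [r hr] := block_entropy_le mxi e4.
move/cvgrPdist_le : cv => /(_ _ e4) [n1 _ h1].
have [n2 h2] := large_nat ((h - eps) * (2 * r)%:R) e4.
exists (n1 + n2 + 1 + 2 * r)%N => n hn.
pose m := (n - 2 * r)%N; have En : n = (m + 2 * r)%N by rewrite /m; lia.
have m0 : 0 < m%:R :> R by rewrite ltr0n /m; lia.
have m1 : (n1 <= m)%N by rewrite /m; lia.
have m2 : (n2 <= m)%N by rewrite /m; lia.
have := h1 m m1; rewrite /= ler_norml => /andP[_].
rewrite -/(partition_entropy mu shift_map xi) => h3.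
have h4 := hr m; have h5 := h2 m m2.
have h6 : (h - eps / 2) * m%:R <= block_entropy mu shift_map xi m.
  have h7 : h - eps / 2 <= m%:R^-1 * block_entropy mu shift_map xi m by lra.
  by have := ler_wpM2r (ltW m0) h7; rewrite mulrAC mulVf ?gt_eqF // mul1r.
rewrite {1}En; rewrite -En in h4; rewrite natrD mulrDr; lra.
Qed.

End generator.

(** * Equilibrium measures *)

Section squeeze.
Variable R : realType.
Variables (J1 J2 J3 : nat -> R) (c1 c2 c3 L : R).
Hypotheses (u1 : sublinear (fun n => J1 n - n%:R * c1))
           (u2 : sublinear (fun n => J2 n - n%:R * c2))
           (u3 : sublinear (fun n => J3 n - n%:R * c3))
           (lo : sublinear (fun n => n%:R * L - (J1 n + J2 n + J3 n))).

Lemma squeeze_le : L <= c1 + c2 + c3.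
Proof.
apply/ler_addgt0Pl => e e0; have e4 : 0 < e / 4 by rewrite divr_gt0.
have [n1 h1] := u1 e4; have [n2 h2] := u2 e4; have [n3 h3] := u3 e4;
  have [n4 h4] := lo e4.
pose n := (n1 + n2 + n3 + n4).+1.
have n0 : 0 < n%:R :> R by rewrite ltr0n.
have {}h1 := h1 n ltac:(rewrite /n; lia); have {}h2 := h2 n ltac:(rewrite /n; lia).
have {}h3 := h3 n ltac:(rewrite /n; lia); have {}h4 := h4 n ltac:(rewrite /n; lia).
rewrite -(ler_pM2l n0); lra.
Qed.

(** If the three upper rates add up to at most the rate reached by the sum, each of them is attained
    up to o(n). *)
Lemma squeeze_sublinear : c1 + c2 + c3 <= L -> sublinear (fun n => n%:R * c1 - J1 n).
Proof.
move=> cL e e0; have e4 : 0 < e / 4 by rewrite divr_gt0.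
have [n2 h2] := u2 e4; have [n3 h3] := u3 e4; have [n4 h4] := lo e4.
exists (n2 + n3 + n4)%N => n hn.
have {}h2 := h2 n ltac:(lia); have {}h3 := h3 n ltac:(lia); have {}h4 := h4 n ltac:(lia).
have := ler_wpM2l (ler0n R n) cL; have := mulr_ge0 (ltW e4) (ler0n R n); lra.
Qed.

End squeeze.

Section mean_weight.
Variables (R : realType) (F : letter -> R) (p : seq letter -> R).
Hypothesis dp : word_dist p.

Lemma sum_dist_catr n w : \sum_(r <- words n) p (w ++ r) = p w.
Proof.
have := sum_dist_cat n (bar w) (word_dist_bar dp); rewrite /= barK => <-.
rewrite -big_words_bar; apply: eq_bigr => r _ /=.
by rewrite bar_cat barK.
Qed.

Lemma mean_wt n : \sum_(w <- words n) p w * wt F w = n%:R * \sum_(l : letter) F l * p [::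
  l].
Proof.
have [_ h2 _ _] := dp.
elim: n => [|n IH]; first by rewrite big_words0 /wt big_nil mulr0 mul0r.
rewrite big_wordsS -[n.+1]addn1 natrD mulrDl mul1r -IH addrC.
transitivity (\sum_(l : letter) (F l * p [:: l] + \sum_(w <- words n) p (l :: w) * wt F
  w)).
  apply: eq_bigr => l _; rewrite -(sum_dist_catr n [:: l]) mulr_sumr -big_split /=.
  by apply: eq_bigr => w _; rewrite wt_cons mulrDr mulrC.
rewrite big_split /=; congr (_ + _); rewrite exchange_big /=.
by apply: eq_bigr => w _; rewrite -mulr_suml h2.
Qed.

End mean_weight.

Section equilibrium.
Variables (R : realType) (f : fullshift -> R) (F : letter -> R).
Hypothesis fF : forall x, dyck x -> f x = F (x 0).
Variable mu : probability fullshift R.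
Hypothesis eq : equilibrium_measure f mu.

Lemma equilibrium_invariant : shift_invariant mu. Proof. by case: eq. Qed.

Lemma equilibrium_dyck : mu dyck = 1%E. Proof. by case: eq. Qed.

Let inv := equilibrium_invariant.
Let pD := pword mu dyck.
Let p1 := pword mu ups.
Let p2 := pword mu downs.
Let p3 := pword mu matched.
Let L := ln (lamF F).

Lemma pr_dyckI E : measurable E -> pr mu (E `&` dyck) = pr mu E.
Proof.
move=> mE; have md := measurable_dyck.
have mC : measurable (E `\` dyck) by exact: measurableD.
have nC : pr mu (E `\` dyck) = 0.
  have : pr mu (dyck `|` (E `\` dyck)) <= 1 by apply: pr_le1; exact: measurableU.
  rewrite prU //; last by apply/seteqP; split=> x // [h [_]].
  by rewrite {1}/pr equilibrium_dyck /=; have := pr_ge0 mu (E `\` dyck); lra.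
rewrite -[RHS](_ : pr mu (E `&` dyck `|` E `\` dyck) = _).
  rewrite prU ?nC ?addr0 //; first exact: measurableI.
  by apply/seteqP; split=> x // [[_ h] [_]].
congr pr; apply/seteqP; split=> x; first by case=> -[].
by move=> Ex; have [d|d] := pselect (dyck x); [left|right].
Qed.

Lemma matched_shift k x : matched (shiftz k x) <-> matched x.
Proof.
split=> -[d h]; split; try by apply/(dyck_shift k).
- move=> i; have := h (i - k); rewrite free_opening_shift free_closing_shift subrK //.
- by move=> i; rewrite free_opening_shift free_closing_shift.
Qed.

Lemma matched_rho x : matched (rho x) <-> matched x.
Proof.
split=> -[d h]; split; try by apply/dyck_rho.
- move=> i; have := h (- i); rewrite free_opening_rho free_closing_rho opprK; tauto.
- move=> i; have := h (- i); rewrite free_opening_rho free_closing_rho; tauto.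
Qed.

Lemma word_dist_dyck : word_dist pD.
Proof.
apply: word_dist_pword => //; first exact: measurable_dyck.
by move=> k x; exact: dyck_shift.
Qed.

Lemma word_dist_matched (nu : probability fullshift R) :
  shift_invariant nu -> word_dist (pword nu matched).
Proof.
move=> hnu; apply: word_dist_pword => //; first exact: measurable_matched.
- by move=> k x; exact: matched_shift.
- by move=> x [].
Qed.

Lemma pword_split w : pD w = p1 w + p2 w + p3 w.
Proof.
have mw : measurable [set x | win x 1 (size w) = w] by exact: (measurable_win (fun z => z
  = w)).
have mE : measurable ([set x | win x 1 (size w) = w] `&` dyck) by apply: measurableI =>
  //; exact: measurable_dyck.
rewrite /pD {1}/pword (pr_decomposition inv mE (@subIsetr _ _ _)).
rewrite /p1 /p2 /p3 /pword; congr (_ + _ + _); congr pr; apply/seteqP; split=> x;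
  try by move=> [[h1 h2] h3].
- by move=> [h1 h2]; split=> //; split=> //; case: h2.
- by move=> [h1 h2]; split=> //; split=> //; apply/dyck_rho; case: h2.
- by move=> [h1 h2]; split=> //; split=> //; case: h2.
Qed.

Let I := \sum_(l : letter) F l * pD [:: l].

Lemma integral_site : (\int[mu]_(x in dyck) (f x)%:E = I%:E)%E.
Proof.
have -> : (\int[mu]_(x in dyck) (f x)%:E = \int[mu]_(x in dyck) (F (x 0))%:E)%E.
  by apply: eq_integral => x /set_mem dx; rewrite fF.
pose S (l : letter) := dyck `&` [set x : fullshift | x 0 = l].
have mS l : measurable (S l) by apply: measurableI;
  [exact: measurable_dyck | exact: measurable_letter].
have DE : dyck = \big[setU/set0]_(l <- index_enum letter) S l.
  rewrite -bigcup_seq; apply/seteqP; split=> x; last by case=> l _ [].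
  by move=> dx; exists (x 0); rewrite /= ?mem_index_enum.
rewrite {1}DE integral_bigsetU_EFin ?index_enum_uniq //.
- rewrite /I -sumEFin; apply: eq_bigr => l _.
  rewrite (eq_integral (cst (F l)%:E)); last by move=> x /set_mem[_ <-].
  rewrite integral_cst // EFinM; congr (_ * _)%E.
  rewrite /pD -(pr_cyl inv measurable_dyck (fun k x => @dyck_shift k x) 0) -prE.
    by congr (mu _); rewrite setIC; congr (_ `&` _); apply/seteqP; split=> x;
      rewrite /mkset /win /mkseq /= addr0; [move=> -> | case].
  by apply: measurableI;
    [exact: (measurable_win (fun z => z = [:: l])) | exact: measurable_dyck].
- by move=> l l' _ _ [x [[_ h1] [_ h2]]]; rewrite -h1 -h2.
  apply: (measurable_funS measurableT) => //.
  apply/measurable_EFinP => _ Y mY; rewrite setTI.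
  apply: measurable_window; exact: (window_event_letter (fun l => Y (F l))).
Qed.

Lemma equilibrium_entropy : kolmogorov_entropy mu shift_map = (L - I)%:E.
Proof.
have [_ _] := eq; rewrite /measure_pressure integral_site (pressureE fF) -/L.
by case: (kolmogorov_entropy _ _) => [k| |] //= [<-]; rewrite addrK.
Qed.

(** The entropy of [mu] is at most the sum over the three parts by [eta_subadditive], while the
    energies add up exactly. *)
Lemma Jfun_lower :
  sublinear (fun n => n%:R * L - (Jfun F p1 n + Jfun F p2 n + Jfun F p3 n)).
Proof.
move=> e e0; have [n0 h] := word_entropy_lower inv equilibrium_entropy e0.
exists n0 => n /h {}h.
suff : word_entropy mu n + n%:R * I <= Jfun F p1 n + Jfun F p2 n + Jfun F p3 n by lra.
rewrite /I -(mean_wt F word_dist_dyck) /word_entropy /Jfun -!big_split /=.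
apply: ler_sum => w _.
have -> : pword mu setT w = pD w.
  by rewrite /pD /pword setIT pr_dyckI //; exact: (measurable_win (fun z => z = w)).
rewrite pword_split.
have q1 : 0 <= p1 w by exact: pr_ge0.
have q2 : 0 <= p2 w by exact: pr_ge0.
have q3 : 0 <= p3 w by exact: pr_ge0.
have := eta_subadditive (addr_ge0 q1 q2) q3; have := eta_subadditive q1 q2; lra.
Qed.

Let F' := F \o inv_letter.
Let p2' := pword (mu_rho mu) ups.

Lemma mean_npend_ups (nu : probability fullshift R) : shift_invariant nu ->
  sublinear (mean_npend (pword nu ups)).
Proof.
move=> hnu; apply: sublinear_mean_npend; first exact: word_dist_ups.
apply: (defect_pword_small hnu measurable_ups ups_shift) => x ux.
exact: ups_no_closing.
Qed.

Lemma mean_npend_matched (nu : probability fullshift R) : shift_invariant nu ->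
  sublinear (mean_npend (pword nu matched)).
Proof.
move=> hnu; apply: sublinear_mean_npend; first exact: word_dist_matched.
apply: (defect_pword_small hnu measurable_matched matched_shift) => x [_ h].
by case: (h 0).
Qed.

Lemma matched_bar : p3 \o bar = pword (mu_rho mu) matched.
Proof.
apply/funext => w /=; rewrite -[in RHS](barK w).
rewrite (pword_rho_bar inv _ measurable_matched matched_shift) /p3.
congr (pword mu _ _); apply/seteqP; split=> x;
  rewrite /preimage /mkset => /matched_rho //.
Qed.

Lemma Jfun_p2 n : Jfun F' p2' n = Jfun F p2 n.
Proof. exact: (@Jfun_rho R F mu inv ups n measurable_ups ups_shift). Qed.

Let m1 := pr mu ups.
Let m2 := pr mu downs.
Let m3 := pr mu matched.
Let l3 := ln (2 * Num.sqrt (wpair F)).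

Lemma p1_nil : p1 [::] = m1. Proof. exact: pword_nil. Qed.
Lemma p2'_nil : p2' [::] = m2. Proof. exact: pword_nil. Qed.
Lemma p3_nil : p3 [::] = m3. Proof. exact: pword_nil. Qed.

Lemma total_mass : m1 + m2 + m3 = 1.
Proof.
have := pr_decomposition inv measurable_dyck (@subset_refl _ _).
rewrite {1}/pr equilibrium_dyck /= => ->; congr (_ + _ + _); congr pr; apply/seteqP;
  split=> x; try by case.
by move=> h; split=> //; apply/dyck_rho; case: h.
Qed.

Lemma Jfun_ups_upper : sublinear (fun n => Jfun F p1 n - n%:R * (m1 * ln (lamo F))).
Proof.
rewrite -p1_nil; apply: (Jfun_upper (wopen_gt0 F));
  [exact: word_dist_ups | exact: mean_npend_ups | by left].
Qed.

Lemma Jfun_downs_upper : sublinear (fun n => Jfun F p2 n - n%:R * (m2 * ln (lamo F'))).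
Proof.
rewrite -p2'_nil; under [fun n => _]funext => n do rewrite -Jfun_p2.
apply: (Jfun_upper (wopen_gt0 F')); last by left.
- exact: word_dist_ups (inv_rho inv).
- exact: mean_npend_ups (inv_rho inv).
Qed.

Lemma Jfun_matched_upper : sublinear (fun n => Jfun F p3 n - n%:R * (m3 * l3)).
Proof.
have s0 : 0 < Num.sqrt (wpair F) by rewrite sqrtr_gt0 wpair_gt0.
rewrite -p3_nil.
have -> : l3 = ln (lam F (Num.sqrt (wpair F))).
  rewrite /l3 /lam; congr ln.
  have Es : wpair F = Num.sqrt (wpair F) ^+ 2 by rewrite sqr_sqrtr // ltW // wpair_gt0.
  by rewrite [X in _ + X / _]Es; field; rewrite gt_eqF.
apply: (Jfun_upper s0); [exact: word_dist_matched | exact: mean_npend_matched |].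
by right; rewrite matched_bar; exact: mean_npend_matched (inv_rho inv).
Qed.

Lemma rate_bounds : [/\ ln (lamo F) <= L, ln (lamo F') <= L & l3 < L].
Proof.
have l1 := lamo_gt0 F; have l2 := lamo_gt0 F'; have l := lamF_gt0 F.
have g := lam_gap F; have s0 : 0 < Num.sqrt (wpair F) by rewrite sqrtr_gt0 wpair_gt0.
split; rewrite /L /l3 ?ler_ln ?ltr_ln ?posrE //; rewrite /lamF ?le_max ?lexx ?orbT //.
by rewrite mulr_gt0.
Qed.

(** The rates weighted by the masses must reach [L]; the masses add up to 1 and the rate of the
    third part is strictly below [L]. *)
Lemma matched_null : pr mu matched = 0.
Proof.
have [h1 h2 h3] := rate_bounds;
  have := squeeze_le Jfun_ups_upper Jfun_downs_upper Jfun_matched_upper Jfun_lower.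
have k1 := ler_wpM2l (pr_ge0 mu ups) h1; have k2 := ler_wpM2l (pr_ge0 mu downs) h2.
have := total_mass; rewrite -/m1 -/m2 in k1 k2 *; have := pr_ge0 mu matched; rewrite -/m3.
rewrite le_eqVlt => /orP[/eqP <- //|m30].
have := ltr_pM2l m30 l3 L; rewrite h3 => k3 m H.
have : (m1 + m2 + m3) * L = L by rewrite m mul1r.
lra.
Qed.

(** [Jfun_le] bounds [Jfun + Kfun] by the rate of this part, and the squeeze keeps [Jfun] from
    falling short of it by more than o(n). *)
Lemma Kfun_ups : sublinear (Kfun F (wopen F) p1).
Proof.
have [h1 h2 h3] := rate_bounds; have M := total_mass.
have k1 := ler_wpM2l (pr_ge0 mu ups) h1; have k2 := ler_wpM2l (pr_ge0 mu downs) h2.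
have m30 : m3 = 0 by exact: matched_null.
have lo := squeeze_sublinear Jfun_downs_upper Jfun_matched_upper Jfun_lower (c1 := m1 *
  ln (lamo F)).
have cL : m1 * ln (lamo F) + m2 * ln (lamo F') + m3 * l3 <= L.
  have : (m1 + m2 + m3) * L = L by rewrite M mul1r.
  rewrite m30 mul0r addr0 -/m1 -/m2 in k1 k2 *; lra.
have up := Jfun_le (F := F) (t := wopen F) (word_dist_ups inv) (mean_npend_ups inv)
  (or_introl erefl).
rewrite -/p1 p1_nil in up; have S := sublinearD up (lo cL).
move=> e /S[n0 h]; exists n0 => n /h; rewrite -/p1 /lamo; lra.
Qed.

Lemma Kfun_downs : sublinear (Kfun F' (wopen F') p2').
Proof.
have [h1 h2 h3] := rate_bounds; have M := total_mass.
have k1 := ler_wpM2l (pr_ge0 mu ups) h1; have k2 := ler_wpM2l (pr_ge0 mu downs) h2.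
have m30 : m3 = 0 by exact: matched_null.
have lo' : sublinear (fun n => n%:R * L - (Jfun F p2 n + Jfun F p1 n + Jfun F p3 n)).
  by move=> e /Jfun_lower[n0 h]; exists n0 => n /h; lra.
have lo := squeeze_sublinear Jfun_ups_upper Jfun_matched_upper lo' (c1 := m2 * ln (lamo
  F')).
have cL : m2 * ln (lamo F') + m1 * ln (lamo F) + m3 * l3 <= L.
  have : (m1 + m2 + m3) * L = L by rewrite M mul1r.
  rewrite m30 mul0r addr0 -/m1 -/m2 in k1 k2 *; lra.
have ir := inv_rho inv.
have up := Jfun_le (F := F') (t := wopen F') (word_dist_ups ir) (mean_npend_ups ir)
  (or_introl erefl).
rewrite -/p2' p2'_nil in up; have S := sublinearD up (lo cL).
move=> e /S[n0 h]; exists n0 => n /h; rewrite Jfun_p2 /lamo; lra.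
Qed.

(** The part on [downs] is [exchange_ups] for the reflected measure and the words [bar u], [bar v];
    the reflected window starts at [1 - a - (size v)%:Z]. The matched part is null. *)
Lemma equilibrium_exchange (a : int) u v B : size u = size v -> measurable B -> B `<=`
  dyck ->
  pr mu [set y | [/\ dyck y, win y a (size v) = v & B (subst a u y)]] =
  expR (wt F v - wt F u) *
  pr mu [set x | [/\ B x, win x a (size u) = u & dyck (subst a v x)]].
Proof.
move=> uv mB Bd; set Y := [set y | _]; set X := [set x | _].
have md := measurable_dyck.
have mY : measurable Y.
  rewrite (_ : Y = dyck `&` ([set y | win y a (size v) = v] `&` subst a u @^-1` B)).
    apply: measurableI => //; apply: measurableI;
      first exact: (measurable_win (fun z => z = v)).
    exact: measurable_preimage (measurable_subst a u) mB.
  by apply/seteqP; split=> x; rewrite /Y /setI /mkset; [case | case=> h1 [h2 h3]].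
have mX : measurable X.
  rewrite (_ : X = B `&` ([set x | win x a (size u) = u] `&` subst a v @^-1` dyck)).
    apply: measurableI => //; apply: measurableI;
      first exact: (measurable_win (fun z => z = u)).
    exact: measurable_preimage (measurable_subst a v) md.
  by apply/seteqP; split=> x; rewrite /X /setI /mkset; [case | case=> h1 [h2 h3]].
have null E : measurable E -> pr mu (E `&` matched) = 0.
  move=> mE; apply/eqP; rewrite eq_le pr_ge0 andbT -matched_null.
  by apply: pr_le => //; [apply: measurableI => // | ];
    exact: measurable_matched || move=> x [].
rewrite (pr_decomposition inv mY) ?(pr_decomposition inv mX) ?null ?addr0 //;
  last 2 first.
- by move=> x [/Bd].
- by move=> x [].
rewrite mulrDr; congr (_ + _).
  rewrite -(exchange_ups a inv Kfun_ups uv mB Bd); congr pr; apply/seteqP; split=> y.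
    by move=> [[h1 h2 h3] h4].
  by move=> [[h1 h2] h3]; split=> //; split=> //; case: h3.
have mB' : measurable (rho @^-1` B) by exact: measurable_preimage measurable_rho mB.
have Bd' : rho @^-1` B `<=` dyck by move=> x /Bd /dyck_rho.
have uv' : size (bar u) = size (bar v) by rewrite !size_bar.
have := exchange_ups (1 - a - (size v)%:Z) (inv_rho inv) Kfun_downs uv' mB' Bd'.
rewrite !wt_bar !pr_rho => H; apply: etrans (etrans _ H) _.
- congr pr; apply/seteqP; split=> y; rewrite /Y /setI /preimage /mkset size_bar win_rho;
  rewrite -uv subst_rho rhoK (_ : 1 - (1 - a - (size u)%:Z) - (size u)%:Z = a);
    try by lia.
    by move=> [[h1 h2 h3] h4]; rewrite h2.
  move=> [[/(congr1 bar) h1 h2] h3]; rewrite !barK in h1; split=> //; split=> //.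
  by apply/dyck_rho; case: h3.
- congr (_ * _); congr pr; apply/seteqP; split=> x;
  rewrite /X /setI /preimage /mkset size_bar win_rho rhoK;
  rewrite subst_rho -uv (_ : 1 - (1 - a - (size u)%:Z) - (size u)%:Z = a); try by lia.
    move=> [[h1 /(congr1 bar) h2 h3] h4]; rewrite !barK in h2; split=> //; split=> //.
    exact/dyck_rho.
  by move=> [[h1 h2 h3] h4]; rewrite h2; split=> //; split=> //; apply/dyck_rho.
Qed.

End equilibrium.

(** * Gibbs measures *)

Lemma gibbs_relationP x y : gibbs_relation x y -> exists N : nat,
  y = subst (- N%:Z) (wide N y) x.
Proof.
move=> [_ _ /finite_seqP[s Es]].
exists (\max_(k <- s) `|k|%N); set N := \max_(k <- s) _.
apply/funext => k; rewrite /subst size_win; case: ifP => h.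
  by rewrite nth_win; [congr y; lia | lia].
apply: contrapT => /nesym xy; have ks : k \in s.
  have : [set n | x n <> y n] k by [].
  by rewrite Es.
have kN : (`|k| <= N)%N by rewrite /N (big_rem k) //= leq_maxl.
by move/negP: h; apply; lia.
Qed.

Section gibbs.
Variables (R : realType) (f : fullshift -> R) (F : letter -> R).
Hypothesis fF : forall x, dyck x -> f x = F (x 0).

Lemma gibbs_cocycle_subst (a : int) v x : dyck x -> dyck (subst a v x) ->
  gibbs_cocycle f x (subst a v x) = wt F v - wt F (win x a (size v)).
Proof.
move=> dx dy; set y := subst a v x.
have E n : f (shiftz n y) - f (shiftz n x) = F (y n) - F (x n).
  by rewrite !fF ?dyck_shift // /shiftz !add0r.
pose r := [seq a + i%:Z | i <- iota 0 (size v)].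
have ur : uniq r by rewrite map_inj_uniq ?iota_uniq // => i j /addrI [].
rewrite /gibbs_cocycle (fsbigE r) //; last first.
  move=> n _ nr; rewrite E /y subst_out ?subrr //.
  apply: contrapT => h; move/negP: nr; apply; apply/mapP; exists `|(n - a)%R|%N;
    last by lia.
  by rewrite mem_iota; lia.
rewrite (eq_bigl xpredT); last by move=> n; rewrite in_setT.
rewrite (eq_bigr _ (fun n _ => E n)) sumrB; congr (_ - _);
  last by rewrite /wt /win /mkseq !big_map.
by rewrite -[in RHS](win_subst a v x) -/y /wt /win /mkseq !big_map.
Qed.

Variable mu : probability fullshift R.
Hypothesis eq : equilibrium_measure f mu.

(** An enumeration of the elementary moves, replacing [src m] by [tgt m] at position [pos m]. Any
    Gibbs pair is related by one of them, so the relation is a countable union of moves. Numbers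
    that encode nothing give the empty move. *)
Let step (m : nat) : nat * (seq letter * seq letter) :=
  odflt (0%N, ([::], [::])) (unpickle m).

Let len m := (step m).1.
Let pos m : int := - (len m)%:Z.
Let src m : seq letter := (step m).2.1.
Let tgt m : seq letter := (step m).2.2.

Let stepP N u v : exists m, [/\ len m = N, src m = u & tgt m = v].
Proof.
by exists (pickle (N, (u, v))); rewrite /len /src /tgt /step pickleK.
Qed.

Lemma mu_exchange (a : int) u v B : size u = size v -> measurable B -> B `<=` dyck ->
  mu [set y | [/\ dyck y, win y a (size v) = v & B (subst a u y)]] =
  ((expR (wt F v - wt F u))%:E *
  mu [set x | [/\ B x, win x a (size u) = u & dyck (subst a v x)]])%E.
Proof.
move=> uv mB Bd; have md := measurable_dyck.
rewrite !prE ?(equilibrium_exchange fF eq a uv mB Bd) ?EFinM //.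
  rewrite (_ : [set _ | _] = B `&` ([set x | win x a (size u) = u] `&` subst a v @^-1`
    dyck)).
    apply: measurableI => //; apply: measurableI;
      first exact: (measurable_win (fun z => z = u)).
    exact: measurable_preimage (measurable_subst a v) md.
  by apply/seteqP; split=> x; rewrite /setI /mkset; [case | case=> h1 [h2 h3]].
rewrite (_ : [set _ | _] = dyck `&` ([set y | win y a (size v) = v] `&` subst a u @^-1`
  B)).
  apply: measurableI => //; apply: measurableI;
    first exact: (measurable_win (fun z => z = v)).
  exact: measurable_preimage (measurable_subst a u) mB.
by apply/seteqP; split=> x; rewrite /setI /mkset; [case | case=> h1 [h2 h3]].
Qed.

(** Countably many moves cover the relation, and by [mu_exchange] each carries [E] to a null set. *)
Lemma saturation_null E : measurable E -> E `<=` dyck -> mu E = 0%E ->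
  mu.-negligible (saturation E).
Proof.
move=> mE Ed E0.
pose Y m := [set y | [/\ dyck y, win y (pos m) (size (tgt m)) = tgt m & E (subst (pos m)
  (src m) y)]].
pose Z m := if size (src m) == size (tgt m) then Y m else set0.
have nZ m : mu.-negligible (Z m).
  rewrite /Z; case: eqP => uv; last exact: negligible_set0.
  exists (Y m); split=> //.
    rewrite (_ : Y m = dyck `&` ([set y | win y (pos m) (size (tgt m)) = tgt m] `&` subst
      (pos m) (src m) @^-1` E)).
      apply: measurableI; first exact: measurable_dyck.
      apply: measurableI; first exact: (measurable_win (fun z => z = tgt m)).
      exact: measurable_preimage (measurable_subst _ _) mE.
    by apply/seteqP; split=> x; rewrite /setI /mkset; [case | case=> h1 [h2 h3]].
  rewrite /Y (mu_exchange _ uv mE Ed) (_ : mu _ = 0)%E ?mule0 //.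
  apply/eqP; rewrite -measure_le0 -E0 le_measure ?inE //; last by move=> x [].
  rewrite (_ : [set _ | _] = E `&` ([set x | win x (pos m) (size (src m)) = src m] `&`
    subst (pos m) (tgt m) @^-1` dyck)).
    apply: measurableI => //; apply: measurableI;
      first exact: (measurable_win (fun z => z = src m)).
    exact: measurable_preimage (measurable_subst _ _) measurable_dyck.
  by apply/seteqP; split=> x; rewrite /setI /mkset; [case | case=> h1 [h2 h3]].
apply: negligibleS (negligible_bigcup nZ) => y [x Ex xy].
have [N yE] := gibbs_relationP xy; have [dx dy _] := xy.
have [m [mN mu_ mv]] := stepP N (wide N x) (wide N y).
exists m => //; rewrite /Z /Y /pos mN mu_ mv !size_win eqxx.
split=> //; rewrite yE subst_subst ?size_win //.
by rewrite /wide subst_win.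
Qed.

(** On [Pc m] the holonomy is one fixed move and the density is the constant [D m], so [mu_exchange]
    is the claim there. The pieces cover [A] and are made disjoint by [seqDU]; both sides are
    countably additive. *)
Lemma holonomy_rn A B g : holonomy A B g ->
  exists2 rho : fullshift -> \bar R,
    radon_nikodym_on mu A (fun E => mu (g @` E)) rho
  & {ae mu, forall x, A x -> rho x = (expR (gibbs_cocycle f x (g x)))%:E}.
Proof.
move=> [[mA mB] [gAB gI gS] gG mg mgE].
have Ad : A `<=` dyck by move=> x /gG [].
exists (fun x => (expR (gibbs_cocycle f x (g x)))%:E); last by apply: aeW.
pose Pc m := if size (src m) == size (tgt m) then
  [set x | [/\ A x, win x (pos m) (size (src m)) = src m & g x = subst (pos m) (tgt m)
    x]] else set0.
have mAg (V : set fullshift) : measurable V -> measurable (A `&` g @^-1` V) by exact: mg.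
have mP m : measurable (Pc m).
  rewrite /Pc; case: eqP => // _.
  (* The equality of two points is tested coordinate by coordinate and letter by letter, which makes
     it measurable. *)
  rewrite (_ : [set _ | _] = [set x | win x (pos m) (size (src m)) = src m] `&`
    [set x | forall k : int, (\big[setU/set0]_(l <- index_enum letter)
       ((A `&` g @^-1` [set y : fullshift | y k = l]) `&` subst (pos m) (tgt m) @^-1`
         [set y : fullshift | y k = l])) x]).
    apply: measurableI; first exact: (measurable_win (fun z => z = src m)).
    apply: measurable_forall_int => k; apply: bigsetU_measurable => l _.
    apply: measurableI; first by apply: mAg; exact: measurable_letter.
    exact: measurable_preimage (measurable_subst _ _) (measurable_letter k l).
  apply/seteqP; split=> x; rewrite /setI /mkset.
    move=> [Ax h1 h2]; split=> // k; rewrite -bigcup_seq; exists (g x k);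
      first by rewrite /= mem_index_enum.
    by split; [split | rewrite /preimage /mkset -h2].
  move=> [h1 h2]; split=> //.
    by have := h2 0; rewrite -bigcup_seq => -[l _ [[]]].
  apply/funext => k; have := h2 k; rewrite -bigcup_seq => -[l _ [[_ e1] e2]].
  by rewrite [LHS]e1 [RHS]e2.
have AP : A = \bigcup_m Pc m.
  apply/seteqP; split=> x; last by move=> [m _]; rewrite /Pc; case: ifP => // _ [].
  move=> Ax; have [N yE] := gibbs_relationP (gG x Ax).
  have [m [mN mu_ mv]] := stepP N (wide N x) (wide N (g x)).
  exists m => //; rewrite /Pc /pos mN mu_ mv !size_win eqxx; split=> //.
pose D m := expR (wt F (tgt m) - wt F (src m)).
have cD m x : Pc m x -> expR (gibbs_cocycle f x (g x)) = D m.
  rewrite /Pc; case: eqP => // uv [Ax xu gx]; have [dx dy _] := gG x Ax.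
  by rewrite gx in dy *; rewrite gibbs_cocycle_subst // -uv xu.
have mrho : measurable_fun A (fun x => (expR (gibbs_cocycle f x (g x)))%:E).
  move=> _ V mV.
  rewrite (_ : A `&` _ = \bigcup_m (Pc m `&` [set x | V (D m)%:E])).
    apply: bigcupT_measurable => m; apply: measurableI => //.
    have [h|h] := pselect (V (D m)%:E).
      by rewrite (_ : [set _ | _] = setT) //; apply/seteqP; split.
    by rewrite (_ : [set _ | _] = set0) //; apply/seteqP; split.
  apply/seteqP; split=> x; rewrite /preimage /mkset.
    move=> [Ax Vx]; have [m _ Px] : (\bigcup_m Pc m) x by rewrite -AP.
    by exists m => //; split=> //; rewrite /mkset -(cD m x Px).
  move=> [m _ [Px Vx]]; split; first by rewrite AP; exists m.
  by rewrite (cD m x Px).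
split; [exact: mrho | by move=> x _; rewrite lee_fin expR_ge0 |].
move=> E mE EA.
pose Q m := E `&` seqDU Pc m.
have mQ m : measurable (Q m).
  by apply: measurableI => //; apply: measurableD => //; apply: bigsetU_measurable => i _.
have QP m : Q m `<=` Pc m by move=> x [_ []].
have QA m : Q m `<=` A by move=> x [/EA].
have EQ : E = \bigcup_m Q m.
  by rewrite -setI_bigcupr -seqDU_bigcup_eq -AP setIidl.
have tQ : trivIset setT Q by apply: trivIset_setIl; exact: trivIset_seqDU.
have -> : (\int[mu]_(x in E) (expR (gibbs_cocycle f x (g x)))%:E =
    \sum_(m <oo) \int[mu]_(x in Q m) (expR (gibbs_cocycle f x (g x)))%:E)%E.
  rewrite {1}EQ ge0_integral_bigcup //.
  by rewrite -EQ; apply: measurable_funS mrho.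
have gQ m : measurable (g @` Q m) by apply: mgE.
have -> : g @` E = \bigcup_m (g @` Q m).
  rewrite EQ; apply/seteqP; split=> y.
    by move=> [x [m _ Qx] <-]; exists m => //; exists x.
  by move=> [m _ [x Qx <-]]; exists x => //; exists m.
rewrite measure_semi_bigcup //; last 2 first.
(* The images of disjoint pieces are disjoint because [g] is injective on [A]. *)
- move=> i j _ _ [y [[x Qx <-] [x' Qx' /gI xx']]]; apply: tQ => //.
  exists x; split=> //; rewrite -xx' ?inE //; [exact: QA Qx' | exact: QA Qx].
- exact: bigcupT_measurable.
apply: eq_eseriesr => m _.
rewrite (eq_integral (cst (D m)%:E)); last by move=> x /set_mem /QP /cD ->.
rewrite integral_cst //.
have [uv|uv] := eqVneq (size (src m)) (size (tgt m)); last first.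
  have Q0 : Q m = set0 by apply/seteqP; split=> x // /QP; rewrite /Pc (negbTE uv).
  by rewrite Q0 image_set0 measure0 mule0.
have QE x : Q m x -> [/\ A x, win x (pos m) (size (src m)) = src m & g x = subst (pos m)
  (tgt m) x].
  by move=> /QP; rewrite /Pc uv eqxx.
have := mu_exchange (pos m) uv (mQ m) (fun x h => Ad x (QA m x h)).
rewrite (_ : [set x | [/\ Q m x, _ & _]] = Q m); last first.
  apply/seteqP; split=> x; first by case.
  by move=> Qx; have [Ax h1 h2] := QE x Qx; split=> //; rewrite -h2; case: (gG x Ax).
move=> <-; congr (mu _); apply/seteqP; split=> y.
  move=> [x Qx <-]; have [Ax h1 h2] := QE x Qx; have [dx dy _] := gG x Ax.
  split=> //; rewrite h2; first exact: win_subst.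
  by rewrite subst_subst // -{1}h1 subst_win.
move=> [dy yv Qx]; exists (subst (pos m) (src m) y) => //.
have [_ _ ->] := QE _ Qx.
by rewrite subst_subst // -{1}yv subst_win.
Qed.

Lemma equilibrium_gibbs : gibbs_measure f mu.
Proof.
split; [by case: eq | exact: saturation_null | exact: holonomy_rn].
Qed.

End gibbs.

Theorem proposition6p1 (R : realType) (f : fullshift -> R)
    (hf : site_potential f) (mu : probability fullshift R) :
  equilibrium_measure f mu -> gibbs_measure f mu.
Proof.
case: hf => f1 [f2 [f3 [f4 fE]]].
pose F (l : letter) := match l with
  | Alpha false => f1 | Alpha true => f2
  | AlphaInv false => f3 | AlphaInv true => f4 end.
exact: (@equilibrium_gibbs R f F fE mu).
Qed.
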